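(* Let $\chi>0$, let $X$ be a complete geodesic metric space and let $\Delta\subseteq X$ be a nonempty closed convex subset. Assume: (A) every geodesic triangle in $X$ with a vertex in $\Delta$ (and of perimeter $<\operatorname{circum}X_\chi$) satisfies CAT($\chi$); (B) for every $c\in\Delta$, local geodesics in the metric completion $\overline{T_cX}$ of the tangent space $T_cX$ are unique (any two points of $\overline{T_cX}$ are joined by at most one local geodesic, up to affine reparameterization); (C) there exists $\lambda>0$ such that for all $x\in X-\Delta$, the closed ball with center $x$ and radius $\lambda\cdot d(x,\Delta)$ is complete and CAT($\chi$). Assume also that all of $X$ lies within $R<\frac14\operatorname{circum}X_\chi$ of some fixed point of $\Delta$. Then $X$ is CAT($\chi$).
   Context: ''Within $R$'' means at distance less than $R$. Geodesics. In a metric space $(X,d)$ a path $\gamma:I\to X$ on a compact interval is a geodesic (of speed $\sigma\ge0$) if $d(\gamma(s),\gamma(t))=\sigma|s-t|$ for all $s,t\in I$, and a local geodesic if this holds locally on $I$. $X$ is a geodesic space if any two points are joined by a geodesic. A subset $C\subseteq X$ is convex if any two of its points may be joined by a geodesic in $X$ and every geodesic of $X$ joining them lies in $C$. CAT($\chi$), $\chi>0$. $X_\chi$ is the sphere of radius $1/\sqrt\chi$ and $\operatorname{circum}X_\chi=2\pi/\sqrt\chi$. A geodesic triangle (three points and geodesics joining them in pairs) of perimeter $<\operatorname{circum}X_\chi$ has a comparison triangle, unique up to isometry: a geodesic triangle in $X_\chi$ with the same edge lengths. It satisfies CAT($\chi$) if for any two points $v',w'$ on edges of the comparison triangle the corresponding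 points $v,w$ of the original triangle satisfy $d_X(v,w)\le d_{X_\chi}(v',w')$. A geodesic space is CAT($\chi$) if every geodesic triangle of perimeter $<\operatorname{circum}X_\chi$ satisfies CAT($\chi$). Tangent space. For $x\in X$, a geodesic-germ at $x$ is an equivalence class of geodesics $[0,\epsilon]\to X$ ($\epsilon>0$) starting at $x$, two being equivalent if they agree near $0$ (constant geodesic allowed). Put $D(\gamma,\gamma')=\limsup_{t\to0}d(\gamma(t),\gamma'(t))/t$. $T_xX$ is the set of germs with germs at $D$-distance $0$ identified, with metric $D$. *)

(* Defs.v *)
From HB Require Import structures.
From mathcomp Require Import all_boot all_order all_algebra.
From mathcomp Require Import generic_quotient.
From mathcomp Require Import all_classical all_reals all_analysis.
From mathcomp Require Import ring lra.

Set Implicit Arguments.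
Unset Strict Implicit.
Unset Printing Implicit Defensive.

Import Order.TTheory GRing.Theory Num.Theory.
Import numFieldNormedType.Exports.

Local Open Scope classical_set_scope.
Local Open Scope quotient_scope.
Local Open Scope ring_scope.

Section metric_spaces.
Context {R : realType}.

(* A metric space need not be pointed, so this is the axiom of [completeType]
   with the limit existentially quantified. *)
Definition complete_metric (M : metricType R) : Prop :=
  forall F : set_system M, ProperFilter F -> cauchy F -> exists l : M, F --> l.

(* In a general metric space [closed_ball] is the closure of the open ball,
   which may be smaller than this set. *)
Definition mclosed_ball (M : metricType R) (x : M) (r : R) : set M :=
  [set y | mdist x y <= r].

(* The infimum is meant for nonempty A. *)
Definition mdist_set (M : metricType R) (x : M) (A : set M) : R :=
  inf [set mdist x y | y in A].

End metric_spaces.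

(* [set_type A] carries the metric induced from M. *)
Section submetric.
Context {R : realType} {M : metricType R} (A : set M).

Let sdist (x y : set_type A) : R := mdist (\val x) (\val y).

Let sdist_ge0 x y : 0 <= sdist x y.
Proof. exact: mdist_ge0. Qed.

Let sdist_positivity x y : sdist x y = 0 -> x = y.
Proof. by move=> /mdist_positivity /val_inj. Qed.

Let ballEsdist (x : set_type A) (d : R) : ball x d = [set y | sdist x y < d].
Proof.
have -> : ball x d = \val @^-1` (ball (\val x) d) by [].
by rewrite ballEmdist.
Qed.

HB.instance Definition _ := @PseudoMetric_isMetric.Build R (set_type A)
  sdist sdist_ge0 sdist_positivity ballEsdist.

End submetric.

Record pseudodist (R : realType) (T : Type) := Pseudodist {
  pdist :> T -> T -> R;
  pdistxx : forall x, pdist x x = 0;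
  pdist_sym : forall x y, pdist x y = pdist y x;
  pdist_triangle : forall y x z, pdist x z <= pdist x y + pdist y z }.

Section metric_quotient.
Context {R : realType} {T : Type} (d : pseudodist R T).

Lemma pdist_ge0 x y : 0 <= d x y.
Proof.
have := pdist_triangle d y x x; rewrite pdistxx (pdist_sym d y x) -mulr2n.
by rewrite pmulrn_lge0.
Qed.

Let rel0 (x y : {classic T}) : bool := d x y == 0.

Let rel0_refl : reflexive rel0.
Proof. by move=> x; rewrite /rel0 pdistxx. Qed.

Let rel0_sym : symmetric rel0.
Proof. by move=> x y; rewrite /rel0 pdist_sym. Qed.

Let rel0_trans : transitive rel0.
Proof.
move=> y x z /eqP xy /eqP yz; rewrite /rel0 eq_le pdist_ge0 andbT.
by have := pdist_triangle d y x z; rewrite xy yz addr0.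
Qed.

Definition dist0_rel := EquivRel rel0 rel0_refl rel0_sym rel0_trans.

Definition metric_quotient := {eq_quot dist0_rel}.

HB.instance Definition _ := Choice.on metric_quotient.
HB.instance Definition _ := EqQuotient.on metric_quotient.

Definition quotient_dist (a b : metric_quotient) : R := d (repr a) (repr b).

Let qdistxx a : quotient_dist a a = 0.
Proof. exact: pdistxx. Qed.

Let qdist_positivity a b : quotient_dist a b = 0 -> a = b.
Proof.
move=> ab; rewrite -[a]reprK -[b]reprK; apply/eqmodP => /=.
by apply/eqP.
Qed.

Let qdist_sym a b : quotient_dist a b = quotient_dist b a.
Proof. exact: pdist_sym. Qed.

Let qdist_triangle b a c :
  quotient_dist a c <= quotient_dist a b + quotient_dist b c.
Proof. exact: pdist_triangle. Qed.

HB.instance Definition _ := isMetric.Build R metric_quotient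
  qdistxx qdist_positivity qdist_sym qdist_triangle.

Lemma mdist_pi (x y : {classic T}) :
  mdist (\pi_metric_quotient x) (\pi_metric_quotient y) = d x y.
Proof.
have repr0 (z : {classic T}) : d (repr (\pi_metric_quotient z)) z = 0.
  by apply/eqP; have /eqmodP := reprK (\pi_metric_quotient z).
rewrite /mdist /= /quotient_dist.
set x' := repr _; set y' := repr _.
have x'x : d x' x = 0 by exact: repr0.
have y'y : d y' y = 0 by exact: repr0.
have xx' : d x x' = 0 by rewrite pdist_sym.
have yy' : d y y' = 0 by rewrite pdist_sym.
have := pdist_triangle d x' x y; have := pdist_triangle d y' x' y.
have := pdist_triangle d x x' y'; have := pdist_triangle d y x y'.
lra.
Qed.

End metric_quotient.

Section completion.
Context {R : realType} (M : metricType R).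

Record cauchy_seq := CauchySeq {
  cseq :> nat -> M;
  cseqP : cauchy (cseq @ \oo) }.

Definition cseq_dist (u v : cauchy_seq) : R :=
  lim (mdist (u n) (v n) @[n --> \oo]).

Lemma cseq_near (u : cauchy_seq) (e : R) : 0 < e ->
  exists N : nat, forall m n : nat, (N <= m)%N -> (N <= n)%N ->
    mdist (u m) (u n) < e.
Proof.
move=> e0; have /cauchy_ballP /(_ _ e0) := @cseqP u.
move=> [[A B] /= [[N1 _ A1] [N2 _ B2]] AB].
exists (maxn N1 N2) => m n; rewrite !geq_max => /andP[m1 m2] /andP[n1 n2].
by have := AB (u m, u n); rewrite /= ballEmdist; apply; split;
  [exact: A1|exact: B2].
Qed.

Lemma cseq_dist_cvg (u v : cauchy_seq) :
  mdist (u n) (v n) @[n --> \oo] --> cseq_dist u v.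
Proof.
apply: cauchy_cvg; apply/cauchy_exP => e e0.
have e20 : 0 < e / 2 by rewrite divr_gt0.
have [N uN] := cseq_near u e20; have [K vK] := cseq_near v e20.
pose L := maxn N K.
exists (mdist (u L) (v L)); exists L => //= n /=.
rewrite geq_max => /andP[Nn Kn]; rewrite /ball/=.
have [NL KL] : (N <= L)%N /\ (K <= L)%N by rewrite leq_maxl leq_maxr.
have h1 := uN _ _ NL Nn; have h2 := vK _ _ KL Kn.
have t1 := metric_triangle (u L) (u n) (v L).
have t2 := metric_triangle (u n) (v n) (v L).
have t3 := metric_triangle (u n) (u L) (v n).
have t4 := metric_triangle (u L) (v L) (v n).
rewrite (metric_sym (u n) (u L)) in t3.
rewrite (metric_sym (v n) (v L)) in t2.
rewrite ltr_norml; apply/andP; split; lra.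
Qed.

Let cseq_distxx u : cseq_dist u u = 0.
Proof.
rewrite /cseq_dist; under eq_fun do rewrite mdistxx.
exact: lim_cst.
Qed.

Let cseq_dist_sym u v : cseq_dist u v = cseq_dist v u.
Proof. by rewrite /cseq_dist; under eq_fun do rewrite metric_sym. Qed.

Let cseq_dist_triangle v u w :
  cseq_dist u w <= cseq_dist u v + cseq_dist v w.
Proof.
have uw := @cseq_dist_cvg u w.
have uvw : mdist (u n) (v n) + mdist (v n) (w n) @[n --> \oo] -->
    cseq_dist u v + cseq_dist v w.
  exact: (cvgD (@cseq_dist_cvg u v) (@cseq_dist_cvg v w)).
have : \forall n \near \oo,
    mdist (u n) (w n) <= mdist (u n) (v n) + mdist (v n) (w n).
  by apply: nearW => n; exact: metric_triangle.
exact: (ler_cvg_to uw uvw).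
Qed.

Definition cseq_pdist : pseudodist R cauchy_seq :=
  Pseudodist cseq_distxx cseq_dist_sym cseq_dist_triangle.

Definition metric_completion := metric_quotient cseq_pdist.

End completion.

Section geodesics.
Context {R : realType}.
Implicit Types (M : metricType R) (a b : R).

(* A path [a, b] -> M is represented by a function R -> M of which only the
   values on [a, b] matter. *)
Definition is_geodesic M a b (g : R -> M) : Prop :=
  a <= b /\ exists2 s : R, 0 <= s &
    forall t u, t \in `[a, b] -> u \in `[a, b] ->
      mdist (g t) (g u) = s * `|t - u|.

Definition is_local_geodesic M a b (g : R -> M) : Prop :=
  a <= b /\ exists2 s : R, 0 <= s &
    forall c, c \in `[a, b] -> exists2 e : R, 0 < e &
      forall t u, t \in `[a, b] -> u \in `[a, b] ->
        `|t - c| < e -> `|u - c| < e -> mdist (g t) (g u) = s * `|t - u|.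

Definition geodesic_space M : Prop :=
  forall p q : M, exists a b g, [/\ is_geodesic a b g, g a = p & g b = q].

Definition geodesically_convex M (C : set M) : Prop :=
  forall p q, C p -> C q ->
    (exists a b g, [/\ is_geodesic a b g, g a = p & g b = q]) /\
    (forall a b g, is_geodesic a b g -> g a = p -> g b = q ->
      forall t, t \in `[a, b] -> C (g t)).

(* Affine reparameterization is expressed by rescaling both paths to [0, 1]. *)
Definition unique_local_geodesics M : Prop :=
  forall (p q : M) a b a' b' (g g' : R -> M),
    is_local_geodesic a b g -> g a = p -> g b = q ->
    is_local_geodesic a' b' g' -> g' a' = p -> g' b' = q ->
    forall t, t \in `[0, 1] -> g (line_path a b t) = g' (line_path a' b' t).

End geodesics.

Section model_sphere.
Context {R : realType}.

Definition dot3 (p q : 'rV[R]_3) : R := \sum_i p 0 i * q 0 i.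

Record model_sphere (chi : R) := ModelSphere {
  sphere_pt : 'rV[R]_3;
  sphere_ptP : dot3 sphere_pt sphere_pt = (Num.sqrt chi)^-1 ^+ 2 }.

Definition circum (chi : R) : R := 2 * pi / Num.sqrt chi.

Let dot3E p q :
  dot3 p q = p 0 0 * q 0 0 + p 0 1 * q 0 1 + p 0 (1 + 1) * q 0 (1 + 1).
Proof.
rewrite /dot3 !big_ord_recl big_ord0 addr0 addrA.
by congr (_ * _ + _ * _ + _ * _); congr (_ _ _); apply: val_inj.
Qed.

Let dot3C p q : dot3 p q = dot3 q p.
Proof. by rewrite !dot3E; ring. Qed.

Let dot3_CS p q : (dot3 p q) ^+ 2 <= dot3 p p * dot3 q q.
Proof.
rewrite !dot3E -subr_ge0.
set a := p 0 0; set b := p 0 1; set c := p 0 _.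
set x := q 0 0; set y := q 0 1; set z := q 0 _.
have -> : (a * a + b * b + c * c) * (x * x + y * y + z * z) -
   (a * x + b * y + c * z) ^+ 2 =
   (a * y - b * x) ^+ 2 + (a * z - c * x) ^+ 2 + (b * z - c * y) ^+ 2 by ring.
by rewrite !addr_ge0 ?sqr_ge0.
Qed.

Let gram p q r : 0 <= dot3 p p * dot3 q q * dot3 r r
  + dot3 p q * dot3 q r * dot3 p r *+ 2 - dot3 p p * dot3 q r ^+ 2
  - dot3 q q * dot3 p r ^+ 2 - dot3 r r * dot3 p q ^+ 2.
Proof.
rewrite !dot3E.
set a := p 0 0; set b := p 0 1; set c := p 0 _.
set x := q 0 0; set y := q 0 1; set z := q 0 _.
set u := r 0 0; set v := r 0 1; set w := r 0 _.
rewrite [leRHS](_ : _ =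
  (a * (y * w - z * v) - b * (x * w - z * u) + c * (x * v - y * u)) ^+ 2).
  exact: sqr_ge0.
by ring.
Qed.

Let dot3_eq p q : dot3 p p = dot3 q q -> dot3 p q = dot3 p p -> p = q.
Proof.
move=> pq pqp.
have : dot3 p p - dot3 p q *+ 2 + dot3 q q = 0 by rewrite -pq pqp; ring.
rewrite !dot3E.
set a := p 0 0; set b := p 0 1; set c := p 0 _.
set x := q 0 0; set y := q 0 1; set z := q 0 _.
move=> H.
have {H} : (a - x) ^+ 2 + (b - y) ^+ 2 + (c - z) ^+ 2 = 0.
  by rewrite -[RHS]H; ring.
move/eqP; rewrite paddr_eq0 ?addr_ge0 ?sqr_ge0// paddr_eq0 ?sqr_ge0//.
rewrite !sqrf_eq0 !subr_eq0 => /andP[/andP[/eqP ax /eqP b_y] /eqP cz].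
apply/rowP => i.
have [->//|->//|->//] : [\/ i = 0, i = 1 | i = 1 + 1].
case: i => -[|[|[|]]]// i3; [apply: Or31|apply: Or32|apply: Or33];
  exact: val_inj.
Qed.

Context (chi : R).
Implicit Types p q r : model_sphere chi.

(* The length of the shorter great-circle arc from p to q: the radius
   1 / sqrt chi times the angle between p and q. *)
Definition sphere_dist p q : R :=
  (Num.sqrt chi)^-1 * acos (Num.sqrt chi ^+ 2 * dot3 (sphere_pt p) (sphere_pt q)).

Let k : R := Num.sqrt chi.

Let k_gt0 : k != 0 -> 0 < k.
Proof. by move=> k0; rewrite lt_def k0 sqrtr_ge0. Qed.

Let sphere_pt_inj p q : sphere_pt p = sphere_pt q -> p = q.
Proof.
by case: p q => [p hp] [q hq] /= pq; subst q; congr ModelSphere;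
  exact: Prop_irrelevance.
Qed.

Let normdot p : k != 0 -> k ^+ 2 * dot3 (sphere_pt p) (sphere_pt p) = 1.
Proof. by move=> k0; rewrite sphere_ptP -/k exprVn mulfV// expf_neq0. Qed.

Let dot_bound p q : k != 0 ->
  -1 <= k ^+ 2 * dot3 (sphere_pt p) (sphere_pt q) <= 1.
Proof.
move=> k0; rewrite -ler_norml -[leRHS]normr1 -ler_sqr ?nnegrE// !real_normK//.
  rewrite expr1n exprMn.
  have := dot3_CS (sphere_pt p) (sphere_pt q).
  have : 0 <= (k ^+ 2) ^+ 2 by exact: sqr_ge0.
  move=> /ler_wpM2l /[apply] /le_trans; apply.
  rewrite [leLHS](_ : _ = (k ^+ 2 * dot3 (sphere_pt p) (sphere_pt p)) *
    (k ^+ 2 * dot3 (sphere_pt q) (sphere_pt q))); last by ring.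
  by rewrite !normdot// mulr1.
all: exact: num_real.
Qed.

Let sphere_distxx p : sphere_dist p p = 0.
Proof.
rewrite /sphere_dist -/k; have [->|k0] := eqVneq k 0; first by rewrite invr0 mul0r.
by rewrite normdot// acos1 mulr0.
Qed.

Let sphere_dist_positivity p q : sphere_dist p q = 0 -> p = q.
Proof.
move=> /eqP; rewrite /sphere_dist -/k mulf_eq0 invr_eq0 => /orP[/eqP k0|].
  apply: sphere_pt_inj; apply: dot3_eq; first by rewrite !sphere_ptP.
  have := dot3_CS (sphere_pt p) (sphere_pt q).
  rewrite !sphere_ptP -/k k0 invr0 expr0n/= mul0r => h.
  by apply/eqP; rewrite -sqrf_eq0 eq_le h sqr_ge0.
have [k0|k0] := eqVneq k 0.
  move=> _; apply: sphere_pt_inj; apply: dot3_eq; first by rewrite !sphere_ptP.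
  have := dot3_CS (sphere_pt p) (sphere_pt q).
  rewrite !sphere_ptP -/k k0 invr0 expr0n/= mul0r => h.
  by apply/eqP; rewrite -sqrf_eq0 eq_le h sqr_ge0.
move=> /eqP acos0; apply: sphere_pt_inj; apply: dot3_eq.
  by rewrite !sphere_ptP.
have := acosK (x := k ^+ 2 * dot3 (sphere_pt p) (sphere_pt q)).
rewrite acos0 cos0 in_itv/= dot_bound// => /(_ isT) /esym.
rewrite -(normdot p k0) => /mulfI; apply.
by rewrite expf_neq0.
Qed.

Let sphere_dist_sym p q : sphere_dist p q = sphere_dist q p.
Proof. by rewrite /sphere_dist dot3C. Qed.

Let sphere_dist_triangle q p r :
  sphere_dist p r <= sphere_dist p q + sphere_dist q r.
Proof.
rewrite /sphere_dist -/k -mulrDr; have [->|k0] := eqVneq k 0.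
  by rewrite invr0 !mul0r.
apply: ler_wpM2l; first by rewrite invr_ge0 sqrtr_ge0.
have xb := dot_bound p q k0; have yb := dot_bound q r k0.
have zb := dot_bound p r k0.
have : 0 <= 1 + (k ^+ 2 * dot3 (sphere_pt p) (sphere_pt q)) *
  (k ^+ 2 * dot3 (sphere_pt q) (sphere_pt r)) *
  (k ^+ 2 * dot3 (sphere_pt p) (sphere_pt r)) *+ 2
  - (k ^+ 2 * dot3 (sphere_pt q) (sphere_pt r)) ^+ 2
  - (k ^+ 2 * dot3 (sphere_pt p) (sphere_pt r)) ^+ 2
  - (k ^+ 2 * dot3 (sphere_pt p) (sphere_pt q)) ^+ 2.
  have := gram (sphere_pt p) (sphere_pt q) (sphere_pt r).
  have k6 : 0 <= (k ^+ 3) ^+ 2 by exact: sqr_ge0.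
  move=> /(mulr_ge0 k6); rewrite !sphere_ptP -/k; set a := dot3 _ _.
  set b := dot3 _ _; set c := dot3 _ _.
  by congr (_ <= _); field.
move: xb yb zb.
set x := _ * dot3 (sphere_pt p) (sphere_pt q).
set y := _ * dot3 (sphere_pt q) (sphere_pt r).
set z := _ * dot3 (sphere_pt p) (sphere_pt r).
move=> xb yb zb G.
have [piab|abpi] := leP pi (acos x + acos y).
  by apply: le_trans piab; exact: acos_lepi.
rewrite leNgt; apply/negP => abz.
have : cos (acos z) < cos (acos x + acos y).
  rewrite ltr_cos// in_itv/= ?acos_ge0 ?acos_lepi//.
  by rewrite addr_ge0 ?acos_ge0// ltW.
rewrite cosD !acosK ?in_itv//= ltNge => /negP; apply.
rewrite lerBlDr -lerBlDl.
have sxy : 0 <= sin (acos x) * sin (acos y).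
  by rewrite mulr_ge0// sin_ge0_pi// acos_ge0// acos_lepi.
have [h|h] := leP (x * y - z) 0; first exact: le_trans h sxy.
rewrite -ler_sqr ?nnegrE ?(ltW h)// exprMn !sin2cos2 !acosK ?in_itv//=.
by rewrite -subr_ge0; move: G; congr (_ <= _); ring.
Qed.

HB.instance Definition _ := gen_eqMixin (model_sphere chi).
HB.instance Definition _ := gen_choiceMixin (model_sphere chi).
HB.instance Definition _ := isMetric.Build R (model_sphere chi)
  sphere_distxx sphere_dist_positivity sphere_dist_sym sphere_dist_triangle.

End model_sphere.

Section cat.
Context {R : realType}.
Implicit Types (M : metricType R) (chi : R).

(* The edges are parameterized on [0, 1]; edge i goes from vertex i to vertex
   i + 1 modulo 3. *)
Record geodesic_triangle M := GeodesicTriangle {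
  edge :> 'I_3 -> R -> M;
  edge_geodesic : forall i, is_geodesic 0 1 (edge i);
  edge_joined : forall i, edge i 1 = edge (ordS i) 0 }.

Definition vertex M (T : geodesic_triangle M) (i : 'I_3) : M := T i 0.

Definition edge_length M (T : geodesic_triangle M) (i : 'I_3) : R :=
  mdist (T i 0) (T i 1).

Definition perimeter M (T : geodesic_triangle M) : R :=
  \sum_(i < 3) edge_length T i.

Definition is_comparison chi M (T : geodesic_triangle M)
    (T' : geodesic_triangle (model_sphere chi)) : Prop :=
  forall i, edge_length T' i = edge_length T i.

(* Edges have constant speed, so corresponding points are those with the same
   edge and parameter. When [perimeter T < circum chi] a comparison triangle
   exists and is unique up to isometry. *)
Definition satisfies_CAT chi M (T : geodesic_triangle M) : Prop :=
  forall T' : geodesic_triangle (model_sphere chi), is_comparison T T' ->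
  forall i j s t, s \in `[0, 1] -> t \in `[0, 1] ->
    mdist (T i s) (T j t) <= mdist (T' i s) (T' j t).

Definition CAT chi M : Prop :=
  geodesic_space M /\
  forall T : geodesic_triangle M, perimeter T < circum chi ->
    satisfies_CAT chi T.

End cat.

Section tangent_space.
Context {R : realType} {X : metricType R} (x : X).

(* The domain [0, e] is left unspecified: only the germ at 0 is used. *)
Record geodesic_from := GeodesicFrom {
  gfun :> R -> X;
  gfun0 : gfun 0 = x;
  gfunP : exists2 e : R, 0 < e & is_geodesic 0 e gfun }.

Let same_germ (g h : {classic geodesic_from}) : bool :=
  `[< exists2 e : R, 0 < e & forall t, t \in `[0, e] ->
      (g : geodesic_from) t = (h : geodesic_from) t >].

Let same_germ_refl : reflexive same_germ.
Proof. by move=> g; apply/asboolP; exists 1. Qed.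

Let same_germ_sym : symmetric same_germ.
Proof.
by move=> g h; apply/asboolP/asboolP => -[e e0 gh]; exists e => // t te;
  rewrite gh.
Qed.

Let same_germ_trans : transitive same_germ.
Proof.
move=> h g f /asboolP[e e0 gh] /asboolP[e' e'0 hf]; apply/asboolP.
exists (Num.min e e'); first by rewrite lt_min e0.
move=> t; rewrite in_itv/= le_min => /and3P[t0 te te'].
by rewrite gh ?hf// in_itv/= t0.
Qed.

Definition germ_rel := EquivRel same_germ same_germ_refl same_germ_sym
  same_germ_trans.

Definition geodesic_germ := {eq_quot germ_rel}.

HB.instance Definition _ := Choice.on geodesic_germ.
HB.instance Definition _ := EqQuotient.on geodesic_germ.

Definition geodesic_elimsup (g h : geodesic_from) : \bar R :=
  limf_esup (fun t : R => (mdist (g t) (h t) / t)%:E) 0^'+.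

(* The limsup is finite, being at most the sum of the speeds. *)
Definition geodesic_limsup (g h : geodesic_from) : R :=
  fine (geodesic_elimsup g h).

Let elimsup_le (g h : geodesic_from) (c : R) :
  (\forall t \near 0^'+, mdist (g t) (h t) / t <= c) ->
  (geodesic_elimsup g h <= c%:E)%E.
Proof.
move=> gh; apply: ge_ereal_inf.
exists (ereal_sup ((fun t : R => (mdist (g t) (h t) / t)%:E) @`
  [set t | mdist (g t) (h t) / t <= c])); first by exists [set t | mdist (g t) (h t) / t <= c].
by apply: ge_ereal_sup => _ [t /= tc <-]; rewrite lee_fin.
Qed.

Let elimsup_lt (g h : geodesic_from) (c : R) : (geodesic_elimsup g h < c%:E)%E ->
  \forall t \near 0^'+, mdist (g t) (h t) / t <= c.
Proof.
move=> /ereal_inf_lt[_ [V FV <-] Vc].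
near=> t.
rewrite -lee_fin; apply: le_trans (ltW Vc); apply: ereal_sup_ubound.
by exists t => //; near: t.
Unshelve. all: by end_near. Qed.

Let elimsup_ge0 (g h : geodesic_from) : (0 <= geodesic_elimsup g h)%E.
Proof.
rewrite leNgt; apply/negP => gh.
have [c c0 ghc] : exists2 c : R, c < 0 & (geodesic_elimsup g h < c%:E)%E.
  case: geodesic_elimsup gh => [r| |]//.
    by rewrite lte_fin => r0; exists (r / 2); rewrite ?lte_fin; lra.
  by move=> _; exists (-1) => //; rewrite ?ltNyr// ltrN10.
have near_le := elimsup_lt ghc.
near (0 : R)^'+ => t.
have : mdist (g t) (h t) / t <= c by near: t.
apply/negP; rewrite -ltNge; apply: lt_le_trans c0 _.
by rewrite divr_ge0 ?mdist_ge0.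
Unshelve. all: by end_near. Qed.

Let elimsup_fin (g h : geodesic_from) : geodesic_elimsup g h \is a fin_num.
Proof.
have [[e e0 [_ [s s0 gs]]] [e' e'0 [_ [s' s'0 hs]]]] := (gfunP g, gfunP h).
rewrite ge0_fin_numE ?elimsup_ge0//.
apply: (@le_lt_trans _ _ (s + s')%:E); last exact: ltry.
apply: elimsup_le; near=> t.
have t0 : 0 < t by [].
have te : t <= e by near: t; exact: nbhs_right_le.
have te' : t <= e' by near: t; exact: nbhs_right_le.
rewrite ler_pdivrMr//.
have := metric_triangle (g t) (g 0) (h t).
rewrite gs ?in_itv/= ?(ltW t0) ?te ?lexx ?(ltW e0)//.
rewrite gfun0 -(gfun0 h) hs ?in_itv/= ?(ltW t0) ?te' ?lexx ?(ltW e'0)//.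
by rewrite subr0 sub0r normrN gtr0_norm// mulrDl.
Unshelve. all: by end_near. Qed.

Let limsupE (g h : geodesic_from) :
  geodesic_elimsup g h = (geodesic_limsup g h)%:E.
Proof. by rewrite fineK. Qed.

Let limsupxx g : geodesic_limsup g g = 0.
Proof.
apply/eqP; rewrite eq_le -!lee_fin -!limsupE elimsup_ge0 andbT.
by apply: elimsup_le; near=> t; rewrite mdistxx mul0r.
Unshelve. all: by end_near. Qed.

Let limsup_sym g h : geodesic_limsup g h = geodesic_limsup h g.
Proof.
rewrite /geodesic_limsup /geodesic_elimsup.
by under [in LHS]eq_fun do rewrite metric_sym.
Qed.

Let limsup_triangle h g f :
  geodesic_limsup g f <= geodesic_limsup g h + geodesic_limsup h f.
Proof.
apply/ler_addgt0Pl => e e0; rewrite -lee_fin -limsupE.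
have nh : (geodesic_elimsup g h < (geodesic_limsup g h + e / 2)%:E)%E.
  by rewrite limsupE lte_fin; lra.
have nf : (geodesic_elimsup h f < (geodesic_limsup h f + e / 2)%:E)%E.
  by rewrite limsupE lte_fin; lra.
have {}nh := elimsup_lt nh; have {}nf := elimsup_lt nf.
apply: elimsup_le; near=> t.
have t0 : 0 < t by [].
have h1 : mdist (g t) (h t) / t <= geodesic_limsup g h + e / 2 by near: t.
have h2 : mdist (h t) (f t) / t <= geodesic_limsup h f + e / 2 by near: t.
have : mdist (g t) (f t) / t <= mdist (g t) (h t) / t + mdist (h t) (f t) / t.
  by rewrite -mulrDl ler_pM2r ?invr_gt0// metric_triangle.
lra.
Unshelve. all: by end_near. Qed.

Lemma geodesic_limsup_germ (g g' h h' : {classic geodesic_from}) :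
  g = g' %[mod geodesic_germ] -> h = h' %[mod geodesic_germ] ->
  geodesic_limsup g h = geodesic_limsup g' h'.
Proof.
have limsup0 (u v : {classic geodesic_from}) : u = v %[mod geodesic_germ] ->
    geodesic_limsup u v = 0.
  move=> /eqmodP/asboolP[e e0 uv].
  apply/eqP; rewrite eq_le -!lee_fin -!limsupE elimsup_ge0 andbT.
  apply: elimsup_le; near=> t; rewrite uv ?mdistxx ?mul0r// in_itv/=.
  by apply/andP; split; [|near: t; exact: nbhs_right_le].
move=> /limsup0 gg' /limsup0 hh'.
have := limsup_triangle g' g h; have := limsup_triangle h' g' h.
have := limsup_triangle g g' h'; have := limsup_triangle h g h'.
rewrite (limsup_sym g' g) (limsup_sym h' h) gg' hh'.
lra.
Unshelve. all: by end_near. Qed.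

Definition germ_dist (a b : geodesic_germ) : R :=
  geodesic_limsup (repr a) (repr b).

Definition germ_pdist : pseudodist R geodesic_germ :=
  @Pseudodist R geodesic_germ germ_dist (fun a => limsupxx (repr a))
    (fun a b => limsup_sym (repr a) (repr b))
    (fun b a c => limsup_triangle (repr b) (repr a) (repr c)).

Definition tangent_space := metric_quotient germ_pdist.

End tangent_space.

(* Main.v *)
From HB Require Import structures.
Require Import Defs.
From mathcomp Require Import all_boot all_order all_algebra.
From mathcomp Require Import generic_quotient.
From mathcomp Require Import all_classical all_reals all_analysis.
From mathcomp Require Import ring lra.

(** The space [X], rescaled by [sqrt chi], lies in an open hemisphere about a point
    [o] of [Delta]. In the Euclidean cone over it consider the part beyond a
    hyperplane orthogonal to [o]. This part is complete and avoids the apex, and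
    spherical comparison for a triangle of [X] amounts to comparison with the
    Euclidean plane, the inequality [cn_ineq], for the triangles of the cone above it
    ([lift_cn], [lift_cmp]). The passage to nonpositive curvature provides the
    homotheties on which the argument rests. The points over [Delta] form a closed
    convex core. By the first hypothesis comparison holds for triangles with a vertex
    in the core, so that homotheties centred at a core point multiply distances at
    most by their ratio ([homothety]); by the third it holds in balls of radius
    proportional to the distance from the core ([cone_cn_ball]).

    It remains to prove comparison in such a space ([cn_everywhere]). The squared
    distance from [p] has to be sufficiently convex along a side, which is a local
    question at each point [q] of this side. If the segment from [q] to [p] meets the
    core, triangles with a vertex in the core suffice. Otherwise the segment is
    covered by balls in which comparison holds, and estimates of the energy of a chain
    of points along it ([energy_shortened]) give the desired convexity, provided that
    a local geodesic obtained by moving the ends of a segment is again a segment.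

    So the heart of the proof is that local geodesics that avoid the core are unique
    ([curve_length_unique]). Let two of them join [x] to [y]. Choose a core point [c]
    for which the detour from [x] to [y] through [c] is almost the shortest, and
    contract towards [c] by a ratio [th] close to [1]. The contracted curve is close to
    a local geodesic between the contracted ends, found by moving the ends of a chain
    and shorter than the old one by the factor [th] ([contract_step]). As it is shorter
    than all detours, it stays away from the core, relatively to the scale, and the
    contraction can be repeated indefinitely. The energies, divided by the squares of
    the scales, decrease and converge, so that the curves converge, seen at the scale
    of the contraction, to a local geodesic of the tangent cone at [c]
    ([contraction_asymptotic]). The tangent cone is the product of the tangent space of
    [X] and a line ([seg_dist_first_order]); a local geodesic of its completion has an
    affine component in the line and a component which is a local geodesic
    ([product_geodesic]), unique by the second hypothesis. Hence the two sequences of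
    curves are eventually as close as desired compared with the scale
    ([blow_up_unique]), therefore equal by local uniqueness ([chain_unique]), and
    equality propagates back through the contractions to the two given curves
    ([contraction_sequences_agree]). *)

Set Implicit Arguments.
Unset Strict Implicit.
Unset Printing Implicit Defensive.

Import Order.TTheory GRing.Theory Num.Theory.
Import numFieldNormedType.Exports.

Local Open Scope classical_set_scope.
Local Open Scope ring_scope.

(** * Local midpoint convexity *)

Section real_functions.
Context {R : realType}.
Implicit Types f : R -> R.

Lemma lipschitz01_continuous f (K : R) :
  (forall s t, 0 <= s <= 1 -> 0 <= t <= 1 -> `|f s - f t| <= K * `|s - t|) ->
  {within `[0, 1], continuous f}.
Proof.
move=> fK; apply/subspace_continuousP => x; rewrite /= in_itv/= => x01.
apply/cvgrPdist_lt => e e0.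
pose K' := `|K| + 1.
have K'0 : 0 < K' by rewrite ltr_wpDl.
near=> y.
have y01 : 0 <= y <= 1.
  have : `[0, 1]%classic y by near: y; exact: withinT.
  by rewrite /= in_itv.
have xy : `|x - y| < e / K'.
  near: y; apply: cvg_within; rewrite -/(ball x (e / K')).
  by apply: nbhsx_ballx; rewrite divr_gt0.
apply: le_lt_trans (fK _ _ x01 y01) _.
apply: (@le_lt_trans _ _ (K' * `|x - y|)).
  by rewrite ler_wpM2r// (le_trans (ler_norm _))// lerDl.
by rewrite mulrC -ltr_pdivlMr.
Unshelve. all: by end_near. Qed.

(** At an interior maximum of [f] minus its chord minus the strictly concave
    [e * t * (1 - t)], the local inequality would be violated by [e * n ^ 2];
    so [f] minus its chord is at most [e / 4] for every [e > 0]. *)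
Lemma local_midpoint_convex f (K : R) :
  (forall s t, 0 <= s <= 1 -> 0 <= t <= 1 -> `|f s - f t| <= K * `|s - t|) ->
  (forall t, 0 < t < 1 -> exists2 e, 0 < e & forall n, 0 < n < e ->
     f t <= (f (t - n) + f (t + n)) / 2) ->
  forall t, 0 <= t <= 1 -> f t <= (1 - t) * f 0 + t * f 1.
Proof.
move=> fK fm t t01.
apply/ler_addgt0Pr => e e0.
pose g s := f s - ((1 - s) * f 0 + s * f 1) - e * (s * (1 - s)).
suff : g t <= 0.
  have : t * (1 - t) <= 1 by nra.
  have := e0; rewrite /g; nra.
have gK : {within `[0, 1], continuous g}.
  apply: (@lipschitz01_continuous _ (K + (`|f 0| + `|f 1|) + e)) => s u s01 u01.
  have h1 := fK _ _ s01 u01.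
  have h2 : `|(s - u) * (f 0 - f 1)| <= (`|f 0| + `|f 1|) * `|s - u|.
    by rewrite normrM mulrC ler_wpM2r// ler_normB.
  have h3 : `|e * ((s - u) * (1 - (s + u)))| <= e * `|s - u|.
    rewrite normrM gtr0_norm// normrM ler_wpM2l ?(ltW e0)//.
    by rewrite ler_piMr// ler_norml; lra.
  have -> : g s - g u = ((f s - f u) + (s - u) * (f 0 - f 1))
     - e * ((s - u) * (1 - (s + u))) by rewrite /g; ring.
  have := ler_normB ((f s - f u) + (s - u) * (f 0 - f 1))
     (e * ((s - u) * (1 - (s + u)))).
  have := ler_normD (f s - f u) ((s - u) * (f 0 - f 1)).
  lra.
have [m m01 gm] := @EVT_max _ _ _ _ ler01 gK.
have {}gm s : 0 <= s <= 1 -> g s <= g m by move=> s01; apply: gm; rewrite in_itv.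
apply: (le_trans (gm _ t01)).
move: m01; rewrite in_itv/= => /andP[m0 m1].
have [->|m0'] := eqVneq m 0; first by rewrite /g; lra.
have [->|m1'] := eqVneq m 1; first by rewrite /g; lra.
have m01 : 0 < m < 1 by rewrite !lt_neqAle m0 m1 eq_sym m0' m1'.
have [n n0 nm] := fm _ m01.
pose n' := Num.min (n / 2) (Num.min m (1 - m)).
have n'0 : 0 < n' by rewrite !lt_min; apply/and3P; split; lra.
have [h1 [h2 h3]] : n' <= n / 2 /\ n' <= m /\ n' <= 1 - m.
  by rewrite /n' !ge_min !lexx !orbT.
have g1 := gm (m - n') ltac:(lra); have g2 := gm (m + n') ltac:(lra).
have := nm n' ltac:(lra).
have := mulr_gt0 e0 (exprn_gt0 2 n'0).
move: g1 g2; rewrite /g; nra.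
Qed.

End real_functions.


(** * Nonpositive curvature relative to a convex set *)

Section relative_cat0_definition.
Context {R : realType} {Y : metricType R}.
Local Notation d := mdist.
Implicit Types (p a b m c x y z : Y) (D : set Y) (seg : Y -> Y -> R -> Y).

(** The comparison with the Euclidean plane for the triangle [p a b] and the point
    that divides [a b] in the ratio [t : 1 - t]; in the plane it is an equality. *)
Definition cn_ineq p a b m (t : R) : Prop :=
  d p m ^+ 2 <= (1 - t) * d p a ^+ 2 + t * d p b ^+ 2 - t * (1 - t) * d a b ^+ 2.

(** The scale [N^-1] on which the path is geodesic is uniform: it has to survive
    limits of sequences of paths. *)
Definition local_geodesic_at (N : nat) (L : R) (F : R -> Y) : Prop :=
  forall s t, 0 <= s <= 1 -> 0 <= t <= 1 -> `|s - t| <= N%:R^-1 ->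
    d (F s) (F t) = L * `|s - t|.

(** Paths that join the images of [x] and [y] under the homotheties of ratios
    [th ^+ j] centred at [c] and that become invariant under these homotheties: at
    the scale [th ^+ j] they converge to a local geodesic of the tangent cone
    at [c], here expressed without the tangent cone. *)
Definition asymptotic_geodesics seg c x y (th : R) (F : nat -> R -> Y) : Prop :=
  [/\ forall j, F j 0 = seg c x (th ^+ j) /\ F j 1 = seg c y (th ^+ j),
      forall e : R, 0 < e -> exists J : nat, forall (j i : nat) (s : R), (J <= j)%N -> 0 <= s <= 1 ->
        d (seg c (F j s) (th ^+ i)) (F (j + i)%N s) <= e * th ^+ (j + i) &
      exists N : nat, exists l : nat -> R, exists l0 : R,
        [/\ (0 < N)%N, forall j, local_geodesic_at N (l j) (F j) &
          forall e : R, 0 < e -> exists J : nat, forall j : nat, (J <= j)%N ->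
            `|l j / th ^+ j - l0| <= e]].

(** The core [D] is a closed convex set. Comparison holds for triangles with a
    vertex in [D] that are thin, and inside the balls whose radius is a fixed
    proportion of the distance from the core. *)
Record locally_relative_cat0 D seg : Prop := LocallyRelativeCat0 {
  seg0 : forall a b, seg a b 0 = a;
  seg1 : forall a b, seg a b 1 = b;
  segd : forall a b (s t : R), 0 <= s <= 1 -> 0 <= t <= 1 ->
    d (seg a b s) (seg a b t) = `|s - t| * d a b;
  core_nonempty : exists c, D c;
  core_closed : forall z, (forall e : R, 0 < e -> exists2 c, D c & d z c < e) -> D z;
  core_convex : forall a b (t : R), D a -> D b -> 0 <= t <= 1 -> D (seg a b t);
  cauchy_complete : forall u : nat -> Y,
    (forall e : R, 0 < e -> exists N : nat, forall m n : nat, (N <= m)%N -> (N <= n)%N ->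
       d (u m) (u n) < e) ->
    exists l, forall e : R, 0 < e -> exists N : nat, forall n : nat, (N <= n)%N -> d (u n) l < e;
  cn_vertex_small : exists2 e : R, 0 < e & forall c a b (s u t : R), D c ->
    0 <= s <= 1 -> 0 <= u <= 1 -> s <= u -> 0 <= t <= 1 ->
    d (seg a b s) (seg a b u) < e ->
    cn_ineq c (seg a b s) (seg a b u) (seg a b ((1 - t) * s + t * u)) t;
  cn_side_small : exists2 e : R, 0 < e & forall c p b (s t : R), D c -> d p b < e ->
    0 <= s <= 1 -> 0 <= t <= 1 -> cn_ineq (seg c p s) c b (seg c b t) t;
  cn_ball : exists2 lam : R, 0 < lam & forall z (r : R), (forall c, D c -> r <= lam * d z c) ->
    forall p a b (t : R), d z p <= r -> d z a <= r -> d z b <= r -> 0 <= t <= 1 ->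
    cn_ineq p a b (seg a b t) t }.

Record relative_cat0 D seg : Prop := RelativeCat0 {
  relative_cat0_local :> locally_relative_cat0 D seg;
  asymptotic_unique : forall c x y (th : R) F F', D c -> 0 < th < 1 ->
    asymptotic_geodesics seg c x y th F -> asymptotic_geodesics seg c x y th F' ->
    forall s : R, 0 <= s <= 1 -> forall e : R, 0 < e -> exists J : nat, forall j : nat, (J <= j)%N ->
      d (F j s) (F' j s) <= e * th ^+ j }.

End relative_cat0_definition.

Section metric_facts.
Context {R : realType} {Y : metricType R}.
Local Notation d := mdist.

Lemma le_of_sqr (a b : R) : 0 <= b -> a ^+ 2 <= b ^+ 2 -> a <= b.
Proof. by move=> b0 ab; rewrite leNgt; apply/negP => ba; nra. Qed.

Lemma steps_energy (u e : nat -> R) n :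
  (forall i, (i < n)%N -> `|u i.+1 - u i| <= e i) ->
  (u n - u 0%N) ^+ 2 <= n%:R * \sum_(i < n) e i ^+ 2.
Proof.
elim: n => [|n IH] ue; first by rewrite subrr big_ord0 expr0n mulr0.
have {}IH := IH (fun i i_n => ue i (leqW i_n)).
rewrite big_ord_recr /=; move: IH; set S := \sum_(_ < n) _ => IH.
have S0 : 0 <= S by apply: sumr_ge0 => i _; exact: sqr_ge0.
have := ue n (leqnn _); rewrite ler_norml -natr1.
have n0 : 0 <= n%:R :> R by [].
move: n0 IH; set N := n%:R; set x := u n - _; set y := e n => n0 IH uy.
have [N0|N0] := eqVneq N 0.
  have : x = 0 by apply/eqP; rewrite -sqrf_eq0; apply/eqP; nra.
  rewrite /x N0 => /eqP; rewrite subr_eq0 => /eqP unu0.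
  by move: uy; rewrite -unu0; nra.
have Np : 0 < N by rewrite lt_def N0.
have sq : 0 <= (x - N * (u n.+1 - u n)) ^+ 2 by exact: sqr_ge0.
have z : (u n.+1 - u n) ^+ 2 <= y ^+ 2 by nra.
have -> : u n.+1 - u 0%N = x + (u n.+1 - u n) by rewrite /x; ring.
move: sq z; set z := u n.+1 - u n => sq zy.
rewrite -(ler_pM2l Np).
have : (N + 1) * x ^+ 2 <= (N + 1) * (N * S) by rewrite ler_wpM2l//; lra.
have : N * (N + 1) * z ^+ 2 <= N * (N + 1) * y ^+ 2.
  by rewrite ler_wpM2l// mulr_ge0; lra.
lra.
Qed.

Lemma path_energy (w : nat -> Y) n :
  d (w 0%N) (w n) ^+ 2 <= n%:R * \sum_(i < n) d (w i) (w i.+1) ^+ 2.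
Proof.
have := @steps_energy (fun i => d (w 0%N) (w i)) (fun i => d (w i) (w i.+1)) n.
rewrite mdistxx subr0; apply => i _; rewrite ler_norml.
have := metric_triangle (w 0%N) (w i) (w i.+1).
have := metric_triangle (w 0%N) (w i.+1) (w i).
by rewrite (metric_sym (w i.+1)); lra.
Qed.

End metric_facts.

Section relative_cat0_theory.
Context {R : realType} {Y : metricType R} (D : set Y) (seg : Y -> Y -> R -> Y).
Hypothesis H : locally_relative_cat0 D seg.
Local Notation d := mdist.
Implicit Types (p a b m c x y z : Y).

Lemma segd0 a b t : 0 <= t <= 1 -> d a (seg a b t) = t * d a b.
Proof.
move=> t01; rewrite -{1}(seg0 H a b) (segd H) ?lexx ?ler01//.
by rewrite sub0r normrN ger0_norm//; case/andP: t01.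
Qed.

Lemma segd1 a b t : 0 <= t <= 1 -> d (seg a b t) b = (1 - t) * d a b.
Proof.
move=> t01; rewrite -{2}(seg1 H a b) (segd H) ?lexx ?ler01//.
by rewrite distrC ger0_norm// subr_ge0; case/andP: t01.
Qed.

(** Comparison for thin triangles with vertex [c] says that the squared distance
    from [c] is locally as convex along a side as in the plane. *)
Lemma cn_vertex c a b t : D c -> 0 <= t <= 1 -> cn_ineq c a b (seg a b t) t.
Proof.
move=> Dc t01; have [e e0 He] := cn_vertex_small H.
pose L := d a b; have L0 : 0 <= L := mdist_ge0 _ _.
pose A := d c a; have A0 : 0 <= A := mdist_ge0 _ _.
pose f s := d c (seg a b s) ^+ 2 - s ^+ 2 * L ^+ 2.
suff : f t <= (1 - t) * f 0 + t * f 1.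
  by rewrite /f /cn_ineq (seg0 H) (seg1 H) -/L; nra.
apply: (@local_midpoint_convex _ _ (2 * (A + L) * L + 2 * L ^+ 2)) => //.
- move=> s u s01 u01.
  have su : `|d c (seg a b s) - d c (seg a b u)| <= `|s - u| * L.
    rewrite -(segd H)// ler_norml.
    have := metric_triangle c (seg a b u) (seg a b s).
    have := metric_triangle c (seg a b s) (seg a b u).
    by rewrite (metric_sym (seg a b u)); lra.
  have bnd r : 0 <= r <= 1 -> 0 <= d c (seg a b r) <= A + L.
    move=> r01; rewrite mdist_ge0/=.
    have := metric_triangle c a (seg a b r); rewrite segd0// -/A -/L; nra.
  have := bnd _ s01; have := bnd _ u01; rewrite /f; move: su.
  set x := d c _; set y := d c _ => su y01 x01.
  have -> : x ^+ 2 - s ^+ 2 * L ^+ 2 - (y ^+ 2 - u ^+ 2 * L ^+ 2) =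
    (x - y) * (x + y) - (s - u) * ((s + u) * L ^+ 2) by ring.
  have h1 : `|(x - y) * (x + y)| <= 2 * (A + L) * L * `|s - u|.
    rewrite normrM (ger0_norm (x := x + y)); last lra.
    have -> : 2 * (A + L) * L * `|s - u| = `|s - u| * L * (2 * (A + L)) by ring.
    by rewrite ler_pM//; lra.
  have h2 : `|(s - u) * ((s + u) * L ^+ 2)| <= 2 * L ^+ 2 * `|s - u|.
    rewrite normrM mulrC (ger0_norm (x := _ * L ^+ 2)); last nra.
    by rewrite ler_wpM2r// ler_wpM2r ?sqr_ge0//; lra.
  apply: le_trans (ler_normB _ _) _; lra.
- move=> {t01} {}t t01.
  exists (Num.min (Num.min t (1 - t)) (e / (2 * (L + 1)))).
    rewrite !lt_min divr_gt0// ?mulr_gt0//; lra.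
  move=> n; rewrite !lt_min => /andP[n0 /andP[/andP[nt n1t] ne]].
  have t1 : 0 <= t - n <= 1 by lra.
  have t2 : 0 <= t + n <= 1 by lra.
  have dn : d (seg a b (t - n)) (seg a b (t + n)) = 2 * n * L.
    by rewrite (segd H)// distrC ger0_norm /L; [ring|lra].
  have small : d (seg a b (t - n)) (seg a b (t + n)) < e.
    rewrite dn; have : n * (2 * (L + 1)) < e by rewrite -ltr_pdivlMr//; lra.
    nra.
  have := He c a b (t - n) (t + n) (1 / 2) Dc t1 t2 ltac:(lra) ltac:(lra) small.
  have -> : (1 - 1 / 2) * (t - n) + 1 / 2 * (t + n) = t by lra.
  by rewrite /cn_ineq dn /f; nra.
Qed.

(** Homogeneity: for points [t] and [t'] on sides issuing from [c], the bound is the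
    value of the squared distance in the plane. *)
Lemma cn_side_scaled e : (forall c p b s t, D c -> d p b < e ->
    0 <= s <= 1 -> 0 <= t <= 1 -> cn_ineq (seg c p s) c b (seg c b t) t) ->
  forall c q q' t t', D c -> d q q' < e -> 0 <= t <= 1 -> 0 <= t' <= 1 ->
  d (seg c q t) (seg c q' t') ^+ 2 <=
    (t - t') * (t * d c q ^+ 2 - t' * d c q' ^+ 2) + t * t' * d q q' ^+ 2.
Proof.
move=> He c q q' t t' Dc qq' t01 t'01.
have := He c q q' t t' Dc qq' t01 t'01.
have q'q : d q' q < e by rewrite metric_sym.
have := He c q' q 1 t Dc q'q ltac:(lra) t01.
rewrite /cn_ineq (seg1 H) ![d _ c]metric_sym segd0//.
rewrite (metric_sym q' q) (metric_sym q' (seg _ _ _)).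
move=> h1 h2; have : t' * d (seg c q t) q' ^+ 2 <= t' * ((1 - t) * d c q' ^+ 2 +
  t * d q q' ^+ 2 - t * (1 - t) * d c q ^+ 2) by rewrite ler_wpM2l//; lra.
lra.
Qed.

(** The planar segment from [p] to [t b], seen from [c] as origin, has polar
    coordinates [q i], [T i] at equidistant times; moving along it with the
    same parameters in the space, the contributions of the intermediate radii
    to the energy telescope away, so that short steps suffice. *)
Lemma cn_side c p b t : D c -> 0 <= t <= 1 -> cn_ineq p c b (seg c b t) t.
Proof.
move=> Dc t01; have [e e0 He] := cn_side_small H.
have [->|tn0] := eqVneq t 0; first by rewrite (seg0 H) /cn_ineq; lra.
have t0 : 0 < t by rewrite lt_def tn0; case/andP: t01.
pose L := d p b; have L0 : 0 <= L := mdist_ge0 _ _.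
have [n Ln] : exists n : nat, L / (t * e) < n.+1%:R.
  exists (Num.truncn (L / (t * e))).
  by rewrite truncnS_gt.
set N := n.+1%:R : R in Ln.
have N0 : 0 < N by rewrite ltr0n.
pose T (i : nat) : R := 1 - (1 - t) * i%:R / N.
pose s (i : nat) : R := i%:R / N * t / T i.
pose q i := seg p b (s i); pose w i := seg c (q i) (T i).
have iN i : (i <= n.+1)%N -> 0 <= i%:R / N <= 1.
  by move=> i_n; rewrite divr_ge0 ?(ltW N0)//= ler_pdivrMr// mul1r ler_nat.
have T01 i : (i <= n.+1)%N -> t <= T i <= 1.
  move=> /iN; rewrite /T -mulrA; set x := _ / N; nra.
have Tpos i : (i <= n.+1)%N -> 0 < T i by move=> /T01; lra.
have s01 i : (i <= n.+1)%N -> 0 <= s i <= 1.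
  move=> i_n; have Ti := Tpos _ i_n; have xi := iN _ i_n.
  rewrite /s; apply/andP; split; first by rewrite !mulr_ge0 ?invr_ge0//; lra.
  by rewrite ler_pdivrMr// mul1r /T -(mulrA (1 - t)); move: xi; set x := _ / N; lra.
have dq i : (i < n.+1)%N -> d (q i) (q i.+1) = t / (N * T i * T i.+1) * L.
  move=> i_n; have T1 := Tpos _ (ltnW i_n); have T2 := Tpos _ i_n.
  rewrite /q (segd H) ?s01//; last exact: ltnW.
  have e1 : i%:R / N * T i.+1 - i.+1%:R / N * T i = - N^-1.
    by rewrite /T -natr1; field; exact: lt0r_neq0.
  have -> : s i - s i.+1 = - (t / (N * T i * T i.+1)).
    transitivity (t * (i%:R / N * T i.+1 - i.+1%:R / N * T i) / (T i * T i.+1)).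
      by rewrite /s; field; rewrite !lt0r_neq0.
    by rewrite e1; field; rewrite !lt0r_neq0.
  rewrite normrN ger0_norm//.
  by rewrite divr_ge0 ?mulr_ge0//; lra.
have dqe i : (i < n.+1)%N -> d (q i) (q i.+1) < e.
  move=> i_n; have /andP[T1 _] := T01 _ (ltnW i_n).
  have /andP[T2 _] := T01 _ i_n.
  rewrite dq// mulrAC ltr_pdivrMr; last by rewrite !mulr_gt0 ?Tpos// ltnW.
  rewrite -(mulrA N).
  have : L < N * (t * e) by rewrite -ltr_pdivrMr// mulr_gt0.
  have : t * t <= T i * T i.+1 by rewrite ler_pM//; lra.
  move: (T i * T i.+1) => U tU LN.
  have : t * L < t * (N * (t * e)) by rewrite ltr_pM2l.
  have : (N * e) * (t * t) <= (N * e) * U by rewrite ler_wpM2l// mulr_ge0; lra.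
  lra.
have dw i : (i < n.+1)%N -> d (w i) (w i.+1) ^+ 2 <=
   (1 - t) / N * (T i * d c (q i) ^+ 2 - T i.+1 * d c (q i.+1) ^+ 2) +
   t ^+ 2 * L ^+ 2 / (N ^+ 2 * T i * T i.+1).
  move=> i_n; have T1 := T01 _ (ltnW i_n); have T2 := T01 _ i_n.
  have T1p := Tpos _ (ltnW i_n); have T2p := Tpos _ i_n.
  apply: le_trans (cn_side_scaled He Dc (dqe _ i_n) _ _) _; [lra|lra|].
  have -> : T i - T i.+1 = (1 - t) / N.
    by rewrite /T -natr1; field; exact: lt0r_neq0.
  rewrite lerD2l dq// le_eqVlt; apply/orP; left; apply/eqP.
  by field; rewrite !lt0r_neq0.
have sum k : (k <= n.+1)%N -> \sum_(i < k) d (w i) (w i.+1) ^+ 2 <=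
   (1 - t) / N * (d c p ^+ 2 - T k * d c (q k) ^+ 2) +
   t ^+ 2 * L ^+ 2 * k%:R / (N ^+ 2 * T k).
  elim: k => [|k IH] k_n.
    rewrite big_ord0 /q /s /T !mulr0 !mul0r subr0 mul1r (seg0 H).
    by rewrite subrr mulr0 addr0.
  rewrite big_ord_recr /=; apply: le_trans (lerD (IH (ltnW k_n)) (dw _ k_n)) _.
  have T1p := Tpos _ (ltnW k_n); have T2p := Tpos _ k_n.
  have kT : k%:R * T k.+1 + 1 = k.+1%:R * T k.
    by rewrite /T -!natr1; field; exact: lt0r_neq0.
  have -> : t ^+ 2 * L ^+ 2 * k.+1%:R / (N ^+ 2 * T k.+1) =
    t ^+ 2 * L ^+ 2 * (k%:R * T k.+1 + 1) / (N ^+ 2 * T k * T k.+1).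
    by rewrite kT; field; rewrite !lt0r_neq0.
  rewrite le_eqVlt; apply/orP; left; apply/eqP.
  by field; rewrite !lt0r_neq0.
have := path_energy w n.+1; rewrite -/N.
have TN : T n.+1 = t by rewrite /T -/N; field; exact: lt0r_neq0.
have w0 : w 0%N = p.
  by rewrite /w /q /s /T !(mulr0, mul0r) subr0 (seg0 H) (seg1 H).
have qN : q n.+1 = b.
  rewrite /q /s TN -/N divff ?lt0r_neq0// mul1r divff ?lt0r_neq0//.
  exact: seg1 H _ _.
have wN : w n.+1 = seg c b t by rewrite /w TN qN.
rewrite w0 wN => en.
have := sum _ (leqnn _); rewrite -/N TN qN => sn.
rewrite /cn_ineq (metric_sym p c).
apply: (le_trans en).
have : N * \sum_(i < n.+1) d (w i) (w i.+1) ^+ 2 <=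
  N * ((1 - t) / N * (d c p ^+ 2 - t * d c b ^+ 2) +
  t ^+ 2 * L ^+ 2 * N / (N ^+ 2 * t)) by rewrite ler_pM2l.
move=> /le_trans; apply; rewrite -/L le_eqVlt; apply/orP; left; apply/eqP.
by field; rewrite !lt0r_neq0.
Qed.

End relative_cat0_theory.

(** * Homotheties and balls *)

Section homothety.
Context {R : realType} {Y : metricType R} (D : set Y) (seg : Y -> Y -> R -> Y).
Hypothesis H : locally_relative_cat0 D seg.
Local Notation d := mdist.
Implicit Types (p a b m c x y z : Y).

Lemma seg_uniqueD c b m t : D c -> 0 <= t <= 1 ->
  d c m = t * d c b -> d m b = (1 - t) * d c b -> m = seg c b t.
Proof.
move=> Dc t01 cm mb; apply: mdist_positivity.
have := cn_side H m b Dc t01; rewrite /cn_ineq (metric_sym m c) cm mb.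
have := mdist_ge0 m (seg c b t); set u := mdist m (seg c b t) => u0 h.
by apply/eqP; rewrite -sqrf_eq0; apply/eqP; have := sqr_ge0 u; lra.
Qed.

Lemma seg_segD c b s t : D c -> 0 <= s <= 1 -> 0 <= t <= 1 ->
  seg c (seg c b s) t = seg c b (t * s).
Proof.
move=> Dc s01 t01; have ts01 : 0 <= t * s <= 1 by nra.
apply/esym/seg_uniqueD => //.
  by rewrite !(segd0 H)// mulrA.
rewrite (segd H)// (segd0 H)// distrC ger0_norm; last nra.
ring.
Qed.

(** In the plane equality holds; apply the comparison first with vertex [x], then
    with vertex [seg c y t]. *)
Lemma homothety c x y t : D c -> 0 <= t <= 1 ->
  d (seg c x t) (seg c y t) <= t * d x y.
Proof.
move=> Dc t01; apply: le_of_sqr; first by rewrite mulr_ge0 ?mdist_ge0//; lra.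
have h1 := cn_side H x y Dc t01.
have h2 := cn_side H (seg c y t) x Dc t01.
move: h1 h2; rewrite /cn_ineq.
rewrite !(metric_sym _ c) (segd0 H)// (metric_sym (seg c y t) x).
rewrite (metric_sym (seg c y t) (seg c x t)).
move=> h1 h2.
have : t * d x (seg c y t) ^+ 2 <= t * ((1 - t) * d c x ^+ 2 +
  t * d x y ^+ 2 - t * (1 - t) * d c y ^+ 2) by rewrite ler_wpM2l//; lra.
lra.
Qed.

End homothety.

Section balls.
Context {R : realType} {Y : metricType R} (D : set Y) (seg : Y -> Y -> R -> Y).
Hypothesis H : locally_relative_cat0 D seg.
Local Notation d := mdist.
Implicit Types (p a b m c x y z : Y).

Definition cat0_ball z r := forall p a b t,
  d z p <= r -> d z a <= r -> d z b <= r -> 0 <= t <= 1 ->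
  cn_ineq p a b (seg a b t) t.

Definition midpoint a b m := d a m = d a b / 2 /\ d m b = d a b / 2.

Lemma midpoint_sym a b m : midpoint a b m -> midpoint b a m.
Proof. by rewrite /midpoint !(metric_sym _ m) (metric_sym b a) => -[-> ->]. Qed.

Lemma midpoint_seg a b : midpoint a b (seg a b (1 / 2)).
Proof.
have h01 : 0 <= (1 / 2 : R) <= 1 by lra.
by rewrite /midpoint (segd0 H)// (segd1 H)//; split; lra.
Qed.

Context (z : Y) (r : R).
Hypothesis zr : cat0_ball z r.

Lemma ball_convex a b t : d z a <= r -> d z b <= r -> 0 <= t <= 1 ->
  d z (seg a b t) <= r.
Proof.
move=> za zb t01; have r0 : 0 <= r := le_trans (mdist_ge0 _ _) za.
apply: le_of_sqr => //.
have zz : d z z <= r by rewrite mdistxx.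
have := zr zz za zb t01; rewrite /cn_ineq.
have : d z a ^+ 2 <= r ^+ 2 by rewrite lerXn2r// nnegrE// mdist_ge0.
have : d z b ^+ 2 <= r ^+ 2 by rewrite lerXn2r// nnegrE// mdist_ge0.
have : 0 <= t * (1 - t) by nra.
have := sqr_ge0 (d a b).
move: (d z a ^+ 2) (d z b ^+ 2) (d a b ^+ 2) (r ^+ 2) => A B C S; nra.
Qed.

Lemma ball_unique a b m t : d z a <= r -> d z b <= r -> d z m <= r ->
  0 <= t <= 1 -> d a m = t * d a b -> d m b = (1 - t) * d a b -> m = seg a b t.
Proof.
move=> za zb zm t01 am mb; apply: mdist_positivity.
have := zr zm za zb t01; rewrite /cn_ineq (metric_sym m a) am mb => h.
by apply/eqP; rewrite -sqrf_eq0; apply/eqP; have := sqr_ge0 (d m (seg a b t)); lra.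
Qed.

Lemma cn_midpoint p a b m : d z p <= r -> d z a <= r -> d z b <= r ->
  d z m <= r -> midpoint a b m ->
  d p m ^+ 2 <= (d p a ^+ 2 + d p b ^+ 2) / 2 - d a b ^+ 2 / 4.
Proof.
move=> zp za zb zm [am mb]; have h01 : 0 <= (1 / 2 : R) <= 1 by lra.
have -> : m = seg a b (1 / 2) by apply: ball_unique => //; lra.
have := zr zp za zb h01; rewrite /cn_ineq; lra.
Qed.

Lemma ball_midpoints a b m a' b' m' :
  d z a <= r -> d z b <= r -> d z m <= r ->
  d z a' <= r -> d z b' <= r -> d z m' <= r ->
  midpoint a b m -> midpoint a' b' m' ->
  d m m' <= (d a a' + d b b') / 2.
Proof.
have aux a0 b0 m0 b1 m1 : d z a0 <= r -> d z b0 <= r -> d z m0 <= r ->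
  d z b1 <= r -> d z m1 <= r -> midpoint a0 b0 m0 -> midpoint a0 b1 m1 ->
  d m0 m1 <= d b0 b1 / 2.
  move=> za zb zm zb' zm' M M'.
  apply: le_of_sqr; first by rewrite divr_ge0 ?mdist_ge0.
  have h1 := cn_midpoint zm za zb' zm' M'.
  have h2 := cn_midpoint zb' za zb zm M.
  case: M M' h1 h2 => [am mb] [am' mb'].
  rewrite (metric_sym m0 a0) am (metric_sym b1 m0) (metric_sym b1 a0).
  by rewrite (metric_sym b1 b0); lra.
move=> za zb zm za' zb' zm' M M'.
have h01 : 0 <= (1 / 2 : R) <= 1 by lra.
pose n := seg a b' (1 / 2).
have Mn : midpoint a b' n by exact: midpoint_seg.
have zn : d z n <= r by exact: ball_convex.
have h1 := aux _ _ _ _ _ za zb zm zb' zn M Mn.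
have h2 := aux _ _ _ _ _ zb' za zn za' zm' (midpoint_sym Mn) (midpoint_sym M').
have := metric_triangle m n m'; lra.
Qed.

(** Both [b] and [a'] are compared with the point of the diagonal [a b'] that
    divides it in the ratio [d a a' : d b b']; this ratio makes the last term a
    product rather than a sum of squares. *)
Lemma quadrilateral a b a' b' :
  d z a <= r -> d z b <= r -> d z a' <= r -> d z b' <= r ->
  d a b' ^+ 2 + d b a' ^+ 2 <=
    d a b ^+ 2 + d a' b' ^+ 2 + 2 * d a a' * d b b'.
Proof.
move=> za zb za' zb'.
have [aa'|] := eqVneq (d a a') 0.
  by rewrite -(mdist_positivity _ _ aa') mdistxx (metric_sym b a); lra.
have [bb'|] := eqVneq (d b b') 0.
  by rewrite -(mdist_positivity _ _ bb') mdistxx (metric_sym b a'); lra.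
rewrite !neq_lt !ltNge !mdist_ge0/= -!ltNge => bb' aa'.
pose s := d a a' + d b b'; pose t := d a a' / s.
have s0 : 0 < s by rewrite addr_gt0.
have t01 : 0 < t < 1.
  by rewrite divr_gt0//= ltr_pdivrMr// mul1r /s ltrDl.
have t01' : 0 <= t <= 1 by lra.
have h1 := zr zb za zb' t01'; have h2 := zr za' za zb' t01'.
move: h1 h2; rewrite /cn_ineq; set m := seg a b' t.
rewrite (metric_sym b a) (metric_sym a' a).
have tri := metric_triangle b m a'; rewrite (metric_sym m a') in tri.
have ba'0 := mdist_ge0 b a'; have bm0 := mdist_ge0 b m.
have a'm0 := mdist_ge0 a' m.
move: tri ba'0 bm0 a'm0; move: (d b m) (d a' m) (d b a') => x y w tri w0 x0 y0.
move=> h1 h2.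
have t1 : 0 < 1 - t by lra.
(* convexity of the square, with weights [1 - t] and [t] *)
have wxy : w ^+ 2 * (t * (1 - t)) <= x ^+ 2 * t + y ^+ 2 * (1 - t).
  have : 0 <= (x * t - y * (1 - t)) ^+ 2 by exact: sqr_ge0.
  have : w ^+ 2 <= (x + y) ^+ 2 by rewrite lerXn2r// nnegrE addr_ge0.
  have tt : 0 < t * (1 - t) by rewrite mulr_gt0//; lra.
  move=> /(ler_wpM2r (ltW tt)); lra.
have : x ^+ 2 * t + y ^+ 2 * (1 - t) <= t * ((1 - t) * d a b ^+ 2 +
   t * d b b' ^+ 2 - t * (1 - t) * d a b' ^+ 2) + (1 - t) * ((1 - t) *
   d a a' ^+ 2 + t * d a' b' ^+ 2 - t * (1 - t) * d a b' ^+ 2).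
  by apply: lerD; rewrite mulrC ler_wpM2l//; lra.
move=> /(le_trans wxy) {wxy h1 h2}.
have ts : t * d b b' = (1 - t) * d a a' by rewrite /t /s; field; lra.
have -> : t * ((1 - t) * d a b ^+ 2 + t * d b b' ^+ 2 -
   t * (1 - t) * d a b' ^+ 2) + (1 - t) * ((1 - t) * d a a' ^+ 2 +
   t * d a' b' ^+ 2 - t * (1 - t) * d a b' ^+ 2) =
   t * (1 - t) * (d a b ^+ 2 + d a' b' ^+ 2 - d a b' ^+ 2) +
   ((t * d b b') ^+ 2 + ((1 - t) * d a a') ^+ 2) by ring.
have -> : (t * d b b') ^+ 2 + ((1 - t) * d a a') ^+ 2 =
  t * (1 - t) * (2 * d a a' * d b b').
  have -> : t * (1 - t) * (2 * d a a' * d b b') =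
    2 * (t * d b b') * ((1 - t) * d a a') by ring.
  by rewrite ts; ring.
rewrite -mulrDr mulrC ler_pM2l; last by rewrite mulr_gt0//; lra.
lra.
Qed.

End balls.

(** * Energy of chains *)

Section chains.
Context {R : realType} {Y : metricType R} (D : set Y) (seg : Y -> Y -> R -> Y).
Hypothesis H : relative_cat0 D seg.
Local Notation d := mdist.
Local Notation cat0_ball := (cat0_ball seg).
Implicit Types (p a b m c x y z : Y) (Z W : nat -> Y) (N : nat).

(** A discrete local geodesic: [Z i.+1] is the midpoint of its neighbours. *)
Definition chain N (h : R) Z : Prop :=
  (forall i, (i < N)%N -> d (Z i) (Z i.+1) = h) /\
  (forall i, (i.+1 < N)%N -> d (Z i) (Z i.+2) = 2 * h).

Definition energy N W : R := \sum_(i < N) d (W i) (W i.+1) ^+ 2.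

Lemma chain_energy N h Z : chain N h Z -> energy N Z = N%:R * h ^+ 2.
Proof.
move=> [Zh _]; rewrite /energy (eq_bigr (fun=> h ^+ 2)).
  by rewrite sumr_const card_ord mulr_natl.
by move=> i _; rewrite Zh.
Qed.

Lemma chain_midpoint N h Z i : chain N h Z -> (i.+1 < N)%N ->
  midpoint (Z i) (Z i.+2) (Z i.+1).
Proof.
move=> [Zh Z2h] iN; rewrite /midpoint Z2h// !Zh//; last exact: ltnW.
by split; lra.
Qed.

Lemma chain_step_ge0 N h Z : (0 < N)%N -> chain N h Z -> 0 <= h.
Proof. by move=> N0 [Zh _]; rewrite -(Zh 0%N N0) mdist_ge0. Qed.

Section nearby.
Context (N : nat) (h e r : R) (Z : nat -> Y).
Hypotheses (Zc : chain N.+1 h Z) (her : h + e <= r).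
Hypothesis Zr : forall i, (i <= N.+1)%N -> cat0_ball (Z i) r.

Let h0 : 0 <= h. Proof. exact: (@chain_step_ge0 N.+1 h Z isT Zc). Qed.

Let near_self i w : (i <= N.+1)%N -> d (Z i) w <= e -> d (Z i) w <= r.
Proof. by move=> _ zw; apply: le_trans zw _; move: her h0; lra. Qed.

Let near_next i w : (i < N.+1)%N -> d (Z i.+1) w <= e -> d (Z i) w <= r.
Proof.
move=> iN zw; have := metric_triangle (Z i) (Z i.+1) w.
by rewrite Zc.1//; move: her h0; lra.
Qed.

Let near_prev i w : (i < N.+1)%N -> d (Z i) w <= e -> d (Z i.+1) w <= r.
Proof.
move=> iN zw; have := metric_triangle (Z i.+1) (Z i) w.
by rewrite (metric_sym (Z i.+1) (Z i)) Zc.1//; move: her h0; lra.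
Qed.

(** The quadrilateral inequality on consecutive links of the two chains,
    summed; the diagonals recombine at each interior [W i] into the two sides
    of a triangle with base [Z i.-1], [Z i.+1], to which the midpoint
    inequality applies. *)
Lemma energy_comparison W : (forall i, (i <= N.+1)%N -> d (Z i) (W i) <= e) ->
  W N.+1 = Z N.+1 ->
  d (Z 1%N) (W 0%N) ^+ 2 + N%:R * h ^+ 2 +
    \sum_(i < N.+1) (d (Z i) (W i) - d (Z i.+1) (W i.+1)) ^+ 2 <=
  energy N.+1 W + d (Z 0%N) (W 0%N) ^+ 2.
Proof.
move=> ZW WN.
have e0 : 0 <= e := le_trans (mdist_ge0 _ _) (ZW 0%N isT).
have zz i : d (Z i) (Z i) <= e by rewrite mdistxx.
have quad i : (i < N.+1)%N -> d (Z i) (W i.+1) ^+ 2 + d (Z i.+1) (W i) ^+ 2 <=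
    h ^+ 2 + d (W i) (W i.+1) ^+ 2 + 2 * d (Z i) (W i) * d (Z i.+1) (W i.+1).
  move=> iN; rewrite -(Zc.1 i iN).
  apply: (quadrilateral (Zr (ltnW iN))).
  - by apply: near_self => //; exact: ltnW.
  - exact: near_next.
  - by apply: near_self; [exact: ltnW|exact/ZW/ltnW].
  - by apply: near_next => //; exact: ZW.
have cn i : (i.+1 < N.+1)%N -> 2 * d (Z i.+1) (W i.+1) ^+ 2 + 2 * h ^+ 2 <=
    d (Z i) (W i.+1) ^+ 2 + d (Z i.+2) (W i.+1) ^+ 2.
  move=> iN; have := cn_midpoint (Zr (ltnW iN)) (near_self (ltnW iN) (ZW _ (ltnW iN)))
    (near_prev (ltnW iN) (zz i)) (near_next iN (zz i.+2))
    (near_self (ltnW iN) (zz _)) (chain_midpoint Zc iN).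
  rewrite Zc.2// !(metric_sym (W i.+1)); lra.
have part k : (k < N.+1)%N ->
    d (Z 1%N) (W 0%N) ^+ 2 + d (Z k) (W k.+1) ^+ 2 + (k%:R - 1) * h ^+ 2 +
    \sum_(i < k.+1) (d (Z i) (W i) - d (Z i.+1) (W i.+1)) ^+ 2 <=
    energy k.+1 W + d (Z 0%N) (W 0%N) ^+ 2 + d (Z k.+1) (W k.+1) ^+ 2.
  elim: k => [|k IH] kN.
    by have := quad _ kN; rewrite /energy !big_ord_recr !big_ord0/=; lra.
  have := IH (ltnW kN); have := quad _ kN; have := cn _ kN.
  rewrite {-1}/energy [\sum_(i < k.+2) _]big_ord_recr/=.
  rewrite [\sum_(i < k.+2) _]big_ord_recr/= -/(energy _ _) -natr1; lra.
have := part N (leqnn _); rewrite WN mdistxx Zc.1// /energy.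
by rewrite expr0n/=; lra.
Qed.

Lemma energy_minimal W : (forall i, (i <= N.+1)%N -> d (Z i) (W i) <= e) ->
  W 0%N = Z 0%N -> W N.+1 = Z N.+1 ->
  N.+1%:R * h ^+ 2 +
    \sum_(i < N.+1) (d (Z i) (W i) - d (Z i.+1) (W i.+1)) ^+ 2 <= energy N.+1 W.
Proof.
move=> ZW W0 WN; have := energy_comparison ZW WN.
rewrite W0 mdistxx metric_sym Zc.1// expr0n/= -natr1; lra.
Qed.

Lemma energy_close W : (forall i, (i <= N.+1)%N -> d (Z i) (W i) <= e) ->
  W 0%N = Z 0%N -> W N.+1 = Z N.+1 ->
  forall i, (i <= N.+1)%N ->
  d (Z i) (W i) ^+ 2 <= N.+1%:R * (energy N.+1 W - N.+1%:R * h ^+ 2).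
Proof.
move=> ZW W0 WN i iN; have := energy_minimal ZW W0 WN.
pose u j := d (Z j) (W j); pose f j := (u j - u j.+1) ^+ 2.
have fE : \sum_(i0 < N.+1) f i0 = \sum_(i0 < i) f i0 + \sum_(i <= j < N.+1) f j.
  by rewrite -!(big_mkord xpredT f) -big_cat_nat//=.
rewrite -/u (eq_bigr (fun j : 'I__ => f j))// fE.
have : 0 <= \sum_(i <= j < N.+1) f j.
  by apply: sumr_ge0 => j _; exact: sqr_ge0.
have := @steps_energy _ u (fun j => `|u j.+1 - u j|) i (fun _ _ => lexx _).
rewrite {2}/u W0 mdistxx subr0.
rewrite (eq_bigr (fun j : 'I__ => f j)); last first.
  by move=> j _; rewrite real_normK ?num_real// /f; ring.
have : 0 <= \sum_(i0 < i) f i0 by apply: sumr_ge0 => j _; exact: sqr_ge0.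
set S := \sum_(i0 < i) f i0; set T := \sum_(i <= j < _) f j.
have : i%:R <= N.+1%:R :> R by rewrite ler_nat.
have : 0 <= i%:R :> R by [].
rewrite -/(u i); set n := i%:R; set M := N.+1%:R.
move=> n0 nM S0 uS T0 E.
apply: (le_trans uS).
have : n * S <= M * S by rewrite ler_wpM2r.
have : M * S <= M * (energy N.+1 W - M * h ^+ 2) by rewrite ler_wpM2l//; lra.
lra.
Qed.

(** The distance between the sequences drops to [0] in [N.+1] steps, so the sum of the
    squares of its differences is at least [N.+1%:R^-1] times its first square. *)
Lemma energy_shortened W : (forall i, (i <= N.+1)%N -> d (Z i) (W i) <= e) ->
  W N.+1 = Z N.+1 ->
  d (Z 1%N) (W 0%N) ^+ 2 + N%:R * h ^+ 2 <=
  energy N.+1 W + (1 - N.+1%:R^-1) * d (Z 0%N) (W 0%N) ^+ 2.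
Proof.
move=> ZW WN; have := energy_comparison ZW WN.
pose u j := d (Z j) (W j).
have := @steps_energy _ u (fun j => `|u j.+1 - u j|) N.+1 (fun _ _ => lexx _).
rewrite {1}/u WN mdistxx sub0r sqrrN.
rewrite (eq_bigr (fun j : 'I__ => (u j - u j.+1) ^+ 2)); last first.
  by move=> j _; rewrite real_normK ?num_real//; ring.
rewrite -/(u 0%N); set S := \sum_(_ < _) _ => uS.
have M0 : 0 < N.+1%:R :> R by [].
have : N.+1%:R^-1 * u 0%N ^+ 2 <= S by rewrite ler_pdivrMl.
by move: (N.+1%:R^-1) => q; lra.
Qed.

End nearby.

(** Each chain minimizes the energy among the sequences near it, so both have the
    same energy and neither can be away from the other. *)
Lemma chain_unique N h h' e r Z Z' : chain N.+1 h Z -> chain N.+1 h' Z' ->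
  h + e <= r -> h' + e <= r ->
  (forall i, (i <= N.+1)%N -> cat0_ball (Z i) r) ->
  (forall i, (i <= N.+1)%N -> cat0_ball (Z' i) r) ->
  (forall i, (i <= N.+1)%N -> d (Z i) (Z' i) <= e) ->
  Z 0%N = Z' 0%N -> Z N.+1 = Z' N.+1 ->
  forall i, (i <= N.+1)%N -> Z i = Z' i.
Proof.
move=> Zc Zc' her her' Zr Zr' ZZ' ZZ0 ZZN i iN.
have Z'Z j : (j <= N.+1)%N -> d (Z' j) (Z j) <= e.
  by move=> jN; rewrite metric_sym ZZ'.
have h1 := energy_close Zc her Zr ZZ' (esym ZZ0) (esym ZZN) iN.
have h2 := energy_close Zc' her' Zr' Z'Z ZZ0 ZZN iN.
rewrite (chain_energy Zc') in h1; rewrite (chain_energy Zc) (metric_sym (Z' i)) in h2.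
apply: mdist_positivity; apply/eqP; rewrite -sqrf_eq0; apply/eqP.
by have := sqr_ge0 (d (Z i) (Z' i)); lra.
Qed.

End chains.

(** * Chains with nearby ends *)

Section geometric_sequences.
Context {R : realType}.

Lemma geometric_small (C q e : R) : 0 <= q < 1 -> 0 < e ->
  exists K : nat, forall k : nat, (K <= k)%N -> C * q ^+ k <= e.
Proof.
move=> /andP[q0 q1] e0.
have cv : C * q ^+ k @[k --> \oo] --> C * 0.
  by apply: cvgMr; apply: cvg_expr; rewrite ger0_norm.
rewrite mulr0 in cv.
have /cvgrPdist_le /(_ e e0) [K _ HK] := cv.
exists K => k Kk; have := HK k Kk; rewrite /= sub0r normrN.
exact: le_trans (ler_norm _).
Qed.

Context {Y : metricType R}.
Local Notation d := mdist.

Lemma geometric_dist (u : nat -> Y) (C q : R) : 0 <= q < 1 -> 0 <= C ->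
  (forall k, d (u k) (u k.+1) <= C * q ^+ k) ->
  forall k m, d (u k) (u (k + m)%N) <= C / (1 - q) * q ^+ k.
Proof.
move=> /andP[q0 q1] C0 uq k m.
suff : d (u k) (u (k + m)%N) <= C / (1 - q) * (q ^+ k - q ^+ (k + m)).
  move=> /le_trans; apply; rewrite ler_wpM2l ?divr_ge0 ?subr_ge0 ?(ltW q1)//.
  by rewrite gerBl exprn_ge0.
elim: m => [|m IH]; first by rewrite addn0 mdistxx subrr mulr0.
apply: le_trans (metric_triangle _ (u (k + m)%N) _) _; rewrite addnS.
apply: le_trans (lerD IH (uq _)) _; rewrite exprS le_eqVlt; apply/orP; left.
by apply/eqP; field; lra.
Qed.

End geometric_sequences.

Section moving_ends.
Context {R : realType} {Y : metricType R} (D : set Y) (seg : Y -> Y -> R -> Y).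
Hypothesis H : relative_cat0 D seg.
Local Notation d := mdist.
Local Notation cat0_ball := (cat0_ball seg).
Implicit Types (p a b m c x y z : Y).

Lemma dist_perturb a b a' b' : `|d a b - d a' b'| <= d a a' + d b b'.
Proof.
rewrite ler_norml.
have := metric_triangle a a' b; have := metric_triangle a' b' b.
have := metric_triangle a' a b'; have := metric_triangle a b b'.
rewrite (metric_sym a' a) (metric_sym b' b); lra.
Qed.

(** Replacing every interior point by the midpoint of its neighbours is a
    contraction for the supremum norm with weights [i * (N - i)], because
    midpoints depend on their ends in a convex way. Its iterates never leave
    the neighbourhood of the chain, for the same reason. *)
Lemma chain_move_ends (N : nat) (h e r : R) (Z : nat -> Y) x y :
  chain N.+1 h Z -> h + e <= r ->
  (forall i, (i <= N.+1)%N -> cat0_ball (Z i) r) ->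
  d (Z 0%N) x <= e -> d (Z N.+1) y <= e ->
  exists h' Z', [/\ chain N.+1 h' Z', Z' 0%N = x, Z' N.+1 = y &
    forall i, (i <= N.+1)%N -> d (Z i) (Z' i) <= e].
Proof.
move=> Zc her Zr Zx Zy.
have e0 : 0 <= e := le_trans (mdist_ge0 _ _) Zx.
have h0 : 0 <= h := chain_step_ge0 (ltn0Sn N) Zc.
pose W := fix W k i := match k with
  | 0%N => if i == 0%N then x else if i == N.+1 then y else Z i
  | k'.+1 => if (i == 0%N) || (i == N.+1) then W k' i
             else seg (W k' i.-1) (W k' i.+1) (1 / 2) end.
have W0 k : W k 0%N = x by elim: k.
have WN k : W k N.+1 = y by elim: k => [|k IH] /=; rewrite eqxx.
have WS k i : (i.+1 < N.+1)%N ->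
    W k.+1 i.+1 = seg (W k i) (W k i.+2) (1 / 2).
  by move=> iN /=; rewrite ltn_eqF.
have Wmid k i : (i.+1 < N.+1)%N -> midpoint (W k i) (W k i.+2) (W k.+1 i.+1).
  by move=> iN; rewrite WS//; exact: (midpoint_seg H).
have ball i w : (i.+1 < N.+1)%N -> [\/ d (Z i) w <= e, d (Z i.+1) w <= e |
    d (Z i.+2) w <= e] -> d (Z i.+1) w <= r.
  move=> iN [] zw.
  - have := metric_triangle (Z i.+1) (Z i) w.
    by rewrite (metric_sym _ (Z i)) (Zc.1 i (ltnW iN)); lra.
  - by apply: le_trans zw _; lra.
  - have := metric_triangle (Z i.+1) (Z i.+2) w.
    by rewrite Zc.1//; lra.
have h01 : 0 <= (1 / 2 : R) <= 1 by lra.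
have zz i : d (Z i) (Z i) <= e by rewrite mdistxx.
have ZW k i : (i <= N.+1)%N -> d (Z i) (W k i) <= e.
  elim: k i => [|k IH] i iN.
    by rewrite /=; have [->//|_] := eqVneq i 0%N; have [->//|_] := eqVneq i N.+1.
  case: i iN => [|i] iN; first by rewrite W0.
  have [->|iN'] := eqVneq i.+1 N.+1; first by rewrite WN.
  have {iN'} iN : (i.+1 < N.+1)%N by rewrite ltn_neqAle iN'.
  have b1 : d (Z i.+1) (W k i) <= r.
    by apply: ball => //; apply: Or31; apply/IH/ltnW/ltnW.
  have b2 : d (Z i.+1) (W k i.+2) <= r by apply: ball => //; apply/Or33/IH.
  have := ball_midpoints H (Zr _ (ltnW iN)) (ball _ _ iN (Or31 _ _ (zz i)))
    (ball _ _ iN (Or33 _ _ (zz i.+2))) (ball _ _ iN (Or32 _ _ (zz i.+1)))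
    b1 b2 _ (chain_midpoint Zc iN) (Wmid k _ iN).
  have := IH i (ltnW (ltnW iN)); have := IH i.+2 iN.
  have b3 : d (Z i.+1) (W k.+1 i.+1) <= r.
    by rewrite WS//; exact: (ball_convex (Zr _ (ltnW iN))).
  by move=> u v /(_ b3); lra.
have [M ME] : exists M : R, M = N.+1%:R by eexists.
have M1 : 1 <= M by rewrite ME ler1n.
pose q : R := 1 - (M ^+ 2)^-1.
have M2 : 0 < M ^+ 2 by rewrite exprn_gt0; lra.
have M2' : 0 < (M ^+ 2)^-1 <= 1.
  by rewrite invr_gt0 M2 invf_le1//= -[leLHS](expr1n _ 2%N) lerXn2r// nnegrE; lra.
have q01 : 0 <= q < 1 by rewrite /q; lra.
pose w (i : nat) : R := i%:R * (M - i%:R).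
have wM i : (i <= N.+1)%N -> 0 <= w i <= M ^+ 2.
  move=> iN; have i0 : 0 <= (i%:R : R) by [].
  have iM : i%:R <= M by rewrite ME ler_nat.
  by rewrite /w; apply/andP; split; nra.
have w1 i : (i.+1 < N.+1)%N -> 1 <= w i.+1.
  move=> iN; have : i.+2%:R <= M by rewrite ME ler_nat.
  have : 0 <= (i%:R : R) by [].
  by rewrite /w -!natr1; nra.
have wq i : (i.+1 < N.+1)%N -> (w i + w i.+2) / 2 <= q * w i.+1.
  move=> iN; have /andP[_] := wM i.+1 (ltnW iN).
  rewrite -[_ <= M ^+ 2]/(_ <= _) => wi.
  have : w i.+1 / M ^+ 2 <= 1 by rewrite ler_pdivrMr// mul1r.
  rewrite /q /w -[i.+2%:R]natr1 -[i.+1%:R]natr1; move: (M ^+ 2)^-1 => P; lra.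
have step k i : (i <= N.+1)%N ->
    d (W k i) (W k.+1 i) <= 2 * e * q ^+ k * w i.
  elim: k i => [|k IH] i iN.
    case: i iN => [|i] iN; first by rewrite !W0 mdistxx /w mul0r mulr0.
    have [->|iN'] := eqVneq i.+1 N.+1; first by rewrite !WN mdistxx /w ME subrr !mulr0.
    have {iN'} iN1 : (i.+1 < N.+1)%N by rewrite ltn_neqAle iN'.
    have := ZW 0%N _ iN; have := ZW 1%N _ iN; have := w1 _ iN1.
    have := metric_triangle (W 0%N i.+1) (Z i.+1) (W 1%N i.+1).
    rewrite (metric_sym (W 0%N i.+1) (Z i.+1)) expr0 mulr1 => t w11 z1 z0.
    have : 2 * e * 1 <= 2 * e * w i.+1 by rewrite ler_wpM2l//; lra.
    lra.
  case: i iN => [|i] iN; first by rewrite !W0 mdistxx /w mul0r mulr0.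
  have [->|iN'] := eqVneq i.+1 N.+1; first by rewrite !WN mdistxx /w ME subrr !mulr0.
  have {iN'} iN1 : (i.+1 < N.+1)%N by rewrite ltn_neqAle iN'.
  have bi k0 : d (Z i.+1) (W k0 i) <= r.
    by apply: ball => //; apply: Or31; apply/ZW/ltnW/ltnW.
  have bi2 k0 : d (Z i.+1) (W k0 i.+2) <= r.
    by apply: ball => //; apply: Or33; apply/ZW.
  have bi1 k0 : d (Z i.+1) (W k0 i.+1) <= r.
    by apply: ball => //; apply: Or32; apply/ZW/ltnW.
  have := ball_midpoints H (Zr _ iN) (bi _) (bi2 _) (bi1 _) (bi _) (bi2 _)
    (bi1 _) (Wmid k _ iN1) (Wmid k.+1 _ iN1).
  have := IH i (ltnW (ltnW iN1)); have := IH i.+2 iN1; have := wq _ iN1.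
  rewrite exprS; set Q := q ^+ k; have Q0 : 0 <= Q by rewrite exprn_ge0; lra.
  move=> a1 a2 a3 a4; apply: (le_trans a4).
  have : (2 * e * Q) * ((w i + w i.+2) / 2) <= (2 * e * Q) * (q * w i.+1).
    by rewrite ler_wpM2l// mulr_ge0//; lra.
  lra.
pose C := 2 * e * M ^+ 2; have C0 : 0 <= C by rewrite mulr_ge0; lra.
have geo i k : (i <= N.+1)%N -> d (W k i) (W k.+1 i) <= C * q ^+ k.
  move=> iN; apply: le_trans (step k i iN) _; rewrite /C.
  have /andP[_ wi] := wM _ iN; have Q0 : 0 <= q ^+ k by rewrite exprn_ge0; lra.
  have : (2 * e * q ^+ k) * w i <= (2 * e * q ^+ k) * M ^+ 2.
    by rewrite ler_wpM2l// mulr_ge0//; lra.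
  lra.
have lims i : exists l, (i <= N.+1)%N -> forall b : R, 0 < b ->
    exists K : nat, forall k, (K <= k)%N -> d (W k i) l <= b.
  have [iN|_] := boolP (i <= N.+1)%N; last by exists x.
  have [|l Hl] := cauchy_complete H (u := W^~ i).
    move=> b b0.
    have b20 : 0 < b / 4 by lra.
    have [K HK] := geometric_small (C / (1 - q)) q01 b20.
    exists K => m n Km Kn.
    have gm := geometric_dist q01 C0 (fun k => geo i k iN) K.
    have := gm (m - K)%N; have := gm (n - K)%N; rewrite !subnKC//.
    have := HK K (leqnn _); have := metric_triangle (W m i) (W K i) (W n i).
    by rewrite (metric_sym (W m i) (W K i)); lra.
  by exists l => _ b b0; have [K HK] := Hl b b0; exists K => k /HK/ltW.
have [Z' HZ'] := choice lims.
have lim_le i l (b : R) : (i <= N.+1)%N -> (forall k, d l (W k i) <= b) -> d l (Z' i) <= b.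
  move=> iN lb; apply/ler_addgt0Pr => a a0; have [K HK] := HZ' i iN a a0.
  by have := metric_triangle l (W K i) (Z' i); have := HK K (leqnn _);
    have := lb K; lra.
have Z'0 : Z' 0%N = x.
  apply/esym/mdist_positivity; apply/eqP; rewrite eq_le mdist_ge0 andbT.
  by apply: lim_le => // k; rewrite W0 mdistxx.
have Z'N : Z' N.+1 = y.
  apply/esym/mdist_positivity; apply/eqP; rewrite eq_le mdist_ge0 andbT.
  by apply: lim_le => // k; rewrite WN mdistxx.
have Z'mid i : (i.+1 < N.+1)%N -> midpoint (Z' i) (Z' i.+2) (Z' i.+1).
  move=> iN.
  have approx (b : R) : 0 < b -> exists k, [/\ d (W k i) (Z' i) <= b,
      d (W k i.+2) (Z' i.+2) <= b & d (W k.+1 i.+1) (Z' i.+1) <= b].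
    move=> b0; have [K1 HK1] := HZ' i (ltnW (ltnW iN)) b b0.
    have [K2 HK2] := HZ' i.+1 (ltnW iN) b b0; have [K3 HK3] := HZ' i.+2 iN b b0.
    exists (maxn K1 (maxn K2 K3)); split.
    - by apply: HK1; rewrite leq_maxl.
    - by apply: HK3; rewrite !leq_max leqnn !orbT.
    - by apply: HK2; rewrite leqW// !leq_max leqnn !orbT.
  split; apply/eqP; rewrite -subr_eq0 -normr_le0; apply/ler_addgt0Pr => a a0.
  - have [k [k1 k2 k3]] := approx _ (divr_gt0 a0 (ltr0n R 4)); have [m1 _] := Wmid k _ iN.
    have p1 := dist_perturb (W k i) (W k i.+2) (Z' i) (Z' i.+2).
    have := dist_perturb (W k i) (W k.+1 i.+1) (Z' i) (Z' i.+1).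
    by move: p1; rewrite m1 !ler_norml; lra.
  - have [k [k1 k2 k3]] := approx _ (divr_gt0 a0 (ltr0n R 4)); have [_ m2] := Wmid k _ iN.
    have p1 := dist_perturb (W k i) (W k i.+2) (Z' i) (Z' i.+2).
    have := dist_perturb (W k.+1 i.+1) (W k i.+2) (Z' i.+1) (Z' i.+2).
    by move: p1; rewrite m2 !ler_norml; lra.
exists (d (Z' 0%N) (Z' 1%N)), Z'; split=> //; last first.
  by move=> i iN; apply: lim_le => // k; exact: ZW.
have Z'h i : (i < N.+1)%N -> d (Z' i) (Z' i.+1) = d (Z' 0%N) (Z' 1%N).
  elim: i => [//|i IH] iN; rewrite -(IH (ltnW iN)).
  by have [-> ->] := Z'mid i iN.
split=> // i iN; have [m1 _] := Z'mid i iN.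
by rewrite -(Z'h i (ltnW iN)) m1; lra.
Qed.

End moving_ends.

(** * Local geodesics that avoid the core *)

Section curves.
Context {R : realType} {Y : metricType R} (D : set Y) (seg : Y -> Y -> R -> Y).
Hypothesis H : relative_cat0 D seg.
Local Notation d := mdist.
Local Notation cat0_ball := (cat0_ball seg).
Implicit Types (p a b m c x y z : Y) (F : R -> Y) (Z : nat -> Y).

Lemma path_length (w : nat -> Y) n (h : R) :
  (forall i, (i < n)%N -> d (w i) (w i.+1) <= h) -> d (w 0%N) (w n) <= n%:R * h.
Proof.
elim: n => [|n IH] wh; first by rewrite mdistxx mul0r.
have := metric_triangle (w 0%N) (w n) (w n.+1); have := wh n (leqnn _).
by have := IH (fun i i_n => wh i (leqW i_n)); rewrite -natr1; lra.
Qed.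

Section interpolation.
Context (N : nat).

Definition node (s : R) : nat := minn (Num.truncn (N.+1%:R * s)) N.
Definition node_offset (s : R) : R := N.+1%:R * s - (node s)%:R.
(** The polygonal path through the points of a chain. [node] is capped by [N] so
    that the parameter [1] belongs to the last segment. *)
Definition interpolate Z (s : R) : Y :=
  seg (Z (node s)) (Z (node s).+1) (node_offset s).

Lemma node_offset01 s : 0 <= s <= 1 -> 0 <= node_offset s <= 1.
Proof.
move=> s01; have M0 : 0 < N.+1%:R :> R by [].
have Ms0 : 0 <= N.+1%:R * s by rewrite mulr_ge0; lra.
have /andP[t1 t2] := truncn_itv Ms0.
rewrite /node_offset /node; case: leqP => tN.
  by move: t1 t2; rewrite -[(Num.truncn _).+1%:R]natr1; lra.
apply/andP; split.
  by rewrite subr_ge0; apply: le_trans t1; rewrite ler_nat ltnW.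
by rewrite lerBlDr addrC natr1 ger_pMr//; lra.
Qed.

Lemma node_lt s : (node s < N.+1)%N.
Proof. by rewrite ltnS geq_minr. Qed.

Lemma interpolate_node Z i : (i <= N.+1)%N -> interpolate Z (i%:R / N.+1%:R) = Z i.
Proof.
move=> iN; have M0 : (N.+1%:R : R) != 0 by [].
have E : N.+1%:R * (i%:R / N.+1%:R) = i%:R :> R by field.
have [->|iN1] := eqVneq i N.+1.
  have -> : N.+1%:R / N.+1%:R = 1 :> R by rewrite divff.
  rewrite /interpolate /node_offset /node mulr1 natrK.
  by rewrite (minn_idPr (leqnSn N)) -natr1 addrC addKr (seg1 H).
have {}iN1 : (i <= N)%N by rewrite -ltnS ltn_neqAle iN1.
rewrite /interpolate /node_offset /node E natrK (minn_idPl iN1).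
by rewrite subrr (seg0 H).
Qed.

Lemma interpolate0 Z : interpolate Z 0 = Z 0%N.
Proof. by rewrite -(@interpolate_node Z 0%N)// mul0r. Qed.

Lemma interpolate1 Z : interpolate Z 1 = Z N.+1.
Proof. by rewrite -(@interpolate_node Z N.+1)// divff. Qed.

Lemma interpolate_geodesic h Z : chain N.+1 h Z ->
  local_geodesic_at N.+1 (N.+1%:R * h) (interpolate Z).
Proof.
move=> Zc.
suff aux s t : 0 <= s -> s <= t -> t <= 1 -> t - s <= N.+1%:R^-1 ->
    d (interpolate Z s) (interpolate Z t) = N.+1%:R * h * (t - s).
  move=> s t s01 t01; have [st|/ltW ts] := leP s t.
    by rewrite distrC ger0_norm ?subr_ge0// => ?; apply: aux => //; lra.
  by rewrite ger0_norm ?subr_ge0// metric_sym => ?; apply: aux => //; lra.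
have M0 : 0 < N.+1%:R :> R by [].
move=> s0 st t1; rewrite -(ler_pM2l M0) divff ?lt0r_neq0// => Mst.
have s01 : 0 <= s <= 1 by lra.
have t01 : 0 <= t <= 1 by lra.
have us := node_offset01 s01; have vt := node_offset01 t01.
have Es : N.+1%:R * s = (node s)%:R + node_offset s by rewrite /node_offset; lra.
have Et : N.+1%:R * t = (node t)%:R + node_offset t by rewrite /node_offset; lra.
have -> : N.+1%:R * h * (t - s) =
    h * ((node t)%:R - (node s)%:R + (node_offset t - node_offset s)).
  by rewrite -[LHS]mulrA [LHS]mulrCA mulrBr Es Et; ring.
have nle : (node s <= node t)%N.
  rewrite /node leq_min geq_minr andbT; apply: (leq_trans (geq_minl _ _)).
  by apply: le_truncn; rewrite ler_pM2l.
have nle1 : (node t <= (node s).+1)%N.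
  rewrite {1}/node geq_min; apply/orP.
  have [sN|sN] := leqP N (node s); first by right; exact: leq_trans sN _.
  left; have nsE : node s = Num.truncn (N.+1%:R * s).
    apply/minn_idPl; rewrite leqNgt; apply/negP => NT.
    by move: sN; rewrite /node (minn_idPr (ltnW NT)) ltnn.
  have Ms0 : 0 <= N.+1%:R * s by rewrite mulr_ge0//; lra.
  have Mt0 : 0 <= N.+1%:R * t by rewrite mulr_ge0//; lra.
  have /andP[_ a2] := truncn_itv Ms0; have /andP[b1 _] := truncn_itv Mt0.
  rewrite -ltnS -(ltr_nat R); apply: le_lt_trans b1 _.
  by rewrite -[(node s).+2%:R]natr1 -[(node s).+1%:R]natr1 nsE; move: a2; rewrite -[(Num.truncn _).+1%:R]natr1; lra.
rewrite /interpolate; have sN := node_lt s; have tN := node_lt t.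
move: nle1; rewrite leq_eqVlt ltnS => /orP[/eqP nt|ntle]; last first.
  have nt : node t = node s by apply/eqP; rewrite eqn_leq ntle nle.
  rewrite nt (segd H)// Zc.1// subrr add0r mulrC distrC ger0_norm//.
  have : N.+1%:R * s <= N.+1%:R * t by rewrite ler_pM2l.
  by rewrite nt in Et; lra.
rewrite nt in tN Et *; rewrite -[(node s).+1%:R]natr1 in Et *.
move: us vt; set u := node_offset s; set v := node_offset t => us vt.
move: sN tN; set i := node s => sN tN.
have h1 := metric_triangle (seg (Z i) (Z i.+1) u) (Z i.+1) (seg (Z i.+1) (Z i.+2) v).
rewrite (segd1 H)// (segd0 H)// !Zc.1// in h1.
have h2 := metric_triangle (Z i) (seg (Z i) (Z i.+1) u) (Z i.+2).
have h3 := metric_triangle (seg (Z i) (Z i.+1) u) (seg (Z i.+1) (Z i.+2) v) (Z i.+2).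
rewrite (segd0 H)// Zc.2// Zc.1// in h2; rewrite (segd1 H)// Zc.1// in h3.
apply/eqP; rewrite eq_le; apply/andP; split; lra.
Qed.

End interpolation.

Lemma chain_of_curve (N M : nat) (L : R) F : (0 < N)%N -> (N.*2 <= M)%N ->
  local_geodesic_at N L F -> chain M (L / M%:R) (fun i => F (i%:R / M%:R)).
Proof.
move=> N0 NM FL.
have M0 : 0 < M%:R :> R by rewrite ltr0n (leq_trans _ NM)// double_gt0.
have iM i : (i <= M)%N -> 0 <= (i%:R / M%:R : R) <= 1.
  by move=> iM; rewrite divr_ge0//= ler_pdivrMr// mul1r ler_nat.
have st (i k : nat) : (i + k <= M)%N -> (k <= 2)%N ->
    d (F (i%:R / M%:R)) (F ((i + k)%N%:R / M%:R)) = L * (k%:R / M%:R).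
  move=> ikM k2.
  have E : `|i%:R / M%:R - (i + k)%N%:R / M%:R| = k%:R / M%:R :> R.
    by rewrite natrD mulrDl opprD addrA subrr add0r normrN ger0_norm// divr_ge0.
  rewrite FL ?E//; [by apply: iM; apply: leq_trans ikM; rewrite leq_addr|exact: iM|].
  rewrite ler_pdivrMr// mulrC ler_pdivlMr ?ltr0n// -natrM ler_nat.
  by apply: leq_trans NM; rewrite -mul2n leq_mul2r k2 orbT.
split=> i iM'; first by rewrite -(addn1 i) st ?addn1//; ring.
by rewrite -(addn2 i) st ?addn2//; ring.
Qed.

Lemma curve_speed_ge0 N (L : R) F : (0 < N)%N -> local_geodesic_at N L F -> 0 <= L.
Proof.
move=> N0 FL; have N1 : 0 < (N%:R : R)^-1 by rewrite invr_gt0 ltr0n.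
have N01 : 0 <= (N%:R : R)^-1 <= 1.
  by rewrite (ltW N1) invf_le1 ?ltr0n// ler1n.
have := mdist_ge0 (F 0) (F N%:R^-1).
rewrite FL ?lexx ?ler01// sub0r normrN gtr0_norm//.
by rewrite pmulr_lge0.
Qed.

Lemma curve_lipschitz N (L : R) F s t : (0 < N)%N -> local_geodesic_at N L F ->
  0 <= s <= 1 -> 0 <= t <= 1 -> d (F s) (F t) <= L * `|s - t|.
Proof.
move=> N0 FL s01 t01; have N1 : 0 < (N%:R : R) by rewrite ltr0n.
pose q (i : nat) : R := s + (t - s) * (i%:R / N%:R).
have iN i : (i <= N)%N -> 0 <= (i%:R / N%:R : R) <= 1.
  by move=> iN; rewrite divr_ge0//= ler_pdivrMr// mul1r ler_nat.
have q01 i : (i <= N)%N -> 0 <= q i <= 1.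
  by move=> /iN; rewrite /q; set w := _ / _ => w01; apply/andP; split; nra.
have := @path_length (fun i => F (q i)) N (L * (`|s - t| / N%:R)).
have q0 : q 0%N = s by rewrite /q mul0r mulr0 addr0.
have qN : q N = t by rewrite /q divff ?lt0r_neq0// mulr1 addrC subrK.
rewrite /= q0 qN.
have -> : N%:R * (L * (`|s - t| / N%:R)) = L * `|s - t|.
  by field; rewrite lt0r_neq0.
apply => i i_N; have E : `|q i - q i.+1| = `|s - t| / N%:R.
  have -> : q i - q i.+1 = (s - t) / N%:R.
    by rewrite /q -natr1; field; rewrite lt0r_neq0.
  by rewrite normrM (gtr0_norm (x := _^-1)) ?invr_gt0.
rewrite FL ?E ?q01// ?(ltnW i_N)// ler_piMl ?invr_ge0 ?(ltW N1)//.
by rewrite ler_norml; lra.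
Qed.

Definition far_from_core (k : R) F : Prop :=
  forall s c, 0 <= s <= 1 -> D c -> k <= d (F s) c.

Context (lam : R).
Hypothesis lam0 : 0 < lam.
Hypothesis lam_ball : forall z k, (forall c, D c -> k <= d z c) ->
  cat0_ball z (lam * k).

(** Off the core short pieces of [F] are segments, as geodesics are unique in the
    balls of comparison. The comparison of these pieces with the vertex [c] makes
    [d c (F s) ^+ 2 - s ^+ 2 * L ^+ 2] locally midpoint convex. *)
Lemma curve_cn N (L : R) F k c s : (0 < N)%N -> local_geodesic_at N L F ->
  0 < k -> far_from_core k F -> D c -> 0 <= s <= 1 ->
  d c (F s) ^+ 2 <=
    (1 - s) * d c (F 0) ^+ 2 + s * d c (F 1) ^+ 2 - s * (1 - s) * L ^+ 2.
Proof.
move=> N0 FL k0 Fk Dc s01; have L0 := curve_speed_ge0 N0 FL.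
have N1 : 0 < (N%:R : R)^-1 by rewrite invr_gt0 ltr0n.
pose A := d c (F 0); have A0 : 0 <= A := mdist_ge0 _ _.
pose f s := d c (F s) ^+ 2 - s ^+ 2 * L ^+ 2.
suff : f s <= (1 - s) * f 0 + s * f 1 by rewrite /f; nra.
apply: (@local_midpoint_convex _ _ (2 * (A + L) * L + 2 * L ^+ 2)) => //.
- move=> u v u01 v01.
  have uv : `|d c (F u) - d c (F v)| <= `|u - v| * L.
    rewrite ler_norml mulrC; have := curve_lipschitz N0 FL u01 v01.
    have := metric_triangle c (F u) (F v); have := metric_triangle c (F v) (F u).
    by rewrite (metric_sym (F v)); lra.
  have bnd r : 0 <= r <= 1 -> 0 <= d c (F r) <= A + L.
    move=> r01; rewrite mdist_ge0/=.
    have := metric_triangle c (F 0) (F r).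
    have z01 : 0 <= (0 : R) <= 1 by rewrite lexx ler01.
    have := curve_lipschitz N0 FL z01 r01.
    by rewrite sub0r normrN ger0_norm -/A; nra.
  have := bnd _ u01; have := bnd _ v01; rewrite /f; move: uv.
  set x := d c _; set y := d c _ => uv y01 x01.
  have -> : x ^+ 2 - u ^+ 2 * L ^+ 2 - (y ^+ 2 - v ^+ 2 * L ^+ 2) =
    (x - y) * (x + y) - (u - v) * ((u + v) * L ^+ 2) by ring.
  have h1 : `|(x - y) * (x + y)| <= 2 * (A + L) * L * `|u - v|.
    rewrite normrM (ger0_norm (x := x + y)); last lra.
    have -> : 2 * (A + L) * L * `|u - v| = `|u - v| * L * (2 * (A + L)) by ring.
    by rewrite ler_pM//; lra.
  have h2 : `|(u - v) * ((u + v) * L ^+ 2)| <= 2 * L ^+ 2 * `|u - v|.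
    rewrite normrM mulrC (ger0_norm (x := _ * L ^+ 2)); last nra.
    by rewrite ler_wpM2r// ler_wpM2r ?sqr_ge0//; lra.
  apply: le_trans (ler_normB _ _) _; lra.
- move=> t t01; have lk : 0 < lam * k by rewrite mulr_gt0.
  exists (Num.min (Num.min t (1 - t)) (Num.min (N%:R^-1 / 2) (lam * k / (L + 1)))).
    have p1 : 0 < (N%:R : R)^-1 / 2 by rewrite divr_gt0.
    have p2 : 0 < lam * k / (L + 1) by rewrite divr_gt0// ltr_wpDl.
    by rewrite !lt_min p1 p2 !andbT; lra.
  move=> n; rewrite !lt_min => /andP[n0 /andP[/andP[nt n1t] /andP[nN nk]]].
  have t1 : 0 <= t - n <= 1 by lra.
  have t2 : 0 <= t + n <= 1 by lra.
  have tt : 0 <= t <= 1 by lra.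
  have nkL : n * (L + 1) < lam * k by rewrite -ltr_pdivlMr// ltr_wpDl.
  have FLe u v : 0 <= u <= 1 -> 0 <= v <= 1 -> u <= v -> v - u <= N%:R^-1 ->
      d (F u) (F v) = (v - u) * L.
    move=> u01 v01 uv uvN; have E : `|u - v| = v - u.
      by rewrite distrC ger0_norm// subr_ge0.
    by rewrite FL ?E// mulrC.
  have d1 : d (F (t - n)) (F t) = n * L by rewrite FLe; lra.
  have d2 : d (F t) (F (t + n)) = n * L by rewrite FLe; lra.
  have d3 : d (F (t - n)) (F (t + n)) = 2 * n * L by rewrite FLe; lra.
  have h01 : 0 <= (1 / 2 : R) <= 1 by lra.
  have ball : cat0_ball (F t) (lam * k) by apply: lam_ball => b Db; exact: Fk.
  have E : F t = seg (F (t - n)) (F (t + n)) (1 / 2).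
    apply: (ball_unique ball) => //; rewrite ?(metric_sym (F t) (F (t - n))) ?d1 ?d2 ?d3 ?mdistxx; nra.
  have := cn_vertex H (F (t - n)) (F (t + n)) Dc h01.
  by rewrite /cn_ineq -E d3 /f; nra.
Qed.

(** A local geodesic avoiding the core is strictly shorter than every detour
    through the core: in the comparison segment the point at proportion
    [a / (a + b)] would be at distance [0] from [c] if [L = a + b]. *)
Lemma curve_gap N (L : R) F k : (0 < N)%N -> local_geodesic_at N L F ->
  0 < k -> far_from_core k F ->
  exists2 g, 0 < g & forall c, D c -> L + g <= d (F 0) c + d (F 1) c.
Proof.
move=> N0 FL k0 Fk; have L0 := curve_speed_ge0 N0 FL.
have q0 : 0 < 4 * k ^+ 2 / (2 * L + 1).
  by rewrite divr_gt0 ?mulr_gt0 ?exprn_gt0//; lra.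
exists (Num.min 1 (4 * k ^+ 2 / (2 * L + 1))); first by rewrite lt_min ltr01.
move=> c Dc; pose a := d c (F 0); pose b := d c (F 1).
have z01 : 0 <= (0 : R) <= 1 by rewrite lexx ler01.
have o01 : 0 <= (1 : R) <= 1 by rewrite lexx ler01.
have ak : k <= a by rewrite /a metric_sym Fk.
have bk : k <= b by rewrite /b metric_sym Fk.
rewrite !(metric_sym _ c) -/a -/b.
pose s := a / (a + b).
have ab0 : 0 < a + b by lra.
have s01 : 0 <= s <= 1.
  by apply/andP; split; [apply: divr_ge0; lra|rewrite ler_pdivrMr// mul1r; lra].
have := curve_cn N0 FL k0 Fk Dc s01; rewrite -/a -/b.
have := Fk s c s01 Dc; rewrite (metric_sym (F s) c); set u := d c (F s) => ku uE.
have u2 : k ^+ 2 <= u ^+ 2 by rewrite lerXn2r// nnegrE; lra.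
have sE : s * (a + b) = a by rewrite /s; field; lra.
have E : (1 - s) * a ^+ 2 + s * b ^+ 2 - s * (1 - s) * L ^+ 2 =
    s * (1 - s) * ((a + b) ^+ 2 - L ^+ 2).
  have -> : b = (a + b) - a by ring.
  by rewrite -{1 3}sE; move: (a + b) => w; ring.
rewrite E in uE; have s4 : 0 <= s * (1 - s) <= 1 / 4.
  have := sqr_ge0 (s - 1 / 2); rewrite expr2 => sq.
  by move: s01 sq; move: (s) => s' s01 sq; apply/andP; split; nra.
have S2 : 4 * k ^+ 2 <= (a + b) ^+ 2 - L ^+ 2.
  have k2 : 0 < k ^+ 2 by rewrite exprn_gt0.
  have : 0 < (a + b) ^+ 2 - L ^+ 2.
    by rewrite ltNge; apply/negP => le0; nra.
  nra.
have [L1|L1] := leP (L + 1) (a + b).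
  by rewrite (le_trans _ L1)// lerD2l ge_min lexx.
have LL : (a + b) ^+ 2 - L ^+ 2 = (a + b - L) * (a + b + L) by ring.
rewrite LL in S2.
have k2 : 0 < k ^+ 2 by rewrite exprn_gt0.
have abL : 0 < a + b - L by rewrite ltNge; apply/negP => le0; nra.
suff : 4 * k ^+ 2 / (2 * L + 1) <= a + b - L.
  by move=> h; rewrite -lerBrDl ge_min h orbT.
rewrite ler_pdivrMr; last lra.
by apply: le_trans S2 _; rewrite ler_wpM2l//; lra.
Qed.

End curves.

(** * Contraction towards the core *)

Section almost_minimal_detour.
Context {R : realType} {Y : metricType R} (D : set Y) (seg : Y -> Y -> R -> Y).
Hypothesis H : relative_cat0 D seg.
Local Notation d := mdist.
Implicit Types (p a b m c x y z P : Y).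

Lemma core_midpoint_sqr x c c' : D c -> D c' ->
  d x (seg c c' (1 / 2)) ^+ 2 <=
    (d x c ^+ 2 + d x c' ^+ 2) / 2 - d c c' ^+ 2 / 4.
Proof.
move=> Dc Dc'; have h01 : 0 <= (1 / 2 : R) <= 1 by lra.
by have := cn_side H x c' Dc h01; rewrite /cn_ineq; lra.
Qed.

Lemma core_midpoint_le x c c' : D c -> D c' ->
  d x (seg c c' (1 / 2)) <= (d x c + d x c') / 2.
Proof.
move=> Dc Dc'; have := core_midpoint_sqr x Dc Dc'.
have := metric_triangle x c c'; have := metric_triangle x c' c.
rewrite (metric_sym c' c); have := mdist_ge0 x c; have := mdist_ge0 x c'.
move=> h1 h2 h3 h4 h5; apply: le_of_sqr; first lra.
have : (d x c - d x c') ^+ 2 <= d c c' ^+ 2.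
  rewrite -[leLHS]real_normK ?num_real//; rewrite lerXn2r// ?nnegrE ?mdist_ge0//.
  by rewrite ler_norml; lra.
lra.
Qed.

(** The sum of the distances to [x] and [y] need not attain its minimum on the
    core uniquely, so it is made strictly convex by adding a small multiple of
    a squared distance; the minimum of the result is almost a minimum of the
    sum, with an error proportional to the distance from the minimizer. *)
Lemma almost_minimal_detour x y : exists2 B : R, 0 <= B &
  forall e, 0 < e <= 1 -> exists c, [/\ D c, d x c + d y c <= B &
    forall P, D P ->
      d x c + d y c <= d x P + d y P + e * ((2 * B + d c P) * d c P)].
Proof.
have [c1 Dc1] := core_nonempty H.
pose S c := d x c + d y c.
have S0 c : 0 <= S c by rewrite addr_ge0 ?mdist_ge0.
exists (S c1 + d x c1 ^+ 2); first by rewrite addr_ge0 ?sqr_ge0.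
move=> e /andP[e0 e1]; pose Phi c := S c + e * d x c ^+ 2.
have Phi0 c : 0 <= Phi c by rewrite addr_ge0// mulr_ge0 ?sqr_ge0 ?ltW.
pose V := [set Phi c | c in D]; pose m := inf V.
have V0 : has_inf V by split; [exists (Phi c1); exists c1|exists 0 => _ [c _ <-]].
have mV c : D c -> m <= Phi c by move=> Dc; apply: (ge_inf V0.2); exists c.
have mid c c' : D c -> D c' -> e / 4 * d c c' ^+ 2 <= (Phi c + Phi c') / 2 - m.
  move=> Dc Dc'; have h01 : 0 <= (1 / 2 : R) <= 1 by lra.
  have := mV _ (core_convex H Dc Dc' h01).
  have := core_midpoint_le x Dc Dc'; have := core_midpoint_le y Dc Dc'.
  have := ler_wpM2l (ltW e0) (core_midpoint_sqr x Dc Dc'); rewrite /Phi /S; lra.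
have approx n : exists c, D c /\ Phi c < m + n.+1%:R^-1.
  have n0 : 0 < (n.+1%:R : R)^-1 by rewrite invr_gt0.
  by have [_ [c Dc <-] cm] := inf_adherent n0 V0; exists c.
have [u Hu] := choice approx.
have inv_small (b : R) : 0 < b -> exists N : nat, forall n : nat, (N <= n)%N ->
    (n.+1%:R : R)^-1 < b.
  move=> b0; exists (Num.truncn b^-1) => n Nn.
  rewrite invf_plt ?posrE ?ltr0n//.
  by apply: lt_le_trans (truncnS_gt _) _; rewrite ler_nat.
have [|l Hl] := cauchy_complete H (u := u).
  move=> b b0; have eb : 0 < e / 4 * b ^+ 2 by rewrite mulr_gt0 ?exprn_gt0//; lra.
  have [N HN] := inv_small _ eb.
  exists N => i j Ni Nj; have := mid _ _ (Hu i).1 (Hu j).1.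
  have := (Hu i).2; have := (Hu j).2; have := HN _ Ni; have := HN _ Nj.
  move: (i.+1%:R^-1) (j.+1%:R^-1) => qi qj h1 h2 h3 h4 h5.
  have : e / 4 * d (u i) (u j) ^+ 2 < e / 4 * b ^+ 2 by lra.
  rewrite ltr_pM2l; last lra.
  by rewrite ltr_pXn2r// ?nnegrE ?mdist_ge0 ?(ltW b0).
have Dl : D l.
  apply: (core_closed H) => b b0; have [N HN] := Hl b b0.
  by exists (u N); [exact: (Hu N).1|rewrite metric_sym; exact: HN].
have Phil : Phi l <= m.
  apply/ler_addgt0Pr => b b0.
  pose K := 2 + 2 * d x l + 1; have K0 : 0 < K.
    by rewrite /K; have := mdist_ge0 x l; lra.
  have bK : 0 < Num.min 1 (b / (2 * K)).
    by rewrite lt_min ltr01 divr_gt0// mulr_gt0.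
  have [N1 HN1] := Hl _ bK; have [N2 HN2] := inv_small (b / 2) ltac:(lra).
  have := HN1 (maxn N1 N2) (leq_maxl _ _); have := HN2 (maxn N1 N2) (leq_maxr _ _).
  have := (Hu (maxn N1 N2)).2; set n := maxn N1 N2; rewrite lt_min.
  move: (n.+1%:R^-1) => qn.
  move=> h1 h2 /andP[h3]; rewrite ltr_pdivlMr ?mulr_gt0// => h4.
  have t1 := metric_triangle x (u n) l; have t2 := metric_triangle y (u n) l.
  have t3 := metric_triangle x l (u n); rewrite (metric_sym l (u n)) in t3.
  have : d x l ^+ 2 <= d x (u n) ^+ 2 + d (u n) l * (2 * d x l + 1).
    have := mdist_ge0 x l; have := mdist_ge0 x (u n); have := mdist_ge0 (u n) l.
    move: h3 t1 t3; move: (d (u n) l) (d x l) (d x (u n)) => q w v h3 t1 t3 q0 v0 w0.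
    have : w ^+ 2 - v ^+ 2 <= q * (w + v).
      have -> : w ^+ 2 - v ^+ 2 = (w - v) * (w + v) by ring.
      by rewrite ler_wpM2r; lra.
    have : q * (w + v) <= q * (2 * w + 1) by rewrite ler_wpM2l; lra.
    lra.
  move=> h5; have h5' : e * d x l ^+ 2 <= e * d x (u n) ^+ 2 +
      d (u n) l * (2 * d x l + 1).
    have := ler_wpM2l (ltW e0) h5; rewrite mulrDr => /le_trans; apply.
    by rewrite lerD2l ler_piMl// mulr_ge0 ?mdist_ge0// addr_ge0 ?mulr_ge0 ?mdist_ge0.
  by move: h4 h1; rewrite /Phi /S /K; lra.
have xlB : S l + e * d x l ^+ 2 <= S c1 + d x c1 ^+ 2.
  apply: le_trans Phil (le_trans (mV _ Dc1) _).
  by rewrite lerD2l ler_piMl// sqr_ge0.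
exists l; split => //.
  by apply: le_trans xlB; rewrite lerDl mulr_ge0 ?sqr_ge0 ?ltW.
move=> P DP; have := le_trans Phil (mV _ DP); rewrite /Phi -/(S l) -/(S P) => h.
have q0 := mdist_ge0 l P; have w0 := mdist_ge0 x l; have v0 := mdist_ge0 x P.
have xl : d x l <= S c1 + d x c1 ^+ 2.
  apply: le_trans xlB; rewrite /S; have := mdist_ge0 y l.
  have : 0 <= e * d x l ^+ 2 by rewrite mulr_ge0 ?sqr_ge0 ?ltW.
  lra.
have t1 := metric_triangle x l P.
have hP : d x P ^+ 2 - d x l ^+ 2 <=
    (2 * (S c1 + d x c1 ^+ 2) + d l P) * d l P.
  have -> : d x P ^+ 2 - d x l ^+ 2 = (d x P + d x l) * (d x P - d x l) by ring.
  apply: (@le_trans _ _ ((d x P + d x l) * d l P)).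
    by rewrite ler_wpM2l//; lra.
  by rewrite ler_wpM2r//; lra.
have := ler_wpM2l (ltW e0) hP; lra.
Qed.

End almost_minimal_detour.

Section contraction.
Context {R : realType} {Y : metricType R} (D : set Y) (seg : Y -> Y -> R -> Y).
Hypothesis H : relative_cat0 D seg.
Local Notation d := mdist.
Local Notation cat0_ball := (cat0_ball seg).
Implicit Types (p a b m c x y z P : Y) (Z : nat -> Y).

Context (lam k A L th : R) (N : nat) (c x y : Y).
Hypotheses (lam0 : 0 < lam) (k0 : 0 < k) (L0 : 0 <= L) (th0 : 1 / 2 <= th < 1).
Hypothesis lam_ball : forall z k, (forall c, D c -> k <= d z c) ->
  cat0_ball z (lam * k).
Hypothesis Dc : D c.
Hypothesis AB : d c x + d c y + L <= A.
Hypothesis thA : (1 - th) * A <= lam * k / 16 /\ (1 - th) * A <= k / 2.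
Hypothesis LN : L / N.+1%:R <= lam * k / 4.
Hypothesis detour : forall P (t : R), D P -> 0 < t <= 1 -> d c P <= (A + k) * t ->
  t * (L + 2 * k) < d (seg c x t) P + d (seg c y t) P.

(** A chain at scale [th ^+ j] between the images of [x] and [y]; the distance from
    the core and the step are bounded in proportion to the scale. *)
Definition contracted (j : nat) (h : R) Z : Prop :=
  [/\ chain N.+1 h Z, Z 0%N = seg c x (th ^+ j), Z N.+1 = seg c y (th ^+ j),
      forall i P, (i <= N.+1)%N -> D P -> k * th ^+ j <= d (Z i) P &
      h <= th ^+ j * (L / N.+1%:R)].

Lemma thj01 j : 0 < th ^+ j <= 1.
Proof.
by have th01 := th0; rewrite exprn_gt0 ?exprn_ile1//; lra.
Qed.

Lemma contracted_dist j h Z i : contracted j h Z -> (i <= N.+1)%N ->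
  d c (Z i) <= A * th ^+ j.
Proof.
move=> [Zc Z0 _ _ hj] iN; have := thj01 j; set t := th ^+ j => t01.
have t01' : 0 <= t <= 1 by lra.
have := @path_length _ _ Z i h (fun n ni => _).
have Zh n : (n < i)%N -> d (Z n) (Z n.+1) <= h.
  by move=> ni; rewrite Zc.1// (leq_trans ni).
have := path_length Zh; rewrite Z0 => h1 _.
have := metric_triangle c (seg c x t) (Z i); rewrite (segd0 H)// => h2.
have h0 := chain_step_ge0 (ltn0Sn N) Zc.
have h3 : i%:R * h <= N.+1%:R * h by rewrite ler_wpM2r// ler_nat.
have h4 : N.+1%:R * h <= t * L.
  have := ler_wpM2l (ler0n R N.+1) hj; rewrite -/t.
  by have -> : N.+1%:R * (t * (L / N.+1%:R)) = t * L by field.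
have := ler_wpM2l (proj1 (andP t01')) AB.
have : 0 <= t * d c y by rewrite mulr_ge0 ?mdist_ge0//; lra.
move: h1 h2 h3 h4; rewrite -/t; lra.
Qed.

Lemma contracted_ball j h Z i : contracted j h Z -> (i <= N.+1)%N ->
  cat0_ball (Z i) (lam * (k * th ^+ j)).
Proof. by move=> [_ _ _ Zk _] iN; apply: lam_ball => P DP; exact: Zk. Qed.

(** One contraction step. The homothety of ratio [th] centred at [c] carries
    the chain close to the new one and does not increase distances by more than
    the factor [th], so the new chain, which minimizes the energy, is shorter
    than the old one by this factor; near a point [P] of the core it would be
    shorter than the detour through [P]. *)
Lemma contract_step j h Z : contracted j h Z ->
  exists h' Z', [/\ contracted j.+1 h' Z', h' <= th * h &
    forall i, (i <= N.+1)%N -> d (Z i) (Z' i) <= (1 - th) * A * th ^+ j].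
Proof.
move=> Zj; have [Zc Z0 ZN Zk hj] := Zj.
have th01 := th0; have lam0' := lam0; have k0' := k0.
have [thA1 thA2] := thA.
have := thj01 j; set t := th ^+ j => t01.
have t01' : 0 <= t <= 1 by lra.
have th01' : 0 <= th <= 1 by lra.
pose e := (1 - th) * A * t; pose r := lam * (k * t).
have r0 : 0 <= r by rewrite !mulr_ge0//; lra.
have er : e <= r / 16.
  have := ler_wpM2r (proj1 (andP t01')) thA1; rewrite /e /r; lra.
have hr : h <= r / 4.
  apply: (le_trans hj); have := ler_wpM2l (proj1 (andP t01')) LN.
  by rewrite /r -/t; move: (L / N.+1%:R) => q; lra.
have h0 := chain_step_ge0 (ltn0Sn N) Zc.
have e0 : 0 <= e.
  rewrite /e mulr_ge0 ?mulr_ge0//; try lra.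
  have := mdist_ge0 c x; have := mdist_ge0 c y; have := AB; have := L0; lra.
have cZ i : (i <= N.+1)%N -> d (Z i) (seg c (Z i) th) <= e.
  move=> iN; rewrite metric_sym (segd1 H)// /e.
  have h1 : 0 <= 1 - th by lra.
  by have := ler_wpM2l h1 (contracted_dist Zj iN); rewrite -/t; lra.
have Zr i : (i <= N.+1)%N -> cat0_ball (Z i) r by move=> iN; exact: (contracted_ball Zj iN).
have her : h + e <= r by lra.
have [h' [Z' [Z'c Z'0 Z'N ZZ']]] := chain_move_ends H Zc her Zr (cZ 0%N isT) (cZ N.+1 (leqnn _)).
have h'0 := chain_step_ge0 (ltn0Sn N) Z'c.
have h'r : h' <= r / 4 + 2 * e.
  rewrite -(Z'c.1 0%N)//; have := metric_triangle (Z' 0%N) (Z 0%N) (Z' 1%N).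
  have := metric_triangle (Z 0%N) (Z 1%N) (Z' 1%N); rewrite Zc.1//.
  rewrite (metric_sym (Z' 0%N) (Z 0%N)); have := ZZ' 0%N isT.
  by have := ZZ' 1%N isT; move: hr; rewrite /e; lra.
have Z'r i : (i <= N.+1)%N -> cat0_ball (Z' i) (r / 2).
  move=> iN; have -> : r / 2 = lam * (k * t / 2) by rewrite /r; lra.
  apply: lam_ball => P DP; have := Zk i P iN DP; have := ZZ' i iN.
  have := metric_triangle (Z i) (Z' i) P; have := ler_wpM2r (proj1 (andP t01')) thA2.
  by rewrite -/t -/e; lra.
have h'2 : h' + 2 * e <= r / 2 by lra.
have Z'W i : (i <= N.+1)%N -> d (Z' i) (seg c (Z i) th) <= 2 * e.
  move=> iN; have := metric_triangle (Z' i) (Z i) (seg c (Z i) th).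
  rewrite (metric_sym (Z' i) (Z i)); have := ZZ' i iN; have := cZ i iN.
  by rewrite -/t -/e; lra.
have N1 : 0 < N.+1%:R :> R by [].
have h'h : h' <= th * h.
  have := energy_minimal Z'c h'2 Z'r Z'W (esym Z'0) (esym Z'N).
  have : 0 <= \sum_(i < N.+1) (d (Z' i) (seg c (Z i) th) -
      d (Z' i.+1) (seg c (Z i.+1) th)) ^+ 2.
    by apply: sumr_ge0 => i _; exact: sqr_ge0.
  have : energy N.+1 (fun i => seg c (Z i) th) <= N.+1%:R * (th * h) ^+ 2.
    have -> : N.+1%:R * (th * h) ^+ 2 = \sum_(i < N.+1) (th * h) ^+ 2.
      by rewrite sumr_const card_ord mulr_natl.
    apply: ler_sum => i _; rewrite lerXn2r// ?nnegrE ?mdist_ge0//.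
      by rewrite mulr_ge0//; lra.
    by rewrite -(Zc.1 i (ltn_ord i)); exact: (homothety H).
  move=> e1 e2 e3; apply: le_of_sqr; first by rewrite mulr_ge0//; lra.
  by rewrite -(ler_pM2l N1); apply: le_trans (le_trans e3 e1); rewrite lerDl.
have E : th * t = th ^+ j.+1 by rewrite exprS.
exists h', Z'; split => //; split => //.
- by rewrite Z'0 Z0 (seg_segD H)// E.
- by rewrite Z'N ZN (seg_segD H)// E.
- move=> i P iN DP; rewrite leNgt; apply/negP => iP.
  have tt : 0 < th ^+ j.+1 <= 1 := thj01 _.
  have N1h' : N.+1%:R * h' <= th ^+ j.+1 * L.
    have := ler_wpM2l (ler0n R N.+1) (le_trans h'h (ler_wpM2l (proj1 (andP th01')) hj)).
    by have -> : N.+1%:R * (th * (t * (L / N.+1%:R))) = th * t * L;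
      [field|rewrite E].
  have l1 : d (Z' 0%N) (Z' i) <= i%:R * h'.
    by apply: path_length => n ni; rewrite Z'c.1// (leq_trans ni).
  have l2 : d (Z' i) (Z' N.+1) <= (N.+1 - i)%N%:R * h'.
    have := @path_length _ _ (fun n => Z' (i + n)%N) (N.+1 - i)%N h'.
    rewrite /= addn0 subnKC//; apply => n ni.
    by rewrite addnS Z'c.1// -ltn_subRL.
  have Ni : i%:R * h' + (N.+1 - i)%N%:R * h' = N.+1%:R * h'.
    by rewrite -mulrDl -natrD subnKC.
  have x' : d (Z' 0%N) P <= i%:R * h' + d (Z' i) P.
    by apply: le_trans (metric_triangle _ (Z' i) _) _; rewrite lerD2r.
  have y' : d (Z' N.+1) P <= (N.+1 - i)%N%:R * h' + d (Z' i) P.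
    apply: le_trans (metric_triangle _ (Z' i) _) _; rewrite lerD2r.
    by rewrite metric_sym.
  have Z'0c : Z' 0%N = seg c x (th ^+ j.+1) by rewrite Z'0 Z0 (seg_segD H)// E.
  have Z'Nc : Z' N.+1 = seg c y (th ^+ j.+1) by rewrite Z'N ZN (seg_segD H)// E.
  rewrite Z'0c in x' l1; rewrite Z'Nc in y' l2.
  have tt' : 0 <= th ^+ j.+1 <= 1 by lra.
  have cP : d c P <= (A + k) * th ^+ j.+1.
    have := metric_triangle c (seg c x (th ^+ j.+1)) P; rewrite (segd0 H)//.
    have : i%:R * h' <= N.+1%:R * h' by rewrite ler_wpM2r// ler_nat.
    have := ler_wpM2l (proj1 (andP tt')) AB.
    have : 0 <= th ^+ j.+1 * d c y by rewrite mulr_ge0 ?mdist_ge0//; lra.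
    lra.
  have := detour DP tt cP; lra.
- by apply: le_trans h'h _; rewrite -E -mulrA ler_wpM2l//; lra.
Qed.

End contraction.

(** * Limits of contractions *)

Section contraction_limit.
Context {R : realType} {Y : metricType R} (D : set Y) (seg : Y -> Y -> R -> Y).
Hypothesis H : relative_cat0 D seg.
Local Notation d := mdist.
Local Notation cat0_ball := (cat0_ball seg).
Implicit Types (p a b m c x y z P : Y) (Z : nat -> Y).

Context (lam k A L th : R) (N : nat) (c x y : Y).
Hypotheses (lam0 : 0 < lam) (k0 : 0 < k) (L0 : 0 <= L) (th0 : 1 / 2 <= th < 1).
Hypothesis lam_ball : forall z k, (forall c, D c -> k <= d z c) ->
  cat0_ball z (lam * k).
Hypothesis Dc : D c.
Hypothesis AB : d c x + d c y + L <= A.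
Hypothesis thA : (1 - th) * A <= lam * k / 16 /\ (1 - th) * A <= k / 2.
Hypothesis LN : L / N.+1%:R <= lam * k / 4.
Hypothesis detour : forall P (t : R), D P -> 0 < t <= 1 -> d c P <= (A + k) * t ->
  t * (L + 2 * k) < d (seg c x t) P + d (seg c y t) P.
Local Notation contracted := (contracted D seg k L th N c x y).

Definition contraction_sequence (h : nat -> R) (Z : nat -> nat -> Y) : Prop :=
  forall j, [/\ contracted j (h j) (Z j), h j.+1 <= th * h j &
    forall i, (i <= N.+1)%N -> d (Z j i) (Z j.+1 i) <= (1 - th) * A * th ^+ j].

Lemma contraction_sequence_exists h0 Z0 : contracted 0 h0 Z0 ->
  exists h (Z : nat -> nat -> Y), [/\ contraction_sequence h Z, h 0%N = h0 & Z 0%N = Z0].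
Proof.
move=> C0.
pose ok (q q' : nat * R * (nat -> Y)) := contracted q.1.1 q.1.2 q.2 ->
  [/\ q'.1.1 = q.1.1.+1, contracted q'.1.1 q'.1.2 q'.2, q'.1.2 <= th * q.1.2 &
    forall i, (i <= N.+1)%N -> d (q.2 i) (q'.2 i) <= (1 - th) * A * th ^+ q.1.1].
have [next Hnext] : exists next, forall q, ok q (next q).
  suff: forall q, exists q', ok q q' by move=> /choice[f Hf]; exists f.
  move=> [[j h] Z].
  have [Cj|nCj] := pselect (contracted j h Z); last by exists (j, h, Z).
  have [h' [Z' [C' hh ZZ]]] :=
    contract_step H lam0 k0 L0 th0 lam_ball Dc AB thA LN detour Cj.
  by exists (j.+1, h', Z').
pose q j := iter j next (0%N, h0, Z0).
have q_ok j : (q j).1.1 = j /\ contracted j (q j).1.2 (q j).2.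
  elim: j => [//|j [qj Cj]].
  by have := Hnext (q j); rewrite /ok qj => /(_ Cj)[-> C' _ _].
exists (fun j => (q j).1.2), (fun j => (q j).2); split => // j.
have [qj Cj] := q_ok j; split => //.
  by have := Hnext (q j); rewrite /ok qj => /(_ Cj)[].
by have := Hnext (q j); rewrite /ok qj => /(_ Cj)[].
Qed.

Context (h : nat -> R) (Z : nat -> nat -> Y).
Hypothesis hZ : contraction_sequence h Z.

(** The scaled steps [h j / th ^+ j] decrease. *)
Lemma scaled_step_limit : exists2 l : R, 0 <= l & forall e : R, 0 < e ->
  exists J : nat, forall j : nat, (J <= j)%N -> l <= h j / th ^+ j <= l + e.
Proof.
have th01 := th0.
have tj j : 0 < th ^+ j by rewrite exprn_gt0//; lra.
pose u (j : nat) := h j / th ^+ j.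
have u0 j : 0 <= u j.
  have [[Zc _ _ _ _] _ _] := hZ j.
  by rewrite divr_ge0 ?(ltW (tj j)) ?(chain_step_ge0 (ltn0Sn N) Zc).
have u_dec : nonincreasing_seq u.
  apply/nonincreasing_seqP => j; rewrite /u exprS.
  have [_ hj _] := hZ j; rewrite invfM mulrA ler_pM2r ?invr_gt0 ?tj//.
  by rewrite ler_pdivrMr ?(mulrC (h j))//; lra.
have u_lb : has_lbound (range u) by exists 0 => _ [j _ <-].
have cv := nonincreasing_cvgn u_dec u_lb.
have ul j : inf (range u) <= u j by apply: ge_inf => //; exists j.
exists (inf (range u)).
  by apply: lb_le_inf; [exists (u 0%N); exists 0%N|move=> _ [j _ <-]].
move=> e e0; move/cvgrPdist_le : cv => /(_ e e0) [J _ HJ].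
exists J => j Jj; rewrite ul/=; have := HJ j Jj.
by rewrite /= ler_norml /u; lra.
Qed.

Let r := lam * k.

Let h_le j : 0 <= h j <= th ^+ j * (r / 4).
Proof.
have [[Zc _ _ _ hj] _ _] := hZ j.
rewrite (chain_step_ge0 (ltn0Sn N) Zc)/=; apply: (le_trans hj).
by rewrite ler_wpM2l// ?LN// exprn_ge0//; have := th0; lra.
Qed.

Let A0 : 0 <= A.
Proof. by have := mdist_ge0 c x; have := mdist_ge0 c y; have := AB; have := L0; lra. Qed.

(** Energies divided by the square of the scale decrease along the sequence,
    hence converge; since a chain minimizes the energy, the contraction of the
    [j]-th chain to a much smaller scale has nearly minimal energy and is
    therefore close to the chain at that scale. *)
Lemma contraction_cauchy (e : R) : 0 < e -> exists J : nat,
  forall (j i n : nat), (J <= j)%N -> (n <= N.+1)%N ->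
    d (seg c (Z j n) (th ^+ i)) (Z (j + i)%N n) <= e * th ^+ (j + i).
Proof.
move=> e0; have th01 := th0; have lam0' := lam0; have k0' := k0.
have [thA1 thA2] := thA; have A0' := A0.
have tj j : 0 < th ^+ j by rewrite exprn_gt0//; lra.
have tj1 j : 0 <= th ^+ j <= 1.
  by rewrite (ltW (tj j)) exprn_ile1//; lra.
have r0 : 0 < r by rewrite mulr_gt0.
pose e1 := Num.min e (r / 8).
have e1e : e1 <= e by rewrite ge_min lexx.
have e1r : e1 <= r / 8 by rewrite ge_min lexx orbT.
have e10 : 0 < e1 by rewrite lt_min e0/=; lra.
have M0 : 0 < N.+1%:R :> R by [].
have [l l0 Hl] := scaled_step_limit.
pose u (j : nat) := h j / th ^+ j.
have hu j : h j = u j * th ^+ j by rewrite /u divfK// gt_eqF.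
have K0 : 0 < N.+1%:R ^+ 2 * (2 * l + 1) :> R.
  by rewrite mulr_gt0 ?exprn_gt0//; lra.
have d0 : 0 < Num.min 1 (e1 ^+ 2 / (N.+1%:R ^+ 2 * (2 * l + 1))).
  by rewrite lt_min ltr01 divr_gt0// exprn_gt0.
have [J HJ] := Hl _ d0; exists J => j i n Jj nN.
have uu (m : nat) : N.+1%:R ^+ 2 * (u j ^+ 2 - u (j + m)%N ^+ 2) <= e1 ^+ 2.
  have /andP[a1 a2] := HJ j Jj.
  have /andP[b1 _] := HJ (j + m)%N (leq_trans Jj (leq_addr _ _)).
  have m1 : Num.min 1 (e1 ^+ 2 / (N.+1%:R ^+ 2 * (2 * l + 1))) <= 1.
    by rewrite ge_min lexx.
  have m2 : Num.min 1 (e1 ^+ 2 / (N.+1%:R ^+ 2 * (2 * l + 1))) <=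
     e1 ^+ 2 / (N.+1%:R ^+ 2 * (2 * l + 1)) by rewrite ge_min lexx orbT.
  move: m1 m2 d0 a2; rewrite -/(u j); move: (Num.min _ _) => q q1.
  rewrite ler_pdivlMr// => q2 q0 uq.
  have -> : e1 ^+ 2 = N.+1%:R ^+ 2 * (e1 ^+ 2 / N.+1%:R ^+ 2) by field.
  rewrite ler_pM2l ?exprn_gt0// ler_pdivlMr ?exprn_gt0//.
  have : u j ^+ 2 - u (j + m)%N ^+ 2 <= q * (2 * l + 1).
    by move: a1 b1; rewrite -/(u j) -/(u _); nra.
  move=> /(ler_wpM2r (ltW (exprn_gt0 2 M0)))/le_trans; apply.
  by apply: le_trans q2; rewrite le_eqVlt; apply/orP; left; apply/eqP; ring.
suff : d (seg c (Z j n) (th ^+ i)) (Z (j + i)%N n) <= e1 * th ^+ (j + i).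
  by move=> /le_trans; apply; rewrite ler_wpM2r// ltW.
elim: i n nN => [|i IH] n nN.
  by rewrite expr0 (seg1 H) addn0 mdistxx mulr_ge0// ltW.
rewrite addnS.
have [Cj _ _] := hZ j; have [Ci hi Zi] := hZ (j + i)%N.
have [Ci1 _ _] := hZ (j + i).+1.
have [Zjc Zj0 ZjN _ _] := Cj; have [Zic Zi0 ZiN _ _] := Ci1.
set t := th ^+ (j + i) in IH Zi *; have tE : th ^+ (j + i).+1 = th * t by rewrite exprS.
have tp : 0 < t := tj _; have tpS : 0 < th * t by rewrite mulr_gt0//; lra.
have rt : 0 <= r * t by rewrite mulr_ge0// ltW.
have thAt : (1 - th) * A * t <= r / 16 * t.
  by rewrite ler_wpM2r ?(ltW tp).
pose e2 := th * (e1 * t) + 2 * ((1 - th) * A * t).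
have e2r : h (j + i).+1 + e2 <= lam * (k * (th ^+ (j + i).+1)).
  have /andP[_] := h_le (j + i).+1; rewrite tE => hle.
  have h1 : th * (e1 * t) <= th * (r / 8 * t).
    by apply: ler_wpM2l; [lra|rewrite ler_wpM2r ?(ltW tp)].
  have h2 : r * t <= 2 * th * (r * t) by rewrite ler_peMl//; lra.
  have -> : lam * (k * (th * t)) = th * (r * t) by rewrite /r; ring.
  by rewrite /e2; lra.
have iN1 i' : (i' <= N.+1)%N ->
    d (Z (j + i).+1 i') (seg c (Z j i') (th ^+ i.+1)) <= e2.
  move=> i'N; have thth : 0 <= th <= 1 by lra.
  have -> : seg c (Z j i') (th ^+ i.+1) = seg c (seg c (Z j i') (th ^+ i)) th.
    by rewrite (seg_segD H)// exprS.
  have t1 := metric_triangle (Z (j + i).+1 i') (Z (j + i)%N i')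
    (seg c (seg c (Z j i') (th ^+ i)) th).
  have t2 := metric_triangle (Z (j + i)%N i') (seg c (Z (j + i)%N i') th)
    (seg c (seg c (Z j i') (th ^+ i)) th).
  have t3 := homothety H (Z (j + i)%N i') (seg c (Z j i') (th ^+ i)) Dc thth.
  have t4 := IH i' i'N; have t5 := Zi i' i'N.
  have t6 : d (Z (j + i)%N i') (seg c (Z (j + i)%N i') th) <= (1 - th) * A * t.
    have h1 : 0 <= 1 - th by lra.
    rewrite metric_sym (segd1 H)//.
    by rewrite -mulrA; apply: (ler_wpM2l h1); exact: (contracted_dist H th0 AB Ci i'N).
  have t7 : th * d (Z (j + i)%N i') (seg c (Z j i') (th ^+ i)) <= th * (e1 * t).
    by apply: ler_wpM2l; [lra|rewrite metric_sym].
  rewrite (metric_sym (Z (j + i).+1 i') (Z (j + i)%N i')) in t1.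
  rewrite /e2; lra.
have tjj : th ^+ i.+1 * th ^+ j = th * t by rewrite -exprD addnC addnS tE.
have W0 : seg c (Z j 0%N) (th ^+ i.+1) = Z (j + i).+1 0%N.
  by rewrite Zj0 (seg_segD H)// Zi0 tE tjj.
have WN : seg c (Z j N.+1) (th ^+ i.+1) = Z (j + i).+1 N.+1.
  by rewrite ZjN (seg_segD H)// ZiN tE tjj.
have Zr i' : (i' <= N.+1)%N ->
    cat0_ball (Z (j + i).+1 i') (lam * (k * th ^+ (j + i).+1)).
  by move=> i'N; exact: (contracted_ball lam_ball Ci1 i'N).
have := energy_close Zic e2r Zr iN1 W0 WN nN.
have : energy N.+1 (fun n => seg c (Z j n) (th ^+ i.+1)) <=
    N.+1%:R * (th * t * u j) ^+ 2.
  have -> : N.+1%:R * (th * t * u j) ^+ 2 = \sum_(i < N.+1) (th * t * u j) ^+ 2.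
    by rewrite sumr_const card_ord mulr_natl.
  apply: ler_sum => i' _; have uj0 : 0 <= u j.
    by rewrite divr_ge0 ?(ltW (tj j))//; have /andP[] := h_le j.
  rewrite lerXn2r// ?nnegrE ?mdist_ge0//; first by rewrite mulr_ge0// ltW.
  have := homothety H (Z j i') (Z j i'.+1) Dc (tj1 i.+1).
  by rewrite (Zjc.1 i' (ltn_ord i')) hu -tjj; lra.
rewrite hu tE metric_sym; set E := energy _ _ => Ele dle.
apply: le_of_sqr; first by rewrite mulr_ge0// ltW.
apply: (le_trans dle); have := uu i.+1; rewrite addnS => /(ler_wpM2l (sqr_ge0 (th * t))).
have := ler_wpM2l (ltW M0) Ele; lra.
Qed.

(** In a ball, a point at distance at most [s h + e] and [(1 - s) h + e] from
    the ends of a segment of length [h'] is close to the corresponding point of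
    the segment, as [h'] is close to [h]. *)
Lemma contraction_asymptotic : asymptotic_geodesics seg c x y th
  (fun j => interpolate seg N (Z j)).
Proof.
have th01 := th0; have lam0' := lam0; have k0' := k0.
have tj j : 0 < th ^+ j by rewrite exprn_gt0//; lra.
have tj1 j : 0 <= th ^+ j <= 1.
  by rewrite (ltW (tj j)) exprn_ile1//; lra.
have r0 : 0 < r by rewrite mulr_gt0.
have [l l0 Hl] := scaled_step_limit.
pose u (j : nat) := h j / th ^+ j.
have hu j : h j = u j * th ^+ j by rewrite /u divfK// gt_eqF.
have u0 j : 0 <= u j.
  by rewrite divr_ge0 ?(ltW (tj j))//; have /andP[] := h_le j.
have ur j : u j <= r / 4.
  by rewrite ler_pdivrMr// mulrC; have /andP[] := h_le j.
split.
- move=> j; have [[_ Z0 ZN _ _] _ _] := hZ j.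
  by rewrite (interpolate0 H) (interpolate1 H) Z0 ZN.
- move=> e e0.
  pose q := Num.min (Num.min 1 (r / 8)) (e ^+ 2 / (2 * l + r + 2)).
  have q0 : 0 < q by rewrite !lt_min ltr01 !divr_gt0 ?exprn_gt0//; lra.
  have [q1 [q2 q3]] : q <= 1 /\ q <= r / 8 /\ q <= e ^+ 2 / (2 * l + r + 2).
    by rewrite /q !ge_min !lexx !orbT.
  have [J1 HJ1] := Hl _ q0; have [J2 HJ2] := contraction_cauchy q0.
  exists (maxn J1 J2) => j i s; rewrite geq_max => /andP[J1j J2j] s01.
  have := node_lt N s; have := node_offset01 N s01.
  rewrite /interpolate; set n := node N s; set v := node_offset N s => v01 nN.
  have [Cj _ _] := hZ j; have [Ci _ _] := hZ (j + i)%N.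
  have [Zjc _ _ _ _] := Cj; have [Zic _ _ _ _] := Ci.
  set w := seg c _ _; pose t := th ^+ (j + i).
  have tE : th ^+ i * th ^+ j = t by rewrite -exprD addnC.
  have tp : 0 < t := tj _.
  have w1 : d w (Z (j + i)%N n) <= t * (v * u j + q).
    have := metric_triangle w (seg c (Z j n) (th ^+ i)) (Z (j + i)%N n).
    have := HJ2 j i n J2j (ltnW nN); rewrite -/t.
    have := homothety H (seg (Z j n) (Z j n.+1) v) (Z j n) Dc (tj1 i).
    rewrite -/w (metric_sym _ (Z j n)) (segd0 H)// (Zjc.1 n nN) hu.
    have -> : th ^+ i * (v * (u j * th ^+ j)) = t * (v * u j) by rewrite -tE; ring.
    lra.
  have w2 : d w (Z (j + i)%N n.+1) <= t * ((1 - v) * u j + q).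
    have := metric_triangle w (seg c (Z j n.+1) (th ^+ i)) (Z (j + i)%N n.+1).
    have := HJ2 j i n.+1 J2j nN; rewrite -/t.
    have := homothety H (seg (Z j n) (Z j n.+1) v) (Z j n.+1) Dc (tj1 i).
    rewrite -/w (segd1 H)// (Zjc.1 n nN) hu.
    have -> : th ^+ i * ((1 - v) * (u j * th ^+ j)) = t * ((1 - v) * u j).
      by rewrite -tE; ring.
    lra.
  have uj := ur j; have uj0 := u0 j; have ui := ur (j + i)%N; have ui0 := u0 (j + i)%N.
  have vu : v * u j <= u j by rewrite ler_piMl//; lra.
  have vu0 : 0 <= v * u j by rewrite mulr_ge0//; lra.
  have ball := contracted_ball lam_ball Ci (ltnW nN).
  have rE : lam * (k * t) = t * r by rewrite /r; ring.
  rewrite -/t rE in ball.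
  have b1 : d (Z (j + i)%N n) w <= t * r.
    by rewrite metric_sym (le_trans w1)// ler_wpM2l ?(ltW tp)//; lra.
  have b2 : d (Z (j + i)%N n) (Z (j + i)%N n) <= t * r.
    by rewrite mdistxx mulr_ge0// ltW.
  have b3 : d (Z (j + i)%N n) (Z (j + i)%N n.+1) <= t * r.
    by rewrite (Zic.1 n nN) hu -/t mulrC ler_wpM2l ?(ltW tp)//; lra.
  have := ball _ _ _ v b1 b2 b3 v01; rewrite /cn_ineq (Zic.1 n nN) hu -/t => cn.
  apply: le_of_sqr; first by rewrite mulr_ge0// ltW.
  apply: (le_trans cn).
  have w1s : d w (Z (j + i)%N n) ^+ 2 <= (t * (v * u j + q)) ^+ 2.
    by rewrite lerXn2r// nnegrE ?mdist_ge0// mulr_ge0// ?(ltW tp)//; lra.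
  have w2s : d w (Z (j + i)%N n.+1) ^+ 2 <= (t * ((1 - v) * u j + q)) ^+ 2.
    by rewrite lerXn2r// nnegrE ?mdist_ge0// mulr_ge0// ?(ltW tp)//; lra.
  have v1 : 0 <= 1 - v by lra.
  have := ler_wpM2l v1 w1s; have := ler_wpM2l (proj1 (andP v01)) w2s.
  move=> g1 g2.
  suff : v * (1 - v) * (u j ^+ 2 - u (j + i)%N ^+ 2) + 4 * (v * (1 - v)) * u j * q + q ^+ 2
      <= e ^+ 2.
    move=> /(ler_wpM2l (sqr_ge0 t)); rewrite -/t; lra.
  have /andP[a1 a2] := HJ1 j J1j.
  have /andP[c1 _] := HJ1 (j + i)%N (leq_trans J1j (leq_addr _ _)).
  rewrite -/(u j) in a1 a2; rewrite -/(u (j + i)%N) in c1.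
  have vv : 0 <= v * (1 - v) <= 1 / 4.
    have := sqr_ge0 (v - 1 / 2); rewrite expr2 => sq.
    by move: v01 sq; move: (v) => s' v01 sq; apply/andP; split; nra.
  have qe : q * (2 * l + r + 2) <= e ^+ 2 by rewrite -ler_pdivlMr//; lra.
  have uu : u j ^+ 2 - u (j + i)%N ^+ 2 <= q * (2 * l + 1).
    have s1 : u j ^+ 2 <= (l + q) ^+ 2 by rewrite lerXn2r// nnegrE//; lra.
    have s2 : l ^+ 2 <= u (j + i)%N ^+ 2 by rewrite lerXn2r// nnegrE.
    have s3 : q * q <= q * 1 by rewrite ler_wpM2l// ltW.
    move: s1 s2 s3; lra.
  have k1 : v * (1 - v) * (u j ^+ 2 - u (j + i)%N ^+ 2) <= q * (2 * l + 1).
    have x0 : 0 <= q * (2 * l + 1) by rewrite mulr_ge0//; lra.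
    apply: (@le_trans _ _ (v * (1 - v) * (q * (2 * l + 1)))).
      by rewrite ler_wpM2l//; lra.
    by rewrite ler_piMl//; lra.
  have k2 : 4 * (v * (1 - v)) * u j * q <= r * q.
    rewrite ler_wpM2r ?(ltW q0)//; apply: (@le_trans _ _ (1 * u j)).
      by rewrite ler_wpM2r//; lra.
    lra.
  have k3 : q ^+ 2 <= q by rewrite expr2 ler_piMl// ltW.
  lra.
- exists N.+1, (fun j => N.+1%:R * h j), (N.+1%:R * l); split => // [j|e e0].
    by have [[Zc _ _ _ _] _ _] := hZ j; exact: (interpolate_geodesic H).
  have M0 : 0 < N.+1%:R :> R by [].
  have eM : 0 < e / N.+1%:R by rewrite divr_gt0.
  have [J HJ] := Hl _ eM; exists J => j Jj.
  rewrite -mulrA -mulrBr normrM (gtr0_norm M0) mulrC -ler_pdivlMr//.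
  by have := HJ j Jj; move: (e / _) (h j / _) => X Y'; rewrite ler_norml; lra.
Qed.

End contraction_limit.

(** * Uniqueness of local geodesics *)

Section uniqueness.
Context {R : realType} {Y : metricType R} (D : set Y) (seg : Y -> Y -> R -> Y).
Hypothesis H : relative_cat0 D seg.
Local Notation d := mdist.
Local Notation cat0_ball := (cat0_ball seg).
Local Notation far_from_core := (far_from_core D).
Implicit Types (p a b m c x y z P : Y) (F : R -> Y).

Lemma uniform_eventually (M : nat) (P : nat -> nat -> Prop) :
  (forall n, (n <= M)%N -> exists J : nat, forall j, (J <= j)%N -> P n j) ->
  exists J : nat, forall n j, (n <= M)%N -> (J <= j)%N -> P n j.
Proof.
elim: M => [|M IH] HP.
  by have [J HJ] := HP 0%N (leqnn _); exists J => n j; rewrite leqn0 => /eqP ->; exact: HJ.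
have [J1 HJ1] := IH (fun n nM => HP n (leqW nM)).
have [J2 HJ2] := HP M.+1 (leqnn _).
exists (maxn J1 J2) => n j; rewrite geq_max leq_eqVlt => nM /andP[j1 j2].
by case/orP: nM => [/eqP ->|nM]; [exact: HJ2|exact: HJ1].
Qed.

Section with_constant.
Context (lam : R).
Hypothesis lam0 : 0 < lam.
Hypothesis lam_ball : forall z k, (forall c, D c -> k <= d z c) ->
  cat0_ball z (lam * k).

(** At a large stage [j] the chains are close compared with their scale, hence equal.
    The steps taken from stage [j] to stage [j.+1] are small, so that equality at
    one stage makes the chains of the previous stage close, hence equal again:
    this descends to [j = 0]. *)
Lemma contraction_sequences_agree (k A L L' th : R) (N : nat) c x y
    (h h' : nat -> R) (Z Z' : nat -> nat -> Y) :
  0 < k -> 0 <= L -> 0 <= L' -> 1 / 2 <= th < 1 -> D c -> 0 <= A ->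
  (1 - th) * A <= lam * k / 16 ->
  L / N.+1%:R <= lam * k / 4 -> L' / N.+1%:R <= lam * k / 4 ->
  contraction_sequence D seg k A L th N c x y h Z ->
  contraction_sequence D seg k A L' th N c x y h' Z' ->
  asymptotic_geodesics seg c x y th (fun j => interpolate seg N (Z j)) ->
  asymptotic_geodesics seg c x y th (fun j => interpolate seg N (Z' j)) ->
  h 0%N = h' 0%N.
Proof.
move=> k0 L0 L'0 th01 Dc A0 thA LN L'N hZ hZ' as1 as2; have lam0' := lam0.
have th1 : 0 < th < 1 by lra.
have uniq := asymptotic_unique H Dc th1 as1 as2.
pose r := lam * k; have r0 : 0 < r by rewrite mulr_gt0.
have r4 : 0 < r / 4 by lra.
have M0 : 0 < N.+1%:R :> R by [].
have agree j e : (forall i, (i <= N.+1)%N -> d (Z j i) (Z' j i) <= e) ->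
    e <= r / 4 * th ^+ j -> forall i, (i <= N.+1)%N -> Z j i = Z' j i.
  have tj : 0 < th ^+ j by rewrite exprn_gt0//; lra.
  move=> ZZ ee; have [Cj _ _] := hZ j; have [Cj' _ _] := hZ' j.
  have [Zc Z0 ZN _ hj] := Cj; have [Zc' Z0' ZN' _ hj'] := Cj'.
  have hr : h j <= th ^+ j * (r / 4).
    by apply: le_trans hj _; rewrite ler_wpM2l ?(ltW tj).
  have hr' : h' j <= th ^+ j * (r / 4).
    by apply: le_trans hj' _; rewrite ler_wpM2l ?(ltW tj).
  have rt : 0 < r * th ^+ j by rewrite mulr_gt0.
  have E : lam * (k * th ^+ j) = r * th ^+ j by rewrite mulrA.
  have he : h j + e <= r * th ^+ j by lra.
  have he' : h' j + e <= r * th ^+ j by lra.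
  move=> i iN; apply: (chain_unique (seg := seg) Zc Zc' he he') => //.
  - by move=> n nN; rewrite -E; exact: (contracted_ball lam_ball Cj nN).
  - by move=> n nN; rewrite -E; exact: (contracted_ball lam_ball Cj' nN).
  - by rewrite Z0 Z0'.
  - by rewrite ZN ZN'.
have [J HJ] : exists J : nat, forall n j, (n <= N.+1)%N -> (J <= j)%N ->
    d (Z j n) (Z' j n) <= r / 4 * th ^+ j.
  apply: uniform_eventually => n nN.
  have n01 : 0 <= (n%:R / N.+1%:R : R) <= 1.
    by rewrite divr_ge0//= ler_pdivrMr// mul1r ler_nat.
  have [J HJ] := uniq _ n01 _ r4; exists J => j /HJ.
  by rewrite !(interpolate_node H).
have eqJ i : (i <= N.+1)%N -> Z J i = Z' J i.
  by apply: agree (lexx _) i => i iN; exact: HJ.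
have down (m i : nat) : (m <= J)%N -> (i <= N.+1)%N -> Z (J - m)%N i = Z' (J - m)%N i.
  elim: m i => [|m IH] i mJ iN; first by rewrite subn0; exact: eqJ.
  have {}IH i' := IH i' (ltnW mJ).
  move: IH; rewrite -(subnSK mJ); set j := (J - m.+1)%N => IH.
  apply: (agree j (2 * ((1 - th) * A * th ^+ j))) => // [i' i'N|].
    have [_ _ /(_ i' i'N) s1] := hZ j; have [_ _ /(_ i' i'N) s2] := hZ' j.
    have := metric_triangle (Z j i') (Z j.+1 i') (Z' j i').
    by rewrite -(IH i' i'N) in s2; rewrite (metric_sym (Z j.+1 i')); lra.
  have tj : 0 < th ^+ j by rewrite exprn_gt0//; lra.
  have rt : 0 < r * th ^+ j by rewrite mulr_gt0.
  have := ler_wpM2r (ltW tj) thA; rewrite -/r; lra.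
have e0 i : (i <= N.+1)%N -> Z 0%N i = Z' 0%N i.
  by move=> iN; have := down J i (leqnn _) iN; rewrite subnn.
have [[Zc _ _ _ _] _ _] := hZ 0%N; have [[Zc' _ _ _ _] _ _] := hZ' 0%N.
by rewrite -(Zc.1 0%N isT) -(Zc'.1 0%N isT) !e0.
Qed.

(** Both curves are contracted towards the same core point [c], an almost
    minimal detour between their ends. The gap between the length of a curve
    and that of every detour is inherited, in proportion, at each stage of the
    contraction, so neither curve ever comes relatively close to the core. *)
Lemma curve_length_unique (N1 N2 : nat) (L1 L2 k0 : R) F1 F2 :
  (0 < N1)%N -> (0 < N2)%N -> 0 < k0 ->
  local_geodesic_at N1 L1 F1 -> local_geodesic_at N2 L2 F2 ->
  far_from_core k0 F1 -> far_from_core k0 F2 ->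
  F1 0 = F2 0 -> F1 1 = F2 1 -> L1 = L2.
Proof.
move=> N1_0 N2_0 k00 F1L F2L F1k F2k F120 F121; have lam0' := lam0.
have L1_0 := curve_speed_ge0 N1_0 F1L; have L2_0 := curve_speed_ge0 N2_0 F2L.
have [g1 g10 Hg1] := curve_gap H lam0 lam_ball N1_0 F1L k00 F1k.
have [g2 g20 Hg2] := curve_gap H lam0 lam_ball N2_0 F2L k00 F2k.
set x := F1 0 in F120 Hg1; set y := F1 1 in F121 Hg1.
rewrite -F120 -F121 in Hg2.
pose g := Num.min g1 g2.
have [g_0 [gg1 gg2]] : 0 < g /\ g <= g1 /\ g <= g2.
  by rewrite /g lt_min g10 g20 !ge_min !lexx orbT.
have [B B0 HB] := almost_minimal_detour H x y.
pose A := B + L1 + L2; have A0 : 0 <= A by rewrite /A; lra.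
pose K := (2 * B + A + 1) * (A + 1); have K0 : 0 < K by rewrite mulr_gt0; lra.
(* the defect of minimality at [c] costs a quarter of the gap [g] at most *)
pose e := Num.min 1 (g / (4 * K)).
have e01 : 0 < e <= 1.
  by rewrite lt_min ltr01 ge_min lexx divr_gt0// mulr_gt0.
have eK : e * K <= g / 4.
  have : e <= g / (4 * K) by rewrite ge_min lexx orbT.
  rewrite ler_pdivlMr ?mulr_gt0//; lra.
have [c [Dc cB cmin]] := HB e e01.
(* [k] is the distance from the core, per unit of scale, that all stages keep *)
have [k [k_0 kk0 k1 kg]] : exists k, [/\ 0 < k, k <= k0, k <= 1 & k <= g / 16].
  exists (Num.min (Num.min k0 1) (g / 16)).
  by rewrite !lt_min k00 ltr01 divr_gt0//= !ge_min !lexx !orbT.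
(* one contraction moves points, all within [A] of [c], by little compared with
   the radius [lam * k] of the balls of comparison *)
pose q := Num.min (1 / 2) (Num.min (lam * k / 16) (k / 2) / (A + 1)).
have lk : 0 < lam * k by rewrite mulr_gt0.
have m0 : 0 < Num.min (lam * k / 16) (k / 2) by rewrite lt_min; lra.
have A1 : 0 < A + 1 by lra.
have q0 : 0 < q <= 1 / 2.
  apply/andP; split; last by rewrite ge_min lexx.
  by rewrite lt_min; apply/andP; split; [lra|exact: divr_gt0].
have qA : q * A <= Num.min (lam * k / 16) (k / 2).
  have : q <= Num.min (lam * k / 16) (k / 2) / (A + 1) by rewrite ge_min lexx orbT.
  by rewrite ler_pdivlMr//; lra.
pose th := 1 - q; have th01 : 1 / 2 <= th < 1 by rewrite /th; lra.
have thA : (1 - th) * A <= lam * k / 16 /\ (1 - th) * A <= k / 2.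
  have -> : 1 - th = q by rewrite /th; lra.
  by move: qA; rewrite le_min => /andP[].
have [N [NN1 NN2 NL1 NL2]] : exists N : nat, [/\ (N1.*2 <= N.+1)%N,
    (N2.*2 <= N.+1)%N, L1 / N.+1%:R <= lam * k / 4 & L2 / N.+1%:R <= lam * k / 4].
  pose T := Num.truncn ((L1 + L2) / (lam * k / 4)).
  exists (maxn T (maxn N1.*2 N2.*2)); set M := maxn _ _.
  have TM : (L1 + L2) / (lam * k / 4) < M.+1%:R.
    by apply: lt_le_trans (truncnS_gt _) _; rewrite ler_nat ltnS leq_maxl.
  rewrite ltr_pdivrMr in TM; last lra.
  split; [by rewrite leqW// !leq_max leqnn !orbT|by rewrite leqW// !leq_max leqnn !orbT| |];
    rewrite ler_pdivrMr//; lra.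
have detour L : L + g <= d x c + d y c -> forall P (t : R), D P -> 0 < t <= 1 ->
    d c P <= (A + k) * t -> t * (L + 2 * k) < d (seg c x t) P + d (seg c y t) P.
  move=> Lg P t DP t01 cP; have t01' : 0 <= t <= 1 by lra.
  have := cmin P DP.
  have := metric_triangle x (seg c x t) P; have := metric_triangle y (seg c y t) P.
  rewrite !(metric_sym _ (seg c _ t)) !(segd1 H)// !(metric_sym c).
  rewrite (metric_sym P c) => h1 h2 h3.
  have cP0 := mdist_ge0 c P.
  have h4 : (2 * B + d c P) * d c P <= K * t.
    have : d c P <= A + 1.
      apply: (le_trans cP); apply: (@le_trans _ _ ((A + k) * 1)); last lra.
      by rewrite ler_wpM2l//; lra.
    move=> cA; rewrite /K -mulrA; apply: ler_pM => //; try lra.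
    by apply: (le_trans cP); rewrite ler_wpM2r//; lra.
  have h5 : e * ((2 * B + d c P) * d c P) <= g / 4 * t.
    apply: (@le_trans _ _ (e * (K * t))); first by rewrite ler_wpM2l//; lra.
    by rewrite mulrA ler_wpM2r//; lra.
  have h6 : t * (L + g) <= t * (d x c + d y c) by rewrite ler_wpM2l//; lra.
  have h7 : t * k <= t * (g / 16) by rewrite ler_wpM2l//; lra.
  have h8 : 0 < t * g by rewrite mulr_gt0//; lra.
  lra.
have dt1 := detour L1 (le_trans (lerD (lexx _) gg1) (Hg1 c Dc)).
have dt2 := detour L2 (le_trans (lerD (lexx _) gg2) (Hg2 c Dc)).
have AB1 : d c x + d c y + L1 <= A by rewrite /A !(metric_sym c); lra.
have AB2 : d c x + d c y + L2 <= A by rewrite /A !(metric_sym c); lra.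
have init (L : R) M F : (0 < M)%N -> (M.*2 <= N.+1)%N -> local_geodesic_at M L F ->
    far_from_core k0 F -> F 0 = x -> F 1 = y ->
    contracted D seg k L th N c x y 0 (L / N.+1%:R) (fun i => F (i%:R / N.+1%:R)).
  move=> M0 MN FL Fk Fx Fy; split.
  - exact: (chain_of_curve M0 MN FL).
  - by rewrite expr0 (seg1 H) mul0r.
  - by rewrite expr0 (seg1 H) divff.
  - move=> i P iN DP; rewrite expr0 mulr1; apply: (le_trans kk0); apply: Fk => //.
    by rewrite divr_ge0//= ler_pdivrMr// mul1r ler_nat.
  - by rewrite expr0 mul1r.
have i1 := init L1 N1 F1 N1_0 NN1 F1L F1k erefl erefl.
have i2 := init L2 N2 F2 N2_0 NN2 F2L F2k (esym F120) (esym F121).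
have [h [Z [hZ h0 _]]] :=
  contraction_sequence_exists H lam0 k_0 L1_0 th01 lam_ball Dc AB1 thA NL1 dt1 i1.
have [h' [Z' [hZ' h'0 _]]] :=
  contraction_sequence_exists H lam0 k_0 L2_0 th01 lam_ball Dc AB2 thA NL2 dt2 i2.
have as1 := contraction_asymptotic H lam0 k_0 L1_0 th01 lam_ball Dc AB1 thA NL1 hZ.
have as2 := contraction_asymptotic H lam0 k_0 L2_0 th01 lam_ball Dc AB2 thA NL2 hZ'.
have := contraction_sequences_agree k_0 L1_0 L2_0 th01 Dc A0 thA.1 NL1 NL2 hZ hZ' as1 as2.
rewrite h0 h'0 => /(congr1 (fun w => w * N.+1%:R)).
by rewrite !divfK.
Qed.

(** The distance from the core is continuous along the segment and attains its
    minimum, which is positive because the core is closed. *)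
Lemma segment_far x y : (forall s, 0 <= s <= 1 -> ~ D (seg x y s)) ->
  exists2 k, 0 < k & far_from_core k (seg x y).
Proof.
move=> nD; have [c1 Dc1] := core_nonempty H.
pose V z := [set d z c | c in D]; pose f s := inf (V (seg x y s)).
have V0 z : has_inf (V z).
  by split; [exists (d z c1); exists c1|exists 0 => _ [c _ <-]; exact: mdist_ge0].
have fle s c : D c -> f s <= d (seg x y s) c.
  by move=> Dc; apply: (ge_inf (V0 _).2); exists c.
have flip s t : 0 <= s <= 1 -> 0 <= t <= 1 -> f s <= f t + d x y * `|s - t|.
  move=> s01 t01; rewrite -lerBlDr; apply: lb_le_inf; first exact: (V0 _).1.
  move=> _ [c Dc <-]; rewrite lerBlDr; apply: le_trans (fle s c Dc) _.
  have := metric_triangle (seg x y s) (seg x y t) c; rewrite (segd H)//; lra.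
have fc : {within `[0, 1], continuous f}.
  apply: (@lipschitz01_continuous _ _ (d x y)) => s t s01 t01.
  have := flip s t s01 t01; have := flip t s t01 s01.
  by rewrite (distrC t s) ler_norml; lra.
have [s0 s01 fmin] := EVT_min ler01 fc.
rewrite in_itv/= in s01.
exists (f s0); last first.
  move=> s c s01' Dc; apply: le_trans (fle s c Dc); apply: fmin.
  by rewrite in_itv.
rewrite ltNge; apply/negP => f0; apply: (nD s0 s01).
apply: (core_closed H) => e e0.
have [_ [c Dc <-] ce] := inf_adherent e0 (V0 (seg x y s0)).
by exists c => //; apply: lt_le_trans ce _; rewrite -/(f s0); lra.
Qed.

Lemma segment_curve x y : local_geodesic_at 1 (d x y) (seg x y).
Proof. by move=> s t s01 t01 _; rewrite (segd H)// mulrC. Qed.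

(** If the segment between the ends of [F] meets the core, then [F] would be
    strictly shorter than this segment; otherwise the segment is a second local
    geodesic that avoids the core. *)
Lemma curve_length (N : nat) (L k : R) F : (0 < N)%N -> 0 < k ->
  local_geodesic_at N L F -> far_from_core k F -> L = d (F 0) (F 1).
Proof.
move=> N0 k0 FL Fk.
have z01 : 0 <= (0 : R) <= 1 by rewrite lexx ler01.
have o01 : 0 <= (1 : R) <= 1 by rewrite lexx ler01.
have [hit|miss] := pselect (exists2 s, 0 <= s <= 1 & D (seg (F 0) (F 1) s)).
  have [s s01 Ds] := hit; have [g g0 Hg] := curve_gap H lam0 lam_ball N0 FL k0 Fk.
  have := Hg _ Ds; rewrite (segd0 H)// (metric_sym (F 1)) (segd1 H)//.
  have := curve_lipschitz N0 FL z01 o01; rewrite sub0r normrN normr1; lra.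
have [|k' k'0 Fk'] := @segment_far (F 0) (F 1).
  by move=> s s01 Ds; apply: miss; exists s.
have m0 : 0 < Num.min k k' by rewrite lt_min k0.
apply: (curve_length_unique N0 (ltn0Sn 0) m0 FL (segment_curve (F 0) (F 1))).
- by move=> s c s01 Dc; rewrite ge_min Fk.
- by move=> s c s01 Dc; rewrite ge_min Fk' ?orbT.
- by rewrite (seg0 H).
- by rewrite (seg1 H).
Qed.

End with_constant.
End uniqueness.

(** * Comparison for all triangles *)

Section comparison_everywhere.
Context {R : realType} {Y : metricType R} (D : set Y) (seg : Y -> Y -> R -> Y).
Hypothesis H : relative_cat0 D seg.
Local Notation d := mdist.
Local Notation cat0_ball := (cat0_ball seg).
Local Notation far_from_core := (far_from_core D).
Implicit Types (p a b c q v : Y).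

Lemma le_of_scaled (s A B C : R) : 0 < s ->
  (forall t, 0 < t <= s -> t * (A - (1 - t) * B) <= t * C) -> A - B <= C.
Proof.
move=> s0 ABC; apply/ler_addgt0Pr => e e0.
pose t := Num.min s (e / (`|B| + 1)).
have B0 : 0 < `|B| + 1 by rewrite ltr_wpDl.
have t0 : 0 < t by rewrite lt_min s0 divr_gt0.
have t1 : t <= s by rewrite ge_min lexx.
have tB : t * (`|B| + 1) <= e.
  by rewrite -ler_pdivlMr// ge_min lexx orbT.
have t01 : 0 < t <= s by rewrite t0.
have := ABC t t01; rewrite ler_pM2l// => h.
have : - (t * B) <= t * `|B|.
  by rewrite -mulrN ler_wpM2l ?(ltW t0)// -normrN ler_norm.
lra.
Qed.

(** Comparison for a segment [q p] with a point [c] of the core in its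
    interior: near [c] on the segment from [c] to [v], the sum of the distances
    to [q] and [p] is at least [d q p], and the comparison holds in the two
    triangles with vertex [c]. *)
Lemma cn_core_point q p v s : 0 < s < 1 -> D (seg q p s) ->
  cn_ineq v q p (seg q p s) s.
Proof.
move=> s01 Dc; have s01' : 0 <= s <= 1 by lra.
set c := seg q p s in Dc *; pose L := d q p.
have qc : d q c = s * L by rewrite (segd0 H).
have cp : d c p = (1 - s) * L by rewrite (segd1 H).
have s1 : 0 < 1 - s by lra.
have s0 : 0 < s by lra.
have ss : 0 < s * (1 - s) by rewrite mulr_gt0.
suff : s * (1 - s) * L ^+ 2 - - d v c ^+ 2 <=
    (1 - s) * d v q ^+ 2 + s * d v p ^+ 2.
  by rewrite /cn_ineq -/L; lra.
apply: (le_of_scaled ltr01) => t t01; have t01' : 0 <= t <= 1 by lra.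
have h1 := cn_side H q v Dc t01'; have h2 := cn_side H p v Dc t01'.
move: h1 h2; rewrite /cn_ineq qc (metric_sym p c) cp (metric_sym c v).
rewrite (metric_sym q v) (metric_sym p v).
set w := seg c v t => h1 h2.
have tri := metric_triangle q w p; rewrite (metric_sym w p) -/L in tri.
have L0 : 0 <= L := mdist_ge0 _ _.
have x0 := mdist_ge0 q w; have y0 := mdist_ge0 p w.
move: tri x0 y0 h1 h2; move: (d q w) (d p w) => X Z tri X0 Z0 h1 h2.
have conv : s * (1 - s) * L ^+ 2 <= (1 - s) * X ^+ 2 + s * Z ^+ 2.
  have : 0 <= ((1 - s) * X - s * Z) ^+ 2 by exact: sqr_ge0.
  have : L ^+ 2 <= (X + Z) ^+ 2 by rewrite lerXn2r// nnegrE addr_ge0.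
  move=> /(ler_wpM2l (ltW ss)); lra.
have := ler_wpM2l (ltW s1) h1; have := ler_wpM2l (ltW s0) h2.
lra.
Qed.

(** Points of [q p] before the core point [seg q p s] lie on the segment from that
    point to [q], to which the comparison with a vertex in the core applies. *)
Lemma cn_through_core q p v s t : 0 < s <= 1 -> D (seg q p s) -> 0 <= t <= s ->
  cn_ineq v q p (seg q p t) t.
Proof.
move=> s01 Dc ts; have s01' : 0 <= s <= 1 by lra.
have t01 : 0 <= t <= 1 by lra.
have cnc : cn_ineq v q p (seg q p s) s.
  have [->|sn1] := eqVneq s 1; first by rewrite (seg1 H) /cn_ineq; lra.
  apply: cn_core_point => //; rewrite (andP s01).1/=.
  by rewrite lt_neqAle sn1 (andP s01).2.
set c := seg q p s in Dc cnc *.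
pose u := 1 - t / s.
have s0 : 0 < s by lra.
have tsu : t = (1 - u) * s by rewrite /u; field; lra.
have u01 : 0 <= u <= 1.
  have := divr_ge0 (proj1 (andP ts)) (ltW s0).
  have : t / s <= 1 by rewrite ler_pdivrMr//; lra.
  by rewrite /u; lra.
have cq : d c q = s * d q p by rewrite metric_sym (segd0 H).
have E : seg q p t = seg c q u.
  apply: (seg_uniqueD H) => //.
    rewrite cq (segd H)// ger0_norm; last lra.
    by rewrite tsu; ring.
  by rewrite metric_sym (segd0 H)// cq tsu; ring.
have := cn_side H v q Dc u01; move: cnc; rewrite -E /cn_ineq cq.
move=> h1 h2; apply: (le_trans h2).
have u1 : 0 <= 1 - u by lra.
have := ler_wpM2l u1 h1; rewrite tsu; lra.
Qed.

Lemma curve_of_segment p q k (N : nat) : 0 < k -> far_from_core k (seg q p) ->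
  (0 < N)%N -> chain N.+1 (d q p / N.+1%:R) (fun i => seg q p (i%:R / N.+1%:R)).
Proof.
move=> k0 Fk N0; apply: (chain_of_curve (N := 1)) => //.
exact: (segment_curve H).
Qed.

(** When [q p] avoids the core, its chain can be moved to a chain from a nearby
    point [q'] to [p]; by [curve_length] the length of the latter is the
    distance from [q'] to [p], and the energy estimate becomes the comparison
    inequality at the first node of the former. *)
Lemma cn_near_start q p : (forall s, 0 <= s <= 1 -> ~ D (seg q p s)) ->
  exists e r w t, [/\ 0 < e <= r, cat0_ball q r, 0 < t <= 1,
    d q w = t * d q p /\ d q w <= r &
    forall q', d q q' <= e -> d w q' ^+ 2 <=
      (1 - t) * d q q' ^+ 2 + t * d q' p ^+ 2 - t * (1 - t) * d q p ^+ 2].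
Proof.
move=> nD; have [k k0 Fk] := segment_far H nD.
have [lam lam0 lam_ball'] := cn_ball H.
have lam_ball z k1 : (forall c, D c -> k1 <= d z c) -> cat0_ball z (lam * k1).
  by move=> zk; apply: lam_ball' => c Dc; rewrite ler_wpM2l ?(ltW lam0)// zk.
pose L := d q p; have L0 : 0 <= L := mdist_ge0 _ _.
pose r := lam * k; have r0 : 0 < r by rewrite mulr_gt0.
pose m := Num.min (r / 4) (k / 16); have m0 : 0 < m by rewrite lt_min; lra.
have [mr mk] : m <= r / 4 /\ m <= k / 16 by rewrite /m !ge_min !lexx orbT.
have [N N0 LN] : exists2 N : nat, (0 < N)%N & L / N.+1%:R <= m.
  exists (Num.truncn (L / m)).+1 => //.
  rewrite ler_pdivrMr// mulrC -ler_pdivrMr//; apply: ltW.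
  by apply: lt_le_trans (truncnS_gt _) _; rewrite ler_nat.
have M0 : 0 < N.+1%:R :> R by [].
pose h := L / N.+1%:R; pose Z i := seg q p (i%:R / N.+1%:R).
have Zc : chain N.+1 h Z := curve_of_segment k0 Fk N0.
have Z0 : Z 0%N = q by rewrite /Z mul0r (seg0 H).
have ZN : Z N.+1 = p by rewrite /Z divff// (seg1 H).
have i01 i : (i <= N.+1)%N -> 0 <= (i%:R / N.+1%:R : R) <= 1.
  by move=> iN; rewrite divr_ge0//= ler_pdivrMr// mul1r ler_nat.
have Zr i : (i <= N.+1)%N -> cat0_ball (Z i) r.
  by move=> iN; apply: lam_ball => c Dc; apply: Fk => //; exact: i01.
have hm : h + m <= r by move: LN; rewrite -/h; move: (h) => h1; lra.
have tN : 0 < (N.+1%:R : R)^-1 <= 1 by rewrite invr_gt0 M0 invf_le1// ler1n.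
exists m, r, (Z 1%N), (N.+1%:R^-1); split => //.
- by rewrite m0; lra.
- by rewrite -Z0; exact: Zr.
- rewrite -{1 3}Z0 (Zc.1 0%N)// /h -/L; split; first by rewrite mulrC.
  by apply: (le_trans LN); lra.
move=> q' qq'.
have ZW0 : d (Z 0%N) q' <= m by rewrite Z0.
have ZWN : d (Z N.+1) p <= m by rewrite ZN mdistxx ltW.
have [h' [W [Wc W0 WN ZW]]] := chain_move_ends H Zc hm Zr ZW0 ZWN.
have h'0 := chain_step_ge0 (ltn0Sn N) Wc.
have h'm : h' <= 3 * m.
  rewrite -(Wc.1 0%N)//; have := metric_triangle (W 0%N) (Z 0%N) (W 1%N).
  have := metric_triangle (Z 0%N) (Z 1%N) (W 1%N); rewrite (Zc.1 0%N)//.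
  rewrite (metric_sym (W 0%N) (Z 0%N)); have := ZW 0%N isT; have := ZW 1%N isT.
  by move: LN; rewrite -/h; move: (h) => h1; lra.
have Wk : far_from_core (k / 2) (interpolate seg N W).
  move=> s c s01 Dc; rewrite /interpolate; have nN := node_lt N s.
  have v01 := node_offset01 N s01; set n := node N s in nN *.
  have := metric_triangle (W n) (seg (W n) (W n.+1) (node_offset N s)) c.
  have := metric_triangle (Z n) (W n) c; have := ZW n (ltnW nN).
  have := Fk _ c (i01 n (ltnW nN)) Dc; rewrite -/(Z n).
  rewrite (segd0 H)// Wc.1//.
  have : node_offset N s * h' <= h' by rewrite ler_piMl//; lra.
  lra.
have k2 : 0 < k / 2 by lra.
have len : N.+1%:R * h' = d q' p.
  rewrite (curve_length H lam0 lam_ball (ltn0Sn N) k2 (interpolate_geodesic H Wc) Wk).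
  by rewrite (interpolate0 H) (interpolate1 H) W0 WN.
have := energy_shortened Zc hm Zr ZW (etrans WN (esym ZN)).
rewrite W0 Z0 (chain_energy Wc).
have -> : N.+1%:R * h' ^+ 2 = N.+1%:R^-1 * d q' p ^+ 2 by rewrite -len; field.
have NE : N%:R = N.+1%:R - 1 :> R by rewrite -natr1 addrK.
have -> : N%:R * h ^+ 2 = N.+1%:R^-1 * (1 - N.+1%:R^-1) * L ^+ 2.
  by rewrite NE /h; field.
by move: (N.+1%:R^-1) => t; rewrite -/L; lra.
Qed.

(** By [local_midpoint_convex] it suffices to bound the squared distance from [p] at a
    point [q] of the side by its values at two nearby points of the side. The
    segment from [q] to [p] is handled near [q], where the first variation of the
    distance decides: if it meets the core, through [cn_through_core], otherwise
    through [cn_near_start]. *)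
Lemma cn_everywhere p a b t : 0 <= t <= 1 -> cn_ineq p a b (seg a b t) t.
Proof.
move=> t01.
pose L := d a b; have L0 : 0 <= L := mdist_ge0 _ _.
pose A := d p a; have A0 : 0 <= A := mdist_ge0 _ _.
pose f s := d p (seg a b s) ^+ 2 - s ^+ 2 * L ^+ 2.
suff : f t <= (1 - t) * f 0 + t * f 1.
  by rewrite /f /cn_ineq (seg0 H) (seg1 H) -/L; nra.
apply: (@local_midpoint_convex _ _ (2 * (A + L) * L + 2 * L ^+ 2)) => //.
  move=> s u s01 u01.
  have su : `|d p (seg a b s) - d p (seg a b u)| <= `|s - u| * L.
    rewrite -(segd H)// ler_norml.
    have := metric_triangle p (seg a b u) (seg a b s).
    have := metric_triangle p (seg a b s) (seg a b u).
    by rewrite (metric_sym (seg a b u)); lra.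
  have bnd r : 0 <= r <= 1 -> 0 <= d p (seg a b r) <= A + L.
    move=> r01; rewrite mdist_ge0/=.
    have := metric_triangle p a (seg a b r); rewrite (segd0 H)// -/A -/L; nra.
  have := bnd _ s01; have := bnd _ u01; rewrite /f; move: su.
  set x := d p _; set y := d p _ => su y01 x01.
  have -> : x ^+ 2 - s ^+ 2 * L ^+ 2 - (y ^+ 2 - u ^+ 2 * L ^+ 2) =
    (x - y) * (x + y) - (s - u) * ((s + u) * L ^+ 2) by ring.
  have h1 : `|(x - y) * (x + y)| <= 2 * (A + L) * L * `|s - u|.
    rewrite normrM (ger0_norm (x := x + y)); last lra.
    have -> : 2 * (A + L) * L * `|s - u| = `|s - u| * L * (2 * (A + L)) by ring.
    by rewrite ler_pM//; lra.
  have h2 : `|(s - u) * ((s + u) * L ^+ 2)| <= 2 * L ^+ 2 * `|s - u|.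
    rewrite normrM mulrC (ger0_norm (x := _ * L ^+ 2)); last nra.
    by rewrite ler_wpM2r// ler_wpM2r ?sqr_ge0//; lra.
  apply: le_trans (ler_normB _ _) _; lra.
move=> {t01} {}t t01; pose q := seg a b t.
have t01' : 0 <= t <= 1 by lra.
suff [e e0 He] : exists2 e, 0 < e & forall n, 0 < n < e -> n < t -> n < 1 - t ->
    d p q ^+ 2 <= (d p (seg a b (t - n)) ^+ 2 + d p (seg a b (t + n)) ^+ 2) / 2 -
      n ^+ 2 * L ^+ 2.
  exists (Num.min e (Num.min t (1 - t))).
    by rewrite !lt_min e0/=; apply/andP; split; lra.
  move=> n; rewrite !lt_min => /andP[n0 /andP[ne /andP[nt n1t]]].
  have n0e : 0 < n < e by rewrite n0.
  by have := He n n0e nt n1t; rewrite /f -/q; lra.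
have dq n : 0 < n -> n < t -> n < 1 - t ->
    [/\ d q (seg a b (t - n)) = n * L, d q (seg a b (t + n)) = n * L &
        d (seg a b (t - n)) (seg a b (t + n)) = 2 * n * L].
  move=> n0 nt n1t; rewrite /q !(segd H); try by lra.
  split; first by rewrite ger0_norm; [congr (_ * _); ring|lra].
    by rewrite distrC ger0_norm; [congr (_ * _); ring|lra].
  by rewrite distrC ger0_norm; [congr (_ * _); ring|lra].
have [[s s01 Ds]|miss] := pselect (exists2 s, 0 <= s <= 1 & D (seg q p s)).
- exists 1; first exact: ltr01.
  move=> n /andP[n0 _] nt n1t; have [d1 d2 d3] := dq n n0 nt n1t.
  have variation s' : 0 < s' <= 1 -> (forall v u, 0 <= u <= s' ->
      cn_ineq v q p (seg q p u) u) ->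
      d p q ^+ 2 <= (d p (seg a b (t - n)) ^+ 2 + d p (seg a b (t + n)) ^+ 2) / 2
      - n ^+ 2 * L ^+ 2.
    move=> s'01 cn.
    suff : n ^+ 2 * L ^+ 2 - - d p q ^+ 2 <=
        (d p (seg a b (t - n)) ^+ 2 + d p (seg a b (t + n)) ^+ 2) / 2 by lra.
    have s'0 : 0 < s' by lra.
    apply: (le_of_scaled s'0) => u us'.
    have us'' : 0 <= u <= s' by lra.
    have := cn (seg a b (t - n)) u us''; have := cn (seg a b (t + n)) u us''.
    rewrite /cn_ineq !(metric_sym _ q) d1 d2 !(metric_sym p).
    set w := seg q p u.
    have := metric_triangle (seg a b (t - n)) w (seg a b (t + n)).
    rewrite d3 (metric_sym w).
    have nL : 0 <= n * L by rewrite mulr_ge0// ltW.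
    have X0 := mdist_ge0 (seg a b (t - n)) w.
    have Z0 := mdist_ge0 (seg a b (t + n)) w.
    move: X0 Z0; move: (d _ w) (d _ w) => X Z X0 Z0 tri h1 h2.
    have : (2 * n * L) ^+ 2 <= (X + Z) ^+ 2.
      by apply: lerXn2r; rewrite ?nnegrE ?addr_ge0//; lra.
    by have := sqr_ge0 (X - Z); lra.
  have [s0|sn0] := eqVneq s 0.
    rewrite s0 (seg0 H) in Ds; apply: (variation 1); first by rewrite ltr01 lexx.
    by move=> v u u01; exact: (cn_side H).
  have s01' : 0 < s <= 1 by rewrite lt_def sn0.
  apply: (variation s) => // v u us; exact: (cn_through_core _ s01' Ds us).
- have [|e [r [w [tau [er ball tau01 [qw qwr] near]]]]] := @cn_near_start q p.
    by move=> s s01 Ds; apply: miss; exists s.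
  exists (e / (L + 1)); first by rewrite divr_gt0 ?ltr_wpDl//; lra.
  move=> n /andP[n0 ne] nt n1t; have [d1 d2 d3] := dq n n0 nt n1t.
  have nL : n * L <= e.
    have : n * (L + 1) < e by rewrite -ltr_pdivlMr// ltr_wpDl.
    lra.
  have nr : n * L <= r by lra.
  have h1 := near (seg a b (t - n)) ltac:(lra).
  have h2 := near (seg a b (t + n)) ltac:(lra).
  have r0 : d q q <= r by rewrite mdistxx; lra.
  have b1 : d q (seg a b (t - n)) <= r by lra.
  have b2 : d q (seg a b (t + n)) <= r by lra.
  have M : midpoint (seg a b (t - n)) (seg a b (t + n)) q.
    by split; rewrite ?(metric_sym _ q) ?d1 ?d2 d3; lra.
  have := cn_midpoint ball qwr b1 b2 r0 M.
  rewrite d3 (metric_sym w q) qw.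
  rewrite d1 (metric_sym _ p) in h1; rewrite d2 (metric_sym _ p) in h2.
  rewrite (metric_sym p q) => h3.
  have tau0 : 0 < tau by lra.
  rewrite -(ler_pM2l tau0); lra.
Qed.

End comparison_everywhere.

(** * The model sphere *)

Section trigonometry.
Context {R : realType}.
Implicit Types a b x y : R.

Lemma cos_le x y : 0 <= x -> x <= y -> y <= pi -> cos y <= cos x.
Proof.
move=> x0 xy ypi; rewrite leNgt; apply/negP => h.
have : y < x by rewrite -ltr_cos ?in_itv//=; apply/andP; split; lra.
lra.
Qed.

Lemma cos_le_rev x y : 0 <= x -> x <= pi -> 0 <= y -> y <= pi ->
  cos y <= cos x -> x <= y.
Proof.
move=> x0 xpi y0 ypi h; rewrite leNgt; apply/negP => yx.
have : cos x < cos y by rewrite ltr_cos// in_itv/=; apply/andP.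
lra.
Qed.

Lemma cosK0 x : `|x| <= pi -> acos (cos x) = `|x|.
Proof. by move=> xpi; rewrite -cos_norm cosK// in_itv/= normr_ge0. Qed.

(** The cosine rule for two directions in a plane at angles [b] and [b'] from a
    reference direction, written in the frame of two directions at angle [w]. *)
Lemma frame_cos w b b' :
  sin (w - b) * sin (w - b') + sin b * sin b' +
    (sin (w - b) * sin b' + sin b * sin (w - b')) * cos w =
  sin w ^+ 2 * cos (b - b').
Proof.
rewrite !sinB cosB.
have -> : sin w ^+ 2 * (cos b * cos b' + sin b * sin b') =
  sin w ^+ 2 * (cos b * cos b') + sin w ^+ 2 * (sin b * sin b') by ring.
rewrite {2}sin2cos2; ring.
Qed.

End trigonometry.

Section sphere.
Context {R : realType} (chi : R).
Hypothesis chi0 : 0 < chi.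
Local Notation k := (Num.sqrt chi).
Local Notation d := mdist.
Implicit Types (p q r : model_sphere chi) (u v w : 'rV[R]_3).

Lemma sqrt_chi_gt0 : 0 < k. Proof. by rewrite sqrtr_gt0. Qed.

Lemma circumE : k * circum chi = 2 * pi.
Proof. by rewrite /circum mulrC divfK// gt_eqF// sqrt_chi_gt0. Qed.

Lemma dot3_sym u v : dot3 u v = dot3 v u.
Proof. by rewrite /dot3; apply: eq_bigr => i _; rewrite mulrC. Qed.

Lemma dot3_lin a b u v w : dot3 w (a *: u + b *: v) = a * dot3 w u + b * dot3 w v.
Proof.
rewrite /dot3 !mulr_sumr -big_split/=; apply: eq_bigr => i _.
by rewrite !mxE; ring.
Qed.

Lemma dot3_lin2 a b a' b' u v :
  dot3 (a *: u + b *: v) (a' *: u + b' *: v) =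
  a * a' * dot3 u u + b * b' * dot3 v v + (a * b' + b * a') * dot3 u v.
Proof.
rewrite dot3_lin ![dot3 (_ + _) _]dot3_sym !dot3_lin (dot3_sym v u); ring.
Qed.

Lemma dot3_ge0 u : 0 <= dot3 u u.
Proof. by apply: sumr_ge0 => i _; rewrite -expr2 sqr_ge0. Qed.

Lemma sphere_norm p : k ^+ 2 * dot3 (sphere_pt p) (sphere_pt p) = 1.
Proof. by rewrite sphere_ptP exprVn divff// expf_neq0// gt_eqF// sqrt_chi_gt0. Qed.

Lemma sphere_dot_bound p q : -1 <= k ^+ 2 * dot3 (sphere_pt p) (sphere_pt q) <= 1.
Proof.
have := dot3_ge0 (1 *: sphere_pt p + 1 *: sphere_pt q).
have := dot3_ge0 (1 *: sphere_pt p + (-1) *: sphere_pt q).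
rewrite !dot3_lin2; have := sphere_norm p; have := sphere_norm q.
have k2 : 0 < k ^+ 2 by rewrite exprn_gt0// sqrt_chi_gt0.
move=> h1 h2 /(mulr_ge0 (ltW k2)) h3 /(mulr_ge0 (ltW k2)) h4.
by apply/andP; split; lra.
Qed.

Lemma sphere_distE p q : d p q = k^-1 * acos (k ^+ 2 * dot3 (sphere_pt p) (sphere_pt q)).
Proof. by []. Qed.

Lemma sphere_angle p q : k * d p q = acos (k ^+ 2 * dot3 (sphere_pt p) (sphere_pt q)).
Proof. by rewrite sphere_distE mulrA divff ?mul1r// gt_eqF// sqrt_chi_gt0. Qed.

Lemma sphere_cos p q : cos (k * d p q) = k ^+ 2 * dot3 (sphere_pt p) (sphere_pt q).
Proof. by rewrite sphere_angle acosK// in_itv/= sphere_dot_bound. Qed.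

Lemma sphere_angle_itv p q : 0 <= k * d p q <= pi.
Proof.
by rewrite sphere_angle acos_ge0 ?acos_lepi// sphere_dot_bound.
Qed.

Lemma sphere_dist_cos p q a : `|a| <= pi ->
  k ^+ 2 * dot3 (sphere_pt p) (sphere_pt q) = cos a -> k * d p q = `|a|.
Proof. by move=> api; rewrite sphere_angle => ->; rewrite cosK0. Qed.

(** The great circle arc, as the combination of its ends in the plane they span;
    inner products with any vector are then explicit. *)
Lemma sphere_geodesic p q (w : R) : 0 <= w < pi -> k * d p q = w ->
  exists g, [/\ is_geodesic 0 1 g, g 0 = p, g 1 = q &
    forall s v, sin w * dot3 v (sphere_pt (g s)) =
      sin ((1 - s) * w) * dot3 v (sphere_pt p) + sin (s * w) * dot3 v (sphere_pt q)].
Proof.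
move=> w0pi pq; have k0 := sqrt_chi_gt0.
have kn0 : k != 0 by rewrite gt_eqF.
have [w0|wn0] := eqVneq w 0.
  have pqE : p = q.
    by apply: mdist_positivity; apply/eqP; rewrite -(mulrI_eq0 _ (mulfI kn0)) pq w0.
  exists (fun=> p); split=> //; last by move=> s v; rewrite w0 !mulr0 sin0; lra.
  by split=> //; exists 0 => // t u _ _; rewrite mdistxx mul0r.
have sw : 0 < sin w by rewrite sin_gt0_pi// lt_def wn0; lra.
have pqc : k ^+ 2 * dot3 (sphere_pt p) (sphere_pt q) = cos w.
  by rewrite -sphere_cos pq.
pose vec s := (sin ((1 - s) * w) / sin w) *: sphere_pt p +
  (sin (s * w) / sin w) *: sphere_pt q.
have dotv s t : k ^+ 2 * dot3 (vec s) (vec t) = cos ((s - t) * w).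
  rewrite /vec dot3_lin2.
  transitivity ((sin (w - s * w) * sin (w - t * w) * (k ^+ 2 * dot3 (sphere_pt p) (sphere_pt p)) +
     sin (s * w) * sin (t * w) * (k ^+ 2 * dot3 (sphere_pt q) (sphere_pt q)) +
     (sin (w - s * w) * sin (t * w) + sin (s * w) * sin (w - t * w)) *
       (k ^+ 2 * dot3 (sphere_pt p) (sphere_pt q))) / sin w ^+ 2).
    by rewrite !mulrBl !mul1r; field; exact: lt0r_neq0.
  rewrite !sphere_norm pqc !mulr1 frame_cos mulrBl.
  by rewrite [X in X / _]mulrC mulfK// expf_neq0// gt_eqF.
have onS s : dot3 (vec s) (vec s) = k^-1 ^+ 2.
  apply: (mulfI (expf_neq0 2 kn0)).
  by rewrite dotv subrr mul0r cos0 exprVn divff// expf_neq0.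
pose g s := ModelSphere (onS s).
have gE s v : sin w * dot3 v (sphere_pt (g s)) =
    sin ((1 - s) * w) * dot3 v (sphere_pt p) + sin (s * w) * dot3 v (sphere_pt q).
  by rewrite /= /vec dot3_lin; field; exact: lt0r_neq0.
have gp s r : vec s = sphere_pt r -> g s = r.
  case: r => r rP /= E; rewrite /g; move: (onS s); rewrite E => rP'.
  by congr ModelSphere; exact: Prop_irrelevance.
exists g; split=> //.
- split=> //; exists (w / k); first by rewrite divr_ge0//; lra.
  move=> s t; rewrite !in_itv/= => s01 t01.
  have api : `|(s - t) * w| <= pi.
    rewrite normrM (ger0_norm (x := w)); last lra.
    have : `|s - t| <= 1 by rewrite ler_norml; lra.
    have := normr_ge0 (s - t); nra.
  have := @sphere_dist_cos (g s) (g t) _ api (dotv s t); rewrite normrM (ger0_norm (x := w)); last lra.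
  by move=> E; apply: (mulfI kn0); rewrite [LHS]E; field.
- by apply: gp; rewrite /vec subr0 mul1r mul0r sin0 mul0r scale0r addr0 divff ?scale1r// gt_eqF.
- by apply: gp; rewrite /vec subrr mul1r mul0r sin0 mul0r scale0r add0r divff ?scale1r// gt_eqF.
Qed.

Lemma sphere_point (a b c : R) : a ^+ 2 + b ^+ 2 + c ^+ 2 = 1 ->
  exists p : model_sphere chi,
    sphere_pt p = \row_(i < 3) (k^-1 * nth 0 [:: a; b; c] i).
Proof.
move=> abc; have kn0 : k != 0 by rewrite gt_eqF// sqrt_chi_gt0.
suff E : dot3 (\row_(i < 3) (k^-1 * nth 0 [:: a; b; c] i))
    (\row_(i < 3) (k^-1 * nth 0 [:: a; b; c] i)) = k^-1 ^+ 2.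
  by exists (ModelSphere E).
rewrite /dot3 !big_ord_recl big_ord0 !mxE/= addr0.
by rewrite -[RHS]mulr1 -abc; ring.
Qed.

Lemma dot3_rows (a b c a' b' c' : R) :
  k ^+ 2 * dot3 (\row_(i < 3) (k^-1 * nth 0 [:: a; b; c] i))
    (\row_(i < 3) (k^-1 * nth 0 [:: a'; b'; c'] i)) = a * a' + b * b' + c * c'.
Proof.
rewrite /dot3 !big_ord_recl big_ord0 !mxE/= addr0.
by field; rewrite gt_eqF// sqrt_chi_gt0.
Qed.

(** Three angles satisfying the triangle inequalities, of sum less than
    [2 * pi], are the mutual distances of three points of the unit sphere. *)
Lemma sphere_three_points (a b c : R) : 0 <= a < pi -> 0 <= b < pi -> 0 <= c < pi ->
  a <= b + c -> b <= a + c -> c <= a + b -> a + b + c < 2 * pi ->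
  exists p q r, [/\ k * d p q = a, k * d q r = b & k * d r p = c].
Proof.
move=> a0 b0 c0 abc bac cab sum; have k0 := sqrt_chi_gt0.
have pi0 := pi_gt0 R.
suff [y [z [yz ab]]] : exists y z, y ^+ 2 + z ^+ 2 = sin c ^+ 2 /\
    cos a * cos c + sin a * y = cos b.
  have [|p pE] := @sphere_point 1 0 0; first by ring.
  have [|q qE] := @sphere_point (cos a) (sin a) 0.
    by have := cos2Dsin2 a; lra.
  have [|r rE] := @sphere_point (cos c) y z.
    by rewrite -addrA yz; exact: cos2Dsin2.
  exists p, q, r; split.
  - rewrite -[RHS]ger0_norm; last lra.
    apply: sphere_dist_cos; first by rewrite ger0_norm; lra.
    by rewrite pE qE dot3_rows; ring.
  - rewrite -[RHS]ger0_norm; last lra.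
    apply: sphere_dist_cos; first by rewrite ger0_norm; lra.
    by rewrite qE rE dot3_rows mul0r addr0.
  - rewrite -[RHS]ger0_norm; last lra.
    apply: sphere_dist_cos; first by rewrite ger0_norm; lra.
    by rewrite pE rE dot3_rows; ring.
have sc0 : 0 <= sin c by apply: sin_ge0_pi; lra.
have [a_0|an0] := eqVneq a 0.
  exists (sin c), 0; split; first by ring.
  have -> : b = c by lra.
  by rewrite a_0 cos0 sin0; ring.
have sa : 0 < sin a by apply: sin_gt0_pi; rewrite lt_def an0; lra.
pose y := (cos b - cos a * cos c) / sin a.
have say : sin a * y = cos b - cos a * cos c.
  by rewrite /y mulrC divfK// gt_eqF.
have lo : cos (a + c) <= cos b.
  have [ac|ac] := leP (a + c) pi; first by apply: cos_le; lra.
  have -> : cos (a + c) = cos (2 * pi - (a + c)).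
    rewrite -(cosN (a + c)) -(cosD2pi (- (a + c))); congr cos; rewrite mulr_natl; ring.
  by apply: cos_le; lra.
have hi : cos b <= cos (a - c).
  rewrite -(cos_norm (a - c)); apply: cos_le => //; last lra.
  by rewrite ler_norml; lra.
rewrite cosD in lo; rewrite cosB in hi.
have y1 : - sin c <= y <= sin c.
  have h1 : sin a * - sin c <= sin a * y by lra.
  have h2 : sin a * y <= sin a * sin c by lra.
  by rewrite !(ler_pM2l sa) in h1 h2; rewrite h1.
have y2 : 0 <= sin c ^+ 2 - y ^+ 2 by nra.
exists y, (Num.sqrt (sin c ^+ 2 - y ^+ 2)); split; last by rewrite say; ring.
by rewrite sqr_sqrtr//; ring.
Qed.

End sphere.

(** * Spherical comparison *)

Section spherical_comparison.
Context {R : realType}.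
Local Notation d := mdist.

Definition geodesic01 (M : metricType R) (g : R -> M) : Prop :=
  forall s t, 0 <= s <= 1 -> 0 <= t <= 1 -> d (g s) (g t) = `|s - t| * d (g 0) (g 1).

(** The comparison of the distances from a vertex to the points of the opposite
    side; in the model sphere of curvature [k ^ 2] this is an equality, as
    [cos] is then linear in the points of the side. *)
Definition spherical_cmp (k : R) (M : metricType R) (p : M) (g : R -> M) : Prop :=
  forall s, 0 <= s <= 1 -> let l := k * d (g 0) (g 1) in
    sin ((1 - s) * l) * cos (k * d p (g 0)) + sin (s * l) * cos (k * d p (g 1)) <=
    sin l * cos (k * d p (g s)).

Lemma geodesic01P (M : metricType R) (g : R -> M) : is_geodesic 0 1 g <-> geodesic01 g.
Proof.
split=> [[_ [s s0 gs]] t u t01 u01|gg].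
  rewrite !gs ?in_itv//= ?lexx ?ler01//.
  by rewrite sub0r normrN normr1 mulr1 mulrC.
split=> //; exists (d (g 0) (g 1)); first exact: mdist_ge0.
by move=> t u; rewrite !in_itv/= => t01 u01; rewrite gg// mulrC.
Qed.

Lemma geodesic_reparam (M : metricType R) a b (g : R -> M) (s u : R) :
  is_geodesic a b g -> a <= s -> s <= u -> u <= b ->
  geodesic01 (fun t => g ((1 - t) * s + t * u)).
Proof.
move=> [_ [v v0 gv]] as_ su ub t t' t01 t'01.
have itv r : 0 <= r <= 1 -> (1 - r) * s + r * u \in `[a, b].
  by move=> r01; rewrite in_itv/=; apply/andP; split; nra.
have z01 : 0 <= (0 : R) <= 1 by rewrite lexx ler01.
have o01 : 0 <= (1 : R) <= 1 by rewrite lexx ler01.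
rewrite !gv ?itv//.
have E (r r' : R) : (1 - r) * s + r * u - ((1 - r') * s + r' * u) = (r - r') * (u - s).
  by ring.
by rewrite !E !normrM sub0r normrN normr1 mul1r mulrCA.
Qed.

Definition e0 : 'I_3 := ord0.
Definition e1 : 'I_3 := @Ordinal 3 1 isT.
Definition e2 : 'I_3 := ord_max.

Lemma I3P (i : 'I_3) : [\/ i = e0, i = e1 | i = e2].
Proof.
by case: i => -[|[|[|]]]// i3; [apply: Or31|apply: Or32|apply: Or33]; exact: val_inj.
Qed.

Lemma ordS3 : [/\ ordS e0 = e1, ordS e1 = e2 & ordS e2 = e0].
Proof. by split; apply: val_inj. Qed.

Lemma perimeterE (M : metricType R) (T : geodesic_triangle M) :
  perimeter T = edge_length T e0 + edge_length T e1 + edge_length T e2.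
Proof.
rewrite /perimeter !big_ord_recl big_ord0 addr0 addrA.
have -> : lift ord0 ord0 = e1 by exact: val_inj.
by have -> : lift ord0 (lift ord0 ord0) = e2 by exact: val_inj.
Qed.

Lemma triangle_exists (M : metricType R) (g0 g1 g2 : R -> M) :
  is_geodesic 0 1 g0 -> is_geodesic 0 1 g1 -> is_geodesic 0 1 g2 ->
  g0 1 = g1 0 -> g1 1 = g2 0 -> g2 1 = g0 0 ->
  exists T : geodesic_triangle M, [/\ T e0 = g0, T e1 = g1 & T e2 = g2].
Proof.
move=> gg0 gg1 gg2 j0 j1 j2.
pose E (i : 'I_3) := nth g0 [:: g0; g1; g2] i.
have Eg i : is_geodesic 0 1 (E i) by case: (I3P i) => ->.
have Ej i : E i 1 = E (ordS i) 0.
  by have [s0 s1 s2] := ordS3; case: (I3P i) => ->; rewrite ?s0 ?s1 ?s2.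
by exists (GeodesicTriangle Eg Ej).
Qed.

Context (chi : R).
Hypothesis chi0 : 0 < chi.
Local Notation k := (Num.sqrt chi).

(** The comparison triangle exists because the perimeter is less than
    [circum chi], and on it the comparison is an equality. *)
Lemma CAT_spherical_cmp (M : metricType R) (g0 g1 g2 : R -> M) :
  is_geodesic 0 1 g0 -> is_geodesic 0 1 g1 -> is_geodesic 0 1 g2 ->
  g0 1 = g1 0 -> g1 1 = g2 0 -> g2 1 = g0 0 ->
  d (g0 0) (g0 1) + d (g1 0) (g1 1) + d (g2 0) (g2 1) < circum chi ->
  (forall T : geodesic_triangle M, T e0 = g0 -> T e1 = g1 -> T e2 = g2 ->
    satisfies_CAT chi T) ->
  spherical_cmp k (g2 0) g0.
Proof.
move=> gg0 gg1 gg2 j0 j1 j2 per sat s s01 /=.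
have k0 : 0 < k := sqrt_chi_gt0 chi0.
pose a := k * d (g0 0) (g0 1); pose b := k * d (g1 0) (g1 1).
pose c := k * d (g2 0) (g2 1); rewrite -/a.
have kper : a + b + c < 2 * pi by rewrite -!mulrDr -(circumE chi0) ltr_pM2l.
have a0 : 0 <= a by rewrite mulr_ge0 ?mdist_ge0 ?ltW.
have b0 : 0 <= b by rewrite mulr_ge0 ?mdist_ge0 ?ltW.
have c0 : 0 <= c by rewrite mulr_ge0 ?mdist_ge0 ?ltW.
have t1 := metric_triangle (g0 0) (g2 0) (g1 0).
have t2 := metric_triangle (g1 0) (g0 0) (g2 0).
have t3 := metric_triangle (g2 0) (g1 0) (g0 0).
rewrite (metric_sym (g0 0) (g2 0)) (metric_sym (g2 0) (g1 0)) in t1.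
rewrite (metric_sym (g1 0) (g0 0)) (metric_sym (g0 0) (g2 0)) in t2.
rewrite (metric_sym (g2 0) (g1 0)) (metric_sym (g1 0) (g0 0)) in t3.
have abc : a <= b + c by rewrite -mulrDr ler_pM2l// j0 j1 j2; lra.
have bac : b <= a + c by rewrite -mulrDr ler_pM2l// j0 j1 j2; lra.
have cab : c <= a + b by rewrite -mulrDr ler_pM2l// j0 j1 j2; lra.
have a1 : 0 <= a < pi by lra.
have b1 : 0 <= b < pi by lra.
have c1 : 0 <= c < pi by lra.
have [p [q [r [pq qr rp]]]] := sphere_three_points chi0 a1 b1 c1 abc bac cab kper.
have [g0' [gg0' g0'0 g0'1 g0'E]] := sphere_geodesic chi0 a1 pq.
have [g1' [gg1' g1'0 g1'1 _]] := sphere_geodesic chi0 b1 qr.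
have [g2' [gg2' g2'0 g2'1 _]] := sphere_geodesic chi0 c1 rp.
have [T [T0 T1 T2]] := triangle_exists gg0 gg1 gg2 j0 j1 j2.
have [T' [T'0 T'1 T'2]] := triangle_exists gg0' gg1' gg2'
  (etrans g0'1 (esym g1'0)) (etrans g1'1 (esym g2'0)) (etrans g2'1 (esym g0'0)).
have kI : injective ( *%R k) by apply: mulfI; rewrite gt_eqF.
have cmp : is_comparison T T'.
  move=> i; case: (I3P i) => ->; rewrite /edge_length ?T0 ?T1 ?T2 ?T'0 ?T'1 ?T'2.
  - by rewrite g0'0 g0'1; apply: kI.
  - by rewrite g1'0 g1'1; apply: kI.
  - by rewrite g2'0 g2'1; apply: kI.
have s01' : s \in `[0, 1] by rewrite in_itv.
have z01' : (0 : R) \in `[0, 1] by rewrite in_itv/= lexx ler01.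
have := sat T T0 T1 T2 T' cmp e0 e2 s 0 s01' z01'.
rewrite T0 T2 T'0 T'2 g2'0 -(ler_pM2l k0) => le1.
have /andP[_ lepi] := sphere_angle_itv chi0 (g0' s) r.
have kd0 : 0 <= k * d (g0 s) (g2 0) by rewrite mulr_ge0 ?mdist_ge0 ?ltW.
have := cos_le kd0 le1 lepi; rewrite (metric_sym (g0 s)) (metric_sym (g0' s)).
rewrite (sphere_cos chi0) => le2.
have sa : 0 <= sin a by apply: sin_ge0_pi; lra.
apply: le_trans (ler_wpM2l sa le2).
rewrite (mulrCA (sin a)) g0'E mulrDr !(mulrCA (k ^+ 2)) -!(sphere_cos chi0).
rewrite rp (metric_sym r q) qr /c /b j2 j1 (metric_sym (g2 0) (g0 1)) j0.
by rewrite -/a lexx.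
Qed.

(** Geodesics of length less than [pi / k] in the sphere are unique, so [g] is the arc
    of [sphere_geodesic]. *)
Lemma sphere_geodesic_cmp (g : R -> model_sphere chi) p s : geodesic01 g ->
  k * d (g 0) (g 1) < pi -> 0 <= s <= 1 ->
  let l := k * d (g 0) (g 1) in
    sin l * cos (k * d p (g s)) =
    sin ((1 - s) * l) * cos (k * d p (g 0)) + sin (s * l) * cos (k * d p (g 1)).
Proof.
move=> gg lpi s01 l; have k0 : 0 < k := sqrt_chi_gt0 chi0.
have l0 : 0 <= l < pi by rewrite /l lpi andbT mulr_ge0 ?mdist_ge0 ?ltW.
have [g' [gg' g'0 g'1 g'E]] := @sphere_geodesic _ _ chi0 (g 0) (g 1) l l0 erefl.
have z01 : 0 <= (0 : R) <= 1 by rewrite lexx ler01.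
have o01 : 0 <= (1 : R) <= 1 by rewrite lexx ler01.
have [l_0|ln0] := eqVneq l 0; first by rewrite l_0 !mulr0 sin0; ring.
have sl : 0 < sin l by apply: sin_gt0_pi; rewrite lt_def ln0; lra.
have c0 : k * d (g s) (g 0) = s * l.
  by rewrite gg// subr0 ger0_norm /l; [ring|lra].
have c1 : k * d (g s) (g 1) = (1 - s) * l.
  by rewrite gg// distrC ger0_norm /l; [ring|lra].
have gg's : g s = g' s.
  apply: mdist_positivity; apply: (mulfI (x := k)); first by rewrite gt_eqF.
  rewrite mulr0 -(normr0 R); apply: (sphere_dist_cos chi0).
    by rewrite normr0 pi_ge0.
  apply: (mulfI (x := sin l)); first by rewrite gt_eqF.
  rewrite (mulrCA (sin l)) g'E mulrDr !(mulrCA (k ^+ 2)) -!(sphere_cos chi0) c0 c1 cos0 mulr1.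
  have E : (1 - s) * l + s * l = l by ring.
  by rewrite -[in RHS]E sinD; ring.
rewrite gg's (sphere_cos chi0) (mulrCA (sin l)) g'E mulrDr !(mulrCA (k ^+ 2)).
by rewrite -!(sphere_cos chi0).
Qed.

(** Two points on different sides: the comparison is applied to one side and the
    opposite vertex, and then to the other side and the point just found, cosines
    replacing distances throughout. *)
Lemma spherical_cmp_CAT (M : metricType R) : geodesic_space M ->
  (forall x y : M, k * d x y < pi) ->
  (forall p (g : R -> M), geodesic01 g -> spherical_cmp k p g) -> CAT chi M.
Proof.
move=> Mg Mpi cmp; split=> // T per T' TT' i j s t.
have k0 : 0 < k := sqrt_chi_gt0 chi0.
rewrite !in_itv/= => s01 t01.
have side P P' n u : 0 <= u <= 1 ->
    cos (k * d P' (T' n 0)) <= cos (k * d P (T n 0)) ->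
    cos (k * d P' (T' n 1)) <= cos (k * d P (T n 1)) ->
    cos (k * d P' (T' n u)) <= cos (k * d P (T n u)).
  move=> u01 h0 h1.
  have gT : geodesic01 (T n) by apply/geodesic01P; exact: edge_geodesic.
  have gT' : geodesic01 (T' n) by apply/geodesic01P; exact: edge_geodesic.
  have lT : d (T' n 0) (T' n 1) = d (T n 0) (T n 1) by exact: TT'.
  have lpi := Mpi (T n 0) (T n 1); have lpi' := lpi; rewrite -lT in lpi'.
  have := cmp P (T n) gT u u01; have := sphere_geodesic_cmp P' gT' lpi' u01.
  rewrite /= lT; set l := k * _ in lpi *; move=> E1 E2.
  have l0 : 0 <= l by rewrite mulr_ge0 ?mdist_ge0 ?ltW.
  have z01 : 0 <= (0 : R) <= 1 by rewrite lexx ler01.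
  have [l_0|ln0] := eqVneq l 0.
    have dl : d (T n 0) (T n 1) = 0.
      by apply/eqP; move/eqP: l_0; rewrite mulf_eq0 gt_eqF.
    have -> : T n u = T n 0 by apply: mdist_positivity; rewrite gT// dl mulr0.
    have -> : T' n u = T' n 0 by apply: mdist_positivity; rewrite gT'// lT dl mulr0.
    exact: h0.
  have sl : 0 < sin l by apply: sin_gt0_pi; rewrite lt_def ln0 l0.
  rewrite -(ler_pM2l sl) E1; apply: le_trans E2; apply: lerD.
    by rewrite ler_wpM2l// sin_ge0_pi//; apply/andP; split; nra.
  by rewrite ler_wpM2l// sin_ge0_pi//; apply/andP; split; nra.
have [s0 s1 s2] := ordS3.
have T01 n : T n 1 = T (ordS n) 0 by exact: edge_joined.
have T01' n : T' n 1 = T' (ordS n) 0 by exact: edge_joined.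
have vert m n : d (T' m 0) (T' n 0) = d (T m 0) (T n 0).
  have len := TT'; rewrite /is_comparison /edge_length in len.
  have := len e0; have := len e1; have := len e2.
  rewrite !T01 !T01' s0 s1 s2 => h2 h1 h0.
  by case: (I3P m) => ->; case: (I3P n) => ->; rewrite ?mdistxx// metric_sym ?h0 ?h1 ?h2// metric_sym.
have vertex_side n m u : 0 <= u <= 1 ->
    cos (k * d (T' m 0) (T' n u)) <= cos (k * d (T m 0) (T n u)).
  by move=> u01; apply: side => //; rewrite ?T01 ?T01' vert.
have key : cos (k * d (T' j t) (T' i s)) <= cos (k * d (T j t) (T i s)).
  apply: side => //; rewrite ?T01 ?T01' metric_sym [in leRHS]metric_sym; exact: vertex_side.
have /andP[x0 xpi] := sphere_angle_itv chi0 (T' i s) (T' j t).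
have y0 : 0 <= k * d (T i s) (T j t) by rewrite mulr_ge0 ?mdist_ge0 ?ltW.
rewrite -(ler_pM2l k0); apply: cos_le_rev => //; first exact/ltW/Mpi.
by rewrite metric_sym (metric_sym (T i s)).
Qed.

End spherical_comparison.

(** * Distances in the plane *)

Section plane.
Context {R : realType}.

Definition plane_dist (r r' a : R) : R :=
  Num.sqrt (r ^+ 2 + r' ^+ 2 - 2 * r * r' * cos a).

Lemma plane_sqr_ge0 (r r' a : R) : 0 <= r ^+ 2 + r' ^+ 2 - 2 * r * r' * cos a.
Proof.
have -> : r ^+ 2 + r' ^+ 2 - 2 * r * r' * cos a =
  (r - r' * cos a) ^+ 2 + r' ^+ 2 * (1 - cos a ^+ 2) by ring.
rewrite -sin2cos2; apply: addr_ge0; first exact: sqr_ge0.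
by apply: mulr_ge0; exact: sqr_ge0.
Qed.

Lemma plane_dist_sqr (r r' a : R) :
  plane_dist r r' a ^+ 2 = r ^+ 2 + r' ^+ 2 - 2 * r * r' * cos a.
Proof. by rewrite sqr_sqrtr// plane_sqr_ge0. Qed.

Lemma plane_dist_ge0 (r r' a : R) : 0 <= plane_dist r r' a.
Proof. exact: sqrtr_ge0. Qed.

Lemma plane_triangle (r1 r2 r3 a b : R) :
  plane_dist r1 r3 (a + b) <= plane_dist r1 r2 a + plane_dist r2 r3 b.
Proof.
have x0 := plane_dist_ge0 r1 r2 a; have y0 := plane_dist_ge0 r2 r3 b.
apply: le_of_sqr; first exact: addr_ge0.
rewrite sqrrD !plane_dist_sqr.
pose p := r1 * cos a - r2; pose q := r1 * sin a.
pose p' := r2 - r3 * cos b; pose q' := r3 * sin b.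
have X2 : plane_dist r1 r2 a ^+ 2 = p ^+ 2 + q ^+ 2.
  rewrite plane_dist_sqr /p /q.
  by have := cos2Dsin2 a => E; rewrite -[r1 ^+ 2]mulr1 -{1}E; ring.
have Y2 : plane_dist r2 r3 b ^+ 2 = p' ^+ 2 + q' ^+ 2.
  rewrite plane_dist_sqr /p' /q'.
  by have := cos2Dsin2 b => E; rewrite -[r3 ^+ 2]mulr1 -{1}E; ring.
have CS : p * p' + q * q' <= plane_dist r1 r2 a * plane_dist r2 r3 b.
  apply: le_of_sqr; first exact: mulr_ge0.
  rewrite exprMn X2 Y2.
  have -> : (p ^+ 2 + q ^+ 2) * (p' ^+ 2 + q' ^+ 2) =
    (p * p' + q * q') ^+ 2 + (p * q' - q * p') ^+ 2 by ring.
  by rewrite lerDl sqr_ge0.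
suff : r1 * r3 * cos (a + b) + r2 ^+ 2 - r1 * r2 * cos a - r2 * r3 * cos b =
    - (p * p' + q * q') by rewrite -mulr_natl; lra.
by rewrite /p /q /p' /q' cosD; ring.
Qed.

Lemma plane_dist_le (r r' a b : R) : 0 <= r -> 0 <= r' -> cos b <= cos a ->
  plane_dist r r' a <= plane_dist r r' b.
Proof.
move=> r0 r'0 ab; apply: ler_wsqrtr; rewrite lerD2l lerN2.
by rewrite ler_wpM2l// !mulr_ge0.
Qed.

(** If the angles add up to more than [pi], the second one is first reduced so
    that the path from the first to the last point runs through the apex. *)
Lemma plane_angle_triangle (r1 r2 r3 a b c : R) :
  0 <= r1 -> 0 <= r2 -> 0 <= r3 -> 0 <= a <= pi -> 0 <= b <= pi ->
  0 <= c <= pi -> c <= a + b ->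
  plane_dist r1 r3 c <= plane_dist r1 r2 a + plane_dist r2 r3 b.
Proof.
move=> r10 r20 r30 a01 b01 c01 cab.
have [abpi|piab] := leP (a + b) pi.
  by apply: le_trans (plane_triangle _ _ _ _ _); apply: plane_dist_le => //; apply: cos_le; lra.
have h1 : plane_dist r2 r3 (pi - a) <= plane_dist r2 r3 b.
  by apply: plane_dist_le => //; apply: cos_le; lra.
have h2 := plane_triangle r1 r2 r3 a (pi - a); rewrite addrCA subrr addr0 in h2.
have h3 : plane_dist r1 r3 c <= plane_dist r1 r3 pi.
  by apply: plane_dist_le => //; apply: cos_le; lra.
lra.
Qed.

End plane.

(** * The Euclidean cone *)

Section euclidean_cone.
Context {R : realType} {X : metricType R}.
Local Notation d := mdist.

(** After rescaling by [k] the space lies strictly inside a hemisphere centred at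
    [o]. *)
Definition in_open_hemisphere (k : R) (o : X) : Prop :=
  0 < k /\ exists2 r, k * r < pi / 2 & forall x, d x o < r.

(** Points of the Euclidean cone over the space rescaled by [k], beyond the
    hyperplane at distance [1] from the apex and orthogonal to [o]; this part of
    the cone is convex, and complete although it does not contain the apex. *)
Record cone_over (k : R) (o : X) (H : in_open_hemisphere k o) := Cone {
  base : X;
  radius : R;
  coneP : 1 <= radius * cos (k * d o base) }.

Context (k : R) (o : X) (H : in_open_hemisphere k o).
Local Notation cone := (cone_over H).
Implicit Types z w : cone.

Lemma k_gt0 : 0 < k. Proof. by case: H. Qed.

Lemma kdist_ge0 (x y : X) : 0 <= k * d x y.
Proof. by rewrite mulr_ge0 ?mdist_ge0// ltW// k_gt0. Qed.

Lemma kdist_o (x : X) : 0 <= k * d o x < pi / 2.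
Proof.
rewrite kdist_ge0/=; have [k0 [r kr Hr]] := H; apply: lt_trans kr.
by rewrite ltr_pM2l// metric_sym.
Qed.

Lemma kdist_lt_pi (x y : X) : k * d x y < pi.
Proof.
have := kdist_o x; have := kdist_o y.
have := ler_wpM2l (ltW k_gt0) (metric_triangle x o y).
by rewrite mulrDr (metric_sym x o); lra.
Qed.

Lemma kdist_itv (x y : X) : 0 <= k * d x y <= pi.
Proof. by rewrite kdist_ge0 ltW// kdist_lt_pi. Qed.

Lemma cos_o_gt0 (x : X) : 0 < cos (k * d o x).
Proof.
apply: cos_gt0_pihalf; have := kdist_o x; have := pi_gt0 R; lra.
Qed.

Lemma radius_ge1 z : 1 <= radius z.
Proof.
have c0 := cos_o_gt0 (base z); have := coneP z => h.
have r0 : 0 < radius z by rewrite -(pmulr_lgt0 _ c0); lra.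
apply: le_trans h _; rewrite ger_pMr//; exact: cos_le1.
Qed.

Lemma radius_gt0 z : 0 < radius z.
Proof. by apply: lt_le_trans (radius_ge1 z). Qed.

Definition cone_dist z w : R :=
  plane_dist (radius z) (radius w) (k * d (base z) (base w)).

Let cone_distxx z : cone_dist z z = 0.
Proof.
rewrite /cone_dist /plane_dist mdistxx mulr0 cos0 -[RHS]sqrtr0; congr Num.sqrt; ring.
Qed.

Lemma cone_eq z w : base z = base w -> radius z = radius w -> z = w.
Proof.
case: z w => [x r p] [y s q] /= xy rs; rewrite -xy -rs in q *.
by congr Cone; exact: Prop_irrelevance.
Qed.

Let cone_dist_positivity z w : cone_dist z w = 0 -> z = w.
Proof.
move=> zw0; have := plane_dist_sqr (radius z) (radius w) (k * d (base z) (base w)).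
rewrite -/(cone_dist z w) zw0 expr0n/=.
have -> : radius z ^+ 2 + radius w ^+ 2 - 2 * radius z * radius w *
   cos (k * d (base z) (base w)) = (radius z - radius w) ^+ 2 +
   2 * radius z * radius w * (1 - cos (k * d (base z) (base w))) by ring.
have rr : 0 < 2 * radius z * radius w by rewrite !mulr_gt0 ?radius_gt0.
have c1 := cos_le1 (k * d (base z) (base w)).
have h : 0 <= 2 * radius z * radius w * (1 - cos (k * d (base z) (base w))).
  by rewrite mulr_ge0 ?(ltW rr)//; lra.
move/esym/eqP; rewrite paddr_eq0 ?sqr_ge0// sqrf_eq0 subr_eq0 mulf_eq0 (gt_eqF rr)/=.
move=> /andP[/eqP rE]; rewrite subr_eq0 => /eqP cE.
apply: cone_eq => //; apply: mdist_positivity.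
have : k * d (base z) (base w) = 0.
  apply: (@cos_inj R); rewrite ?in_itv/= ?kdist_itv ?lexx ?pi_ge0// cos0 -cE.
  by [].
by move/eqP; rewrite mulf_eq0 gt_eqF ?k_gt0//= => /eqP.
Qed.

Let cone_dist_sym z w : cone_dist z w = cone_dist w z.
Proof.
by rewrite /cone_dist metric_sym /plane_dist; congr Num.sqrt; ring.
Qed.

Let cone_dist_triangle w z v : cone_dist z v <= cone_dist z w + cone_dist w v.
Proof.
apply: plane_angle_triangle; rewrite ?(ltW (radius_gt0 _)) ?kdist_itv//.
by rewrite -mulrDr ler_wpM2l ?(ltW k_gt0)// metric_triangle.
Qed.

HB.instance Definition _ := gen_eqMixin cone.
HB.instance Definition _ := gen_choiceMixin cone.
HB.instance Definition _ := isMetric.Build R cone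
  cone_distxx cone_dist_positivity cone_dist_sym cone_dist_triangle.

Lemma cone_dist_sqr z w : d z w ^+ 2 = radius z ^+ 2 + radius w ^+ 2 -
  2 * radius z * radius w * cos (k * d (base z) (base w)).
Proof. exact: plane_dist_sqr. Qed.

(** [is_lift g z w F f]: the path [F], with base points [g (f t)], is the
    segment from [z] to [w] in the plane sector spanned by the geodesic [g];
    the equations state the polar coordinates of its points. *)
Definition is_lift (g : R -> X) z w (F : R -> cone) (f : R -> R) : Prop :=
  let l := k * d (base z) (base w) in
  forall t, 0 <= t <= 1 -> [/\ 0 <= f t <= 1, base (F t) = g (f t),
    radius (F t) * cos (f t * l) = (1 - t) * radius z + t * radius w * cos l &
    radius (F t) * sin (f t * l) = t * radius w * sin l].

End euclidean_cone.

(** * Lifts of geodesics to the cone *)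

Section polar_coordinates.
Context {R : realType}.

Lemma abs_le_of_sqr (a b : R) : 0 <= b -> a ^+ 2 <= b ^+ 2 -> - b <= a <= b.
Proof.
move=> b0 ab; rewrite (le_of_sqr b0 ab) andbT lerNl.
by apply: le_of_sqr => //; rewrite sqrrN.
Qed.

Lemma polar_exists (A B l : R) : 0 <= A -> 0 <= B -> 0 < A + B -> 0 <= l < pi ->
  exists n a, [/\ 0 < n, 0 <= a <= l, n * cos a = A + B * cos l &
    n * sin a = B * sin l].
Proof.
move=> A0 B0 AB l0pi; pose u := A + B * cos l; pose v := B * sin l.
have sl : 0 <= sin l by apply: sin_ge0_pi; lra.
have v0 : 0 <= v by rewrite mulr_ge0.
have n2 : 0 < u ^+ 2 + v ^+ 2.
  rewrite lt_def addr_ge0 ?sqr_ge0// andbT paddr_eq0 ?sqr_ge0// !sqrf_eq0.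
  apply/negP => /andP[/eqP u0]; rewrite mulf_eq0 => /orP[/eqP B_0|/eqP sl0].
    by move: u0; rewrite /u B_0; lra.
  have l_0 : l = 0.
    apply/eqP/negPn/negP => ln0.
    by have := @sin_gt0_pi R l; rewrite sl0 ltxx lt_def ln0; lra.
  by move: u0; rewrite /u l_0 cos0; lra.
pose n := Num.sqrt (u ^+ 2 + v ^+ 2); have n0 : 0 < n by rewrite sqrtr_gt0.
have nsq : n ^+ 2 = u ^+ 2 + v ^+ 2 by rewrite sqr_sqrtr// ltW.
have un : -1 <= u / n <= 1.
  rewrite ler_pdivlMr// ler_pdivrMr// mulN1r mul1r.
  by apply: abs_le_of_sqr; [exact: ltW|rewrite nsq lerDl sqr_ge0].
have ca : cos (acos (u / n)) = u / n by rewrite acosK// in_itv.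
have sa : n * sin (acos (u / n)) = v.
  rewrite sin_acos//; have -> : 1 - (u / n) ^+ 2 = (v / n) ^+ 2.
    have : (u / n) ^+ 2 + (v / n) ^+ 2 = 1.
      by rewrite [(u / n) ^+ 2]exprMn [(v / n) ^+ 2]exprMn -mulrDl -nsq exprVn divff// expf_neq0// gt_eqF.
    lra.
  by rewrite sqrtr_sqr ger0_norm ?divr_ge0 ?(ltW n0)// mulrC divfK// gt_eqF.
exists n, (acos (u / n)); split => //; last by rewrite ca mulrC divfK// gt_eqF.
rewrite acos_ge0//=; apply: cos_le_rev; rewrite ?acos_ge0 ?acos_lepi//; try lra.
rewrite ca ler_pdivlMr//.
have [c0|c0] := leP 0 (cos l).
  have : n <= A + B.
    apply: le_of_sqr; first lra.
    rewrite nsq /u /v; have := cos2Dsin2 l; have := cos_le1 l.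
    have := mulr_ge0 A0 B0; move: (A * B) => AB' ABB0 c1 cs.
    have -> : (A + B * cos l) ^+ 2 + (B * sin l) ^+ 2 =
      A ^+ 2 + 2 * (A * B) * cos l + B ^+ 2 * (cos l ^+ 2 + sin l ^+ 2) by ring.
    rewrite cs; have : A * B * cos l <= A * B * 1 by rewrite ler_wpM2l// mulr_ge0.
    lra.
  move=> nAB; have : cos l * n <= cos l * (A + B) by rewrite ler_wpM2l.
  have : A * cos l <= A * 1 by rewrite ler_wpM2l// cos_le1.
  by rewrite /u; lra.
have nB : B + A * cos l <= n.
  apply: le_of_sqr; first exact: ltW.
  rewrite nsq /u /v.
  have -> : (A + B * cos l) ^+ 2 + (B * sin l) ^+ 2 = (B + A * cos l) ^+ 2 +
    (A ^+ 2 - B ^+ 2) * (1 - cos l ^+ 2) + B ^+ 2 * sin l ^+ 2 by ring.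
  have -> : 1 - cos l ^+ 2 = sin l ^+ 2 by rewrite sin2cos2.
  have := mulr_ge0 (sqr_ge0 A) (sqr_ge0 (sin l)); lra.
have : - cos l * (B + A * cos l) <= - cos l * n by rewrite ler_wpM2l//; lra.
have : 0 <= A * (1 - cos l ^+ 2) by rewrite mulr_ge0// -sin2cos2 sqr_ge0.
by rewrite /u; lra.
Qed.

Context (r r' l : R).

Definition polar (t n a : R) : Prop :=
  n * cos a = (1 - t) * r + t * r' * cos l /\ n * sin a = t * r' * sin l.

Lemma polar_sqr t n a : polar t n a ->
  n ^+ 2 = ((1 - t) * r) ^+ 2 + (t * r') ^+ 2 + 2 * ((1 - t) * r) * (t * r') * cos l.
Proof.
move=> [h1 h2]; have E : n ^+ 2 = (n * cos a) ^+ 2 + (n * sin a) ^+ 2.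
  by rewrite !exprMn -mulrDr cos2Dsin2 mulr1.
rewrite E h1 h2; have := cos2Dsin2 l => cs.
rewrite [X in _ = _ + X + _](_ : _ = (t * r') ^+ 2 * (cos l ^+ 2 + sin l ^+ 2)); first by ring.
by rewrite cs mulr1.
Qed.

Lemma polar_cross t n a t' n' a' : polar t n a -> polar t' n' a' ->
  n * n' * sin (a' - a) = (t' - t) * (r * r' * sin l).
Proof.
move=> [h1 h2] [h1' h2'].
have -> : n * n' * sin (a' - a) = (n * cos a) * (n' * sin a') - (n * sin a) * (n' * cos a').
  by rewrite sinB; ring.
by rewrite h1 h2 h1' h2'; ring.
Qed.

Lemma polar_dot t n a t' n' a' : polar t n a -> polar t' n' a' ->
  n * n' * cos (a - a') = (1 - t) * (1 - t') * r ^+ 2 + t * t' * r' ^+ 2 +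
    ((1 - t) * t' + t * (1 - t')) * (r * r') * cos l.
Proof.
move=> [h1 h2] [h1' h2'].
have -> : n * n' * cos (a - a') = (n * cos a) * (n' * cos a') + (n * sin a) * (n' * sin a').
  by rewrite cosB; ring.
rewrite h1 h2 h1' h2'; have := cos2Dsin2 l => cs.
have -> : t * t' * r' ^+ 2 = t * t' * r' ^+ 2 * (cos l ^+ 2 + sin l ^+ 2) by rewrite cs mulr1.
ring.
Qed.

End polar_coordinates.

Section lifts.
Context {R : realType} {X : metricType R} (k : R) (o : X).
Context (H : in_open_hemisphere k o).
Local Notation d := mdist.
Local Notation cone := (cone_over H).
Implicit Types (z w p : cone) (g : R -> X) (F : R -> cone) (f : R -> R).

Let k0 : 0 < k := k_gt0 H.

Lemma lift_polar g z w F f t : is_lift g z w F f -> 0 <= t <= 1 ->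
  let l := k * d (base z) (base w) in
  polar (radius z) (radius w) l t (radius (F t)) (f t * l).
Proof. by move=> HF t01 /=; have [_ _ h1 h2] := HF t t01. Qed.

(** By the comparison for [o] the height [radius * cos] over the hyperplane is
    concave along the lift, which therefore stays in this part of the cone. *)
Lemma lift_exists g z w : geodesic01 g -> g 0 = base z -> g 1 = base w ->
  spherical_cmp k o g -> exists F f, is_lift g z w F f.
Proof.
move=> gg g0 g1 cmp.
pose l := k * d (base z) (base w).
have l0 : 0 <= l < pi by rewrite (kdist_ge0 H) (kdist_lt_pi H).
suff : forall t, exists q : cone * R, 0 <= t <= 1 ->
    [/\ 0 <= q.2 <= 1, base q.1 = g q.2,
      radius q.1 * cos (q.2 * l) = (1 - t) * radius z + t * radius w * cos l &
      radius q.1 * sin (q.2 * l) = t * radius w * sin l].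
  by move=> /choice[q Hq]; exists (fun t => (q t).1), (fun t => (q t).2).
move=> t; have [t01|] := boolP (0 <= t <= 1); last by exists (z, 0).
have rz := radius_gt0 z; have rw := radius_gt0 w.
pose A := (1 - t) * radius z; pose B := t * radius w.
have A0 : 0 <= A by rewrite mulr_ge0//; lra.
have B0 : 0 <= B by rewrite mulr_ge0//; lra.
have AB : 0 < A + B.
  rewrite /A /B; have [->|tn0] := eqVneq t 0; first lra.
  have : 0 < t * radius w by rewrite mulr_gt0// lt_def tn0; lra.
  by move: A0; rewrite /A; lra.
have [n [a [n0 a0l na1 na2]]] := polar_exists A0 B0 AB l0.
have [s [s01 sl]] : exists s, 0 <= s <= 1 /\ s * l = a.
  have [l_0|ln0] := eqVneq l 0.
    by exists 0; rewrite lexx ler01 mul0r; split => //; lra.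
  have lp : 0 < l by rewrite lt_def ln0; lra.
  exists (a / l); split; last by rewrite divfK.
  by rewrite divr_ge0//=; [rewrite ler_pdivrMr// mul1r; lra|lra|lra].
have z01 : 0 <= (0 : R) <= 1 by rewrite lexx ler01.
have cP : 1 <= n * cos (k * d o (g s)).
  have := cmp s s01; rewrite /= g0 g1 -/l.
  have h0 : (1 - t) * 1 <= A * cos (k * d o (base z)).
    by rewrite /A -mulrA ler_wpM2l ?coneP//; lra.
  have h1 : t * 1 <= B * cos (k * d o (base w)).
    by rewrite /B -mulrA ler_wpM2l ?coneP//; lra.
  have [l_0|ln0] := eqVneq l 0.
    have dl : d (g 0) (g 1) = 0.
      by apply/eqP; move/eqP: l_0; rewrite /l -g0 -g1 mulf_eq0 gt_eqF.
    move=> _; have -> : g s = base z by rewrite -g0; apply: mdist_positivity; rewrite gg// dl mulr0.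
    have wz : base w = base z by rewrite -g0 -g1; apply: mdist_positivity; rewrite metric_sym.
    move: na1; have -> : a = 0 by lra.
    by rewrite l_0 cos0 !mulr1 => ->; rewrite mulrDl; rewrite wz in h1; lra.
  have sl0 : 0 < sin l by apply: sin_gt0_pi; rewrite lt_def ln0; lra.
  have E1 : n * sin ((1 - s) * l) = A * sin l.
    have -> : (1 - s) * l = l - a by rewrite mulrBl mul1r sl.
    have -> : n * sin (l - a) = sin l * (n * cos a) - cos l * (n * sin a).
      by rewrite sinB; ring.
    by rewrite na1 na2; ring.
  move=> /(ler_wpM2l (ltW n0)).
  have -> : n * (sin ((1 - s) * l) * cos (k * d o (base z)) +
      sin (s * l) * cos (k * d o (base w))) =
    n * sin ((1 - s) * l) * cos (k * d o (base z)) +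
      n * sin (s * l) * cos (k * d o (base w)) by ring.
  rewrite E1 sl na2 => h.
  rewrite -(ler_pM2l sl0); apply: (@le_trans _ _ (sin l * (A * cos (k * d o (base z)) +
    B * cos (k * d o (base w))))); first by rewrite ler_pM2l//; lra.
  lra.
by exists (Cone H cP, s) => _ /=; rewrite sl; split.
Qed.

Section one_lift.
Context (g : R -> X) (z w : cone) (F : R -> cone) (f : R -> R).
Hypotheses (gg : geodesic01 g) (g0 : g 0 = base z) (g1 : g 1 = base w).
Hypothesis HF : is_lift g z w F f.
Let l := k * d (base z) (base w).

Lemma lift_base_dist s t : 0 <= s <= 1 -> 0 <= t <= 1 ->
  k * d (base (F s)) (base (F t)) = `|f s * l - f t * l|.
Proof.
move=> s01 t01; have [fs01 -> _ _] := HF s01; have [ft01 -> _ _] := HF t01.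
rewrite gg// g0 g1 -mulrBl normrM (ger0_norm (x := l)) ?(kdist_ge0 H)// /l; ring.
Qed.

Lemma lift_dist s t : 0 <= s <= 1 -> 0 <= t <= 1 ->
  d (F s) (F t) = `|s - t| * d z w.
Proof.
move=> s01 t01; apply/eqP; rewrite -(@eqrXn2 _ 2)// ?mulr_ge0 ?mdist_ge0//.
rewrite exprMn real_normK ?num_real// !cone_dist_sqr lift_base_dist// cos_norm -/l.
have p1 := lift_polar HF s01; have p2 := lift_polar HF t01.
have := polar_dot p1 p2; rewrite (polar_sqr p1) (polar_sqr p2) -/l => E.
apply/eqP; have -> : 2 * radius (F s) * radius (F t) * cos (f s * l - f t * l) =
   2 * (radius (F s) * radius (F t) * cos (f s * l - f t * l)) by ring.
rewrite E; ring.
Qed.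

Lemma lift0 : F 0 = z.
Proof.
have z01 : 0 <= (0 : R) <= 1 by rewrite lexx ler01.
apply: mdist_positivity; apply/eqP; rewrite -sqrf_eq0 cone_dist_sqr.
have [f01 -> h1 h2] := HF z01.
rewrite -g0 gg// subr0 ger0_norm; last by case/andP: f01.
have -> : k * (f 0 * d (g 0) (g 1)) = f 0 * l by rewrite /l g0 g1; ring.
rewrite (polar_sqr (lift_polar HF z01)) -/l.
have -> : 2 * radius (F 0) * radius z * cos (f 0 * l) =
  2 * radius z * (radius (F 0) * cos (f 0 * l)) by ring.
by rewrite h1; apply/eqP; ring.
Qed.

Lemma lift1 : F 1 = w.
Proof.
have o01 : 0 <= (1 : R) <= 1 by rewrite lexx ler01.
apply: mdist_positivity; apply/eqP; rewrite -sqrf_eq0 cone_dist_sqr.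
have [f01 -> h1 h2] := HF o01.
rewrite -g1 gg// distrC ger0_norm; last by case/andP: f01; rewrite subr_ge0.
have -> : k * ((1 - f 1) * d (g 0) (g 1)) = l - f 1 * l by rewrite /l g0 g1; ring.
rewrite (polar_sqr (lift_polar HF o01)) -/l cosB.
have -> : 2 * radius (F 1) * radius w * (cos l * cos (f 1 * l) + sin l * sin (f 1 * l)) =
  2 * radius w * (cos l * (radius (F 1) * cos (f 1 * l)) +
    sin l * (radius (F 1) * sin (f 1 * l))) by ring.
rewrite h1 h2 subrr !mul0r !add0r !mul1r.
have -> : 2 * radius w * (cos l * (radius w * cos l) + sin l * (radius w * sin l)) =
  2 * radius w ^+ 2 * (cos l ^+ 2 + sin l ^+ 2) by ring.
by rewrite cos2Dsin2; apply/eqP; ring.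
Qed.

Lemma lift_mono s t : 0 < l -> 0 <= s <= 1 -> 0 <= t <= 1 -> s < t -> f s < f t.
Proof.
move=> l0 s01 t01 st; rewrite ltNge; apply/negP => fts.
have := polar_cross (lift_polar HF s01) (lift_polar HF t01); rewrite -/l => E.
have lpi : l < pi by exact: (kdist_lt_pi H).
have [fs01 _ _ _] := HF s01; have [ft01 _ _ _] := HF t01.
have sl : 0 < sin l by apply: sin_gt0_pi; rewrite l0.
have pos : 0 < radius (F s) * radius (F t) * sin (f t * l - f s * l).
  by rewrite E !mulr_gt0 ?radius_gt0//; lra.
have neg : 0 <= sin (f s * l - f t * l).
  apply: sin_ge0_pi; rewrite -mulrBl; apply/andP; split; nra.
have : radius (F s) * radius (F t) * sin (f t * l - f s * l) <= 0.
  have -> : f t * l - f s * l = - (f s * l - f t * l) by ring.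
  by rewrite sinN mulrN oppr_le0 mulr_ge0// mulr_ge0// ltW// radius_gt0.
lra.
Qed.

(** In the cone the comparison says that the inner product with a fixed point,
    [radius * radius * cos], is concave along segments. *)
Lemma lift_concave p s u t : 0 <= s <= 1 -> 0 <= u <= 1 -> s <= u -> 0 <= t <= 1 ->
  spherical_cmp k (base p) (fun v => g ((1 - v) * f s + v * f u)) ->
  let m := (1 - t) * s + t * u in
  (1 - t) * (radius (F s) * cos (k * d (base p) (base (F s)))) +
    t * (radius (F u) * cos (k * d (base p) (base (F u)))) <=
  radius (F m) * cos (k * d (base p) (base (F m))).
Proof.
move=> s01 u01 su t01 cmp /=; set m := (1 - t) * s + t * u.
move: su; rewrite le_eqVlt => /orP[/eqP us|su].
  have -> : m = s by rewrite /m -us; ring.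
  by rewrite -us -mulrDl subrK mul1r.
have m01 : 0 <= m <= 1 by rewrite /m; apply/andP; split; nra.
have ps := lift_polar HF s01; have pu := lift_polar HF u01.
have pm := lift_polar HF m01; rewrite -/l in ps pu pm.
have [fs01 bs _ _] := HF s01; have [fu01 bu _ _] := HF u01.
have [fm01 bm _ _] := HF m01.
have l0 : 0 <= l by exact: (kdist_ge0 H).
have [l_0|ln0] := eqVneq l 0.
  have same q : 0 <= q <= 1 -> base (F q) = base (F s).
    move=> q01; apply: mdist_positivity; apply: (mulfI (x := k)); first by rewrite gt_eqF.
    by rewrite lift_base_dist// l_0 !mulr0 subrr normr0.
  rewrite (same u u01) (same m m01).
  have rad q : 0 <= q <= 1 -> radius (F q) = (1 - q) * radius z + q * radius w.
    by move=> q01; have [_ _] := HF q01; rewrite -/l l_0 mulr0 cos0 !mulr1.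
  by rewrite !rad// /m le_eqVlt; apply/orP; left; apply/eqP; ring.
have lp : 0 < l by rewrite lt_def ln0.
have lpi : l < pi by exact: (kdist_lt_pi H).
have sl : 0 < sin l by apply: sin_gt0_pi; rewrite lp.
have fsu := lift_mono lp s01 u01 su.
have mono q q' : 0 <= q <= 1 -> 0 <= q' <= 1 -> q <= q' -> f q <= f q'.
  move=> q01 q'01; rewrite le_eqVlt => /orP[/eqP ->//|qq'].
  exact/ltW/(lift_mono lp q01 q'01 qq').
have sm : s <= m by rewrite /m; nra.
have mu : m <= u by rewrite /m; nra.
have fsm := mono _ _ s01 m01 sm; have fmu := mono _ _ m01 u01 mu.
pose v := (f m - f s) / (f u - f s).
have v01 : 0 <= v <= 1.
  by rewrite /v divr_ge0 ?ler_pdivrMr ?mul1r; lra.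
have vE : (1 - v) * f s + v * f u = f m by rewrite /v; field; lra.
have := cmp v v01; rewrite /= vE subr0 mul1r mul0r addr0 subrr mul0r add0r mul1r.
rewrite -bs -bu -bm lift_base_dist//.
have E1 : `|f s * l - f u * l| = f u * l - f s * l.
  by rewrite distrC ger0_norm// subr_ge0 ler_pM2r// ltW.
have E2 : (1 - v) * (f u * l - f s * l) = f u * l - f m * l.
  by rewrite -vE; ring.
have E3 : v * (f u * l - f s * l) = f m * l - f s * l by rewrite -vE; ring.
rewrite E1 E2 E3.
set cs := cos (k * d _ (base (F s))); set cu := cos (k * d _ (base (F u))).
set cm := cos (k * d _ (base (F m))) => h.
have K : 0 < radius (F s) * radius (F u) * radius (F m).
  by rewrite !mulr_gt0 ?radius_gt0.
have x1 := polar_cross pm pu; have x2 := polar_cross ps pm; have x3 := polar_cross ps pu.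
have C0 : 0 < (u - s) * (radius z * radius w * sin l).
  by rewrite !mulr_gt0 ?radius_gt0//; lra.
rewrite -(ler_pM2l C0).
have := ler_wpM2l (ltW K) h.
have -> : radius (F s) * radius (F u) * radius (F m) *
    (sin (f u * l - f m * l) * cs + sin (f m * l - f s * l) * cu) =
    (radius (F m) * radius (F u) * sin (f u * l - f m * l)) * (radius (F s) * cs) +
    (radius (F s) * radius (F m) * sin (f m * l - f s * l)) * (radius (F u) * cu) by ring.
have -> : radius (F s) * radius (F u) * radius (F m) * (sin (f u * l - f s * l) * cm) =
    (radius (F s) * radius (F u) * sin (f u * l - f s * l)) * (radius (F m) * cm) by ring.
rewrite x1 x2 x3 => hh; apply: le_trans hh.
by rewrite le_eqVlt; apply/orP; left; apply/eqP; rewrite /m; ring.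
Qed.

(** The apex and a lift lie in a plane, where the comparison is an equality. *)
Lemma lift_radius_sqr s u t : 0 <= s <= 1 -> 0 <= u <= 1 -> 0 <= t <= 1 ->
  let m := (1 - t) * s + t * u in
  radius (F m) ^+ 2 = (1 - t) * radius (F s) ^+ 2 + t * radius (F u) ^+ 2 -
    t * (1 - t) * d (F s) (F u) ^+ 2.
Proof.
move=> s01 u01 t01 m; have m01 : 0 <= m <= 1 by rewrite /m; apply/andP; split; nra.
rewrite lift_dist// exprMn real_normK ?num_real// cone_dist_sqr -/l.
rewrite (polar_sqr (lift_polar HF s01)) (polar_sqr (lift_polar HF u01)).
by rewrite (polar_sqr (lift_polar HF m01)) -/l /m; ring.
Qed.

Lemma lift_cn p s u t : 0 <= s <= 1 -> 0 <= u <= 1 -> s <= u -> 0 <= t <= 1 ->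
  spherical_cmp k (base p) (fun v => g ((1 - v) * f s + v * f u)) ->
  cn_ineq p (F s) (F u) (F ((1 - t) * s + t * u)) t.
Proof.
move=> s01 u01 su t01 cmp; have := lift_concave s01 u01 su t01 cmp.
have := lift_radius_sqr s01 u01 t01; set m := (1 - t) * s + t * u => /= E h.
rewrite /cn_ineq !(cone_dist_sqr p) E.
have := ler_wpM2l (ltW (radius_gt0 p)) h; lra.
Qed.

(** The point [g s] of the side is the base point of [F t] for the [t] defined below,
    at which the ray of angle [s * l] crosses the planar segment; the comparison at
    [F t] is the spherical one up to positive factors. *)
Lemma lift_cmp p : (forall t, 0 <= t <= 1 -> cn_ineq p z w (F t) t) ->
  spherical_cmp k (base p) g.
Proof.
move=> cn s s01 /=; rewrite [d (g 0) (g 1)](_ : _ = d (base z) (base w)) -/l; last first.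
  by rewrite g0 g1.
have l0 : 0 <= l by exact: (kdist_ge0 H).
have z01 : 0 <= (0 : R) <= 1 by rewrite lexx ler01.
have o01 : 0 <= (1 : R) <= 1 by rewrite lexx ler01.
have [->|ln0] := eqVneq l 0; first by rewrite !mulr0 sin0; lra.
have lp : 0 < l by rewrite lt_def ln0.
have lpi : l < pi by exact: (kdist_lt_pi H).
have sl : 0 < sin l by apply: sin_gt0_pi; rewrite lp.
have a0 : 0 <= sin (s * l) by apply: sin_ge0_pi; apply/andP; split; nra.
have b0 : 0 <= sin ((1 - s) * l) by apply: sin_ge0_pi; apply/andP; split; nra.
have rz := radius_gt0 z; have rw := radius_gt0 w.
have den : 0 < radius z * sin (s * l) + radius w * sin ((1 - s) * l).
  have A0 := mulr_ge0 (ltW rz) a0; have B0 := mulr_ge0 (ltW rw) b0.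
  have [s0|s0] := eqVneq s 0.
    by move: B0; rewrite s0 mul0r sin0 mulr0 add0r subr0 mul1r => _; rewrite mulr_gt0.
  have : 0 < sin (s * l).
    apply: sin_gt0_pi; rewrite mulr_gt0//=; last by rewrite lt_def s0; lra.
    by apply: le_lt_trans lpi; rewrite ler_piMl//; lra.
  by move=> /(mulr_gt0 rz); lra.
pose t := radius z * sin (s * l) / (radius z * sin (s * l) + radius w * sin ((1 - s) * l)).
have tE : t * radius w * sin ((1 - s) * l) = (1 - t) * radius z * sin (s * l).
  by rewrite /t; field; exact: lt0r_neq0.
have t01 : 0 <= t <= 1.
  rewrite /t; apply/andP; split; first by rewrite divr_ge0 ?mulr_ge0 ?(ltW rz) ?(ltW den).
  by rewrite ler_pdivrMr// mul1r lerDl mulr_ge0// ltW.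
have [ft01 bt h1 h2] := HF t01; rewrite -/l in h1 h2.
have n0 := radius_gt0 (F t).
have lE : (1 - s) * l = l - s * l by ring.
have ftE : f t = s.
  have : radius (F t) * sin (f t * l - s * l) = 0.
    have -> : radius (F t) * sin (f t * l - s * l) =
      (radius (F t) * sin (f t * l)) * cos (s * l) - (radius (F t) * cos (f t * l)) * sin (s * l).
      by rewrite sinB; ring.
    rewrite h1 h2; move: tE; rewrite lE sinB => tE.
    have : t * radius w * (sin l * cos (s * l) - cos l * sin (s * l)) -
      (1 - t) * radius z * sin (s * l) = 0 by rewrite tE subrr.
    by move=> <-; ring.
  move/eqP; rewrite mulf_eq0 gt_eqF//= -mulrBl => /eqP sin_0.
  have small : `|(f t - s) * l| < pi.
    rewrite normrM (gtr0_norm lp); apply: le_lt_trans lpi; rewrite ler_piMl//.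
    by rewrite ler_norml; lra.
  apply/eqP; rewrite -subr_eq0; apply/negPn/negP => ne.
  move: small; rewrite ltr_norml => sm.
  have [neg|pos|e] := ltgtP (f t - s) 0; last by rewrite e eqxx in ne.
    have : 0 < sin (- ((f t - s) * l)).
      by apply: sin_gt0_pi; apply/andP; split; nra.
    by rewrite sinN sin_0 oppr0 ltxx.
  have : 0 < sin ((f t - s) * l) by apply: sin_gt0_pi; apply/andP; split; nra.
  by rewrite sin_0 ltxx.
rewrite ftE in bt h1 h2.
have := cn t t01; rewrite /cn_ineq !(cone_dist_sqr p) -/l bt.
have := lift_radius_sqr z01 o01 t01; rewrite /= lift0 lift1 mulr0 add0r mulr1 => ->.
rewrite -g0 -g1 => h.
have n1 : radius (F t) * sin ((1 - s) * l) = (1 - t) * radius z * sin l.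
  rewrite lE sinB.
  have -> : radius (F t) * (sin l * cos (s * l) - cos l * sin (s * l)) =
    sin l * (radius (F t) * cos (s * l)) - cos l * (radius (F t) * sin (s * l)) by ring.
  by rewrite h1 h2; ring.
rewrite -(ler_pM2l n0).
have -> : radius (F t) * (sin ((1 - s) * l) * cos (k * d (base p) (g 0)) +
    sin (s * l) * cos (k * d (base p) (g 1))) =
  radius (F t) * sin ((1 - s) * l) * cos (k * d (base p) (g 0)) +
    radius (F t) * sin (s * l) * cos (k * d (base p) (g 1)) by ring.
rewrite n1 h2.
have rp := radius_gt0 p.
have : 2 * radius p * ((1 - t) * radius z * cos (k * d (base p) (g 0)) +
    t * radius w * cos (k * d (base p) (g 1))) <=
    2 * radius p * (radius (F t) * cos (k * d (base p) (g s))) by lra.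
rewrite ler_pM2l ?mulr_gt0// => /(ler_wpM2l (ltW sl)); lra.
Qed.

End one_lift.

End lifts.

(** * Bounds for distances in the cone *)

Section trigonometric_bounds.
Context {R : realType}.
Implicit Types x y : R.

Lemma ge0_of_derive (f df : R -> R) (b : R) : 0 <= b -> f 0 = 0 ->
  (forall x, is_derive x 1 f (df x)) ->
  (forall x, 0 < x < b -> 0 <= df x) -> 0 <= f b.
Proof.
rewrite le_eqVlt => /orP[/eqP <- -> //|b0] f0 fd df0.
have fc : {within `[0, b], continuous f}.
  apply: derivable_within_continuous => x _; by have [] := fd x.
have [c c0b] := MVT b0 (fun x _ => fd x) fc.
rewrite f0 !subr0 => ->; rewrite in_itv/= in c0b.
by apply: mulr_ge0; [exact: df0|exact: ltW].
Qed.

Lemma sin_le x : 0 <= x -> sin x <= x.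
Proof.
move=> x0; rewrite -subr_ge0.
apply: (@ge0_of_derive (fun y => y - sin y) (fun y => 1 - cos y)) => [//||y _].
- by rewrite sin0 subr0.
- by rewrite /= subr_ge0 cos_le1.
Qed.

Lemma cos_ge x : 1 - x ^+ 2 / 2 <= cos x.
Proof.
wlog x0 : x / 0 <= x.
  move=> h; have [/h//|/ltW x0] := leP 0 x.
  by rewrite -(cosN x) -sqrrN h// oppr_ge0.
rewrite -subr_ge0.
apply: (@ge0_of_derive (fun y => cos y - (1 - y ^+ 2 / 2)) (fun y => y - sin y)) => [//||y|y /andP[y0 _]].
- by rewrite cos0 expr0n/=; ring.
- apply: is_derive_eq; rewrite /GRing.scale/=; by field.
- by rewrite /= subr_ge0 sin_le// ltW.
Qed.

Lemma sin_ge_cubic x : 0 <= x -> x - x ^+ 3 / 6 <= sin x.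
Proof.
move=> x0; rewrite -subr_ge0.
apply: (@ge0_of_derive (fun y => sin y - (y - y ^+ 3 / 6)) (fun y => cos y - (1 - y ^+ 2 / 2))) => [//||y|y _].
- by rewrite sin0 expr0n/=; ring.
- apply: is_derive_eq; rewrite /GRing.scale/=; by field.
- by rewrite /= subr_ge0 cos_ge.
Qed.

Lemma cos_le_quartic x : cos x <= 1 - x ^+ 2 / 2 + x ^+ 4 / 24.
Proof.
wlog x0 : x / 0 <= x.
  move=> h; have [/h//|/ltW x0] := leP 0 x.
  have E : x ^+ 4 = (- x) ^+ 4 by ring.
  by rewrite -(cosN x) -sqrrN E h// oppr_ge0.
rewrite -subr_ge0.
apply: (@ge0_of_derive (fun y => 1 - y ^+ 2 / 2 + y ^+ 4 / 24 - cos y)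
  (fun y => sin y - (y - y ^+ 3 / 6))) => [//||y|y /andP[y0 _]].
- by rewrite cos0 !expr0n/=; ring.
- apply: is_derive_eq; rewrite /GRing.scale/=; by field.
- by rewrite /= subr_ge0 sin_ge_cubic// ltW.
Qed.

Lemma pi_lt4 : pi < 4 :> R.
Proof. by have := pihalf_lt2 R; lra. Qed.

(** A crude constant, valid up to [pi]: the quartic bound is used up to [3], and
    beyond [3] the cosine is not positive. *)
Lemma one_sub_cos_ge x : 0 <= x <= pi -> x ^+ 2 / 32 <= 1 - cos x.
Proof.
move=> x0pi; have p4 := pi_lt4.
have [x3|x3] := leP x 3.
  have := cos_le_quartic x.
  have : x ^+ 2 <= 9 by nra.
  have -> : x ^+ 4 = x ^+ 2 * x ^+ 2 by ring.
  have := sqr_ge0 x; move: (x ^+ 2) => y; nra.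
have : cos x <= 0.
  rewrite -cos_pihalf; apply: cos_le; try lra; by have := pihalf_02 R; lra.
by nra.
Qed.

Lemma cos_lipschitz x y : `|cos x - cos y| <= `|x - y|.
Proof.
wlog xy : x y / x < y.
  move=> h; have [/h//|/h|->] := ltgtP x y; last by rewrite !subrr.
  by rewrite distrC (distrC y).
have cc : {within `[x, y], continuous (@cos R)}.
  by apply: continuous_subspaceT; exact: continuous_cos.
have [c _] := MVT xy (fun z _ => is_derive_cos z) cc.
by rewrite distrC => ->; rewrite normrM (distrC x) ler_piMl// normrN sin_max.
Qed.

End trigonometric_bounds.

Section cone_bounds.
Context {R : realType} {X : metricType R} (k : R) (o : X).
Context (H : in_open_hemisphere k o).
Local Notation d := mdist.
Local Notation cone := (cone_over H).
Implicit Types (z w p : cone).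

Lemma cone_dist_split z w : d z w ^+ 2 = (radius z - radius w) ^+ 2 +
  2 * (radius z * radius w) * (1 - cos (k * d (base z) (base w))).
Proof. by rewrite cone_dist_sqr; ring. Qed.

Lemma cone_dist_upper z w : d z w ^+ 2 <= (radius z - radius w) ^+ 2 +
  radius z * radius w * (k * d (base z) (base w)) ^+ 2.
Proof.
rewrite cone_dist_split lerD2l.
have P0 : 0 <= radius z * radius w by rewrite mulr_ge0// ltW ?radius_gt0.
have := cos_ge (k * d (base z) (base w)).
move: (radius z * radius w) P0 => P P0; move: (k * _) => x; move: (cos x) (x ^+ 2) => c y.
by move=> cy; nra.
Qed.

Lemma radius_dist z w : `|radius z - radius w| <= d z w.
Proof.
rewrite ler_norml; apply: abs_le_of_sqr; first exact: mdist_ge0.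
rewrite cone_dist_split lerDl mulr_ge0 ?subr_ge0 ?cos_le1//.
by rewrite !mulr_ge0// ltW ?radius_gt0.
Qed.

Lemma base_dist_radius z w :
  radius z * radius w * (k * d (base z) (base w)) ^+ 2 <= 16 * d z w ^+ 2.
Proof.
have P0 : 0 <= radius z * radius w by rewrite mulr_ge0// ltW ?radius_gt0.
have := one_sub_cos_ge (kdist_itv H (base z) (base w)).
rewrite cone_dist_split; have := sqr_ge0 (radius z - radius w).
move: (radius z * radius w) P0 => P P0; move: (_ ^+ 2) => q q0.
move: (k * _) => x; move: (cos x) (x ^+ 2) => c y cy.
have : P * (y / 32) <= P * (1 - c) by rewrite ler_wpM2l.
lra.
Qed.

Lemma base_dist z w : k * d (base z) (base w) <= 4 * d z w.
Proof.
apply: le_of_sqr; first by rewrite mulr_ge0// mdist_ge0.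
apply: le_trans (_ : 16 * d z w ^+ 2 <= _); last by rewrite exprMn; lra.
apply: le_trans (base_dist_radius z w); rewrite ler_peMl ?sqr_ge0//.
by rewrite -[leLHS]mulr1 ler_pM ?radius_ge1.
Qed.

End cone_bounds.

(** * Completeness of the cone *)

Section completeness.
Context {R : realType}.
Local Notation d := mdist.

Lemma complete_sequence (M : metricType R) (u : nat -> M) : complete_metric M ->
  (forall e : R, 0 < e -> exists N : nat, forall m n : nat, (N <= m)%N -> (N <= n)%N ->
    d (u m) (u n) < e) ->
  exists l, forall e : R, 0 < e -> exists N : nat, forall n : nat, (N <= n)%N -> d (u n) l < e.
Proof.
move=> Mc uc.
have [|l ul] := Mc (u @ \oo) _.
  apply/cauchy_exP => e e0; have [N uN] := uc e e0.
  by exists (u N); exists N => //= n /= Nn; rewrite ballEmdist; exact: uN.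
exists l => e e0.
have [N _ HN] := ul _ (nbhsx_ballx l e e0).
by exists N => n Nn; rewrite metric_sym; have := HN n Nn; rewrite /= ballEmdist.
Qed.

Lemma real_cauchy (u : nat -> R) :
  (forall e : R, 0 < e -> exists N : nat, forall m n : nat, (N <= m)%N -> (N <= n)%N ->
    `|u m - u n| < e) ->
  exists l, forall e : R, 0 < e -> exists N : nat, forall n : nat, (N <= n)%N -> `|u n - l| < e.
Proof.
move=> uc.
have ul : cvg (u n @[n --> \oo]).
  apply: cauchy_cvg; apply/cauchy_exP => e e0; have [N uN] := uc e e0.
  by exists (u N); exists N => //= n /= Nn; rewrite /ball/=; exact: uN.
exists (lim (u n @[n --> \oo])) => e e0.
have [N _ HN] := ul _ (nbhsx_ballx _ e e0).
by exists N => n Nn; rewrite distrC; exact: HN.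
Qed.

Lemma closed_approx (M : metricType R) (A : set M) x : closed A ->
  (forall e : R, 0 < e -> exists2 y, A y & d x y < e) -> A x.
Proof.
move=> Acl h; apply: Acl => B /nbhs_ballP[e /= e0 eB].
have [y Ay xy] := h e e0; exists y; split=> //; apply: eB.
by rewrite ballEmdist.
Qed.

Lemma sub_geodesic01 (M : metricType R) (g : R -> M) (a b : R) :
  geodesic01 g -> 0 <= a <= 1 -> 0 <= b <= 1 ->
  geodesic01 (fun v => g ((1 - v) * a + v * b)).
Proof.
move=> gg a01 b01 s t s01 t01.
have itv v : 0 <= v <= 1 -> 0 <= (1 - v) * a + v * b <= 1 by move=> v01; apply/andP; split; nra.
have z01 : 0 <= (0 : R) <= 1 by rewrite lexx ler01.
have o01 : 0 <= (1 : R) <= 1 by rewrite lexx ler01.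
rewrite (gg _ _ (itv _ s01) (itv _ t01)) (gg _ _ (itv _ z01) (itv _ o01)).
have -> : (1 - s) * a + s * b - ((1 - t) * a + t * b) = (s - t) * (b - a) by ring.
have -> : (1 - 0) * a + 0 * b - ((1 - 1) * a + 1 * b) = - (b - a) by ring.
by rewrite normrM normrN mulrA.
Qed.

End completeness.

Section cone_completeness.
Context {R : realType} {X : metricType R} (k : R) (o : X).
Context (H : in_open_hemisphere k o).
Local Notation d := mdist.
Local Notation cone := (cone_over H).
Implicit Types (z w p : cone).

Lemma cone_dist_le z w (B : R) : radius z <= B -> radius w <= B ->
  d z w <= `|radius z - radius w| + B * (k * d (base z) (base w)).
Proof.
move=> zB wB; have := kdist_ge0 H (base z) (base w); have := cone_dist_upper z w.
have := radius_gt0 z; have := radius_gt0 w.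
move: (k * _) => x; rewrite -[X in X + _]real_normK ?num_real//.
have := normr_ge0 (radius z - radius w); move: (`|_|) => y y0 w0 z0 h x0.
apply: le_of_sqr; first by rewrite addr_ge0// mulr_ge0//; lra.
apply: le_trans h _; rewrite sqrrD -addrA lerD2l -[leLHS]add0r lerD//.
  by rewrite mulrn_wge0// !mulr_ge0//; lra.
by rewrite exprMn ler_wpM2r ?sqr_ge0// expr2 ler_pM//; lra.
Qed.

Lemma cone_complete : complete_metric X -> forall u : nat -> cone,
  (forall e : R, 0 < e -> exists N : nat, forall m n : nat, (N <= m)%N -> (N <= n)%N ->
    d (u m) (u n) < e) ->
  exists l, forall e : R, 0 < e -> exists N : nat, forall n : nat, (N <= n)%N -> d (u n) l < e.
Proof.
move=> Xc u uc; have k0 := k_gt0 H.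
have [r ur] : exists r, forall e : R, 0 < e -> exists N : nat, forall n : nat, (N <= n)%N ->
    `|radius (u n) - r| < e.
  apply: (@real_cauchy R (fun n => radius (u n))) => e e0; have [N uN] := uc e e0.
  by exists N => m n Nm Nn; apply: le_lt_trans (radius_dist _ _) _; exact: uN.
have [x ux] : exists x, forall e : R, 0 < e -> exists N : nat, forall n : nat, (N <= n)%N ->
    d (base (u n)) x < e.
  apply: (complete_sequence Xc) => e e0.
  have [|N uN] := uc (k * e / 4) _; first by rewrite !mulr_gt0.
  exists N => m n Nm Nn; have := uN _ _ Nm Nn; have := base_dist (u m) (u n).
  by move=> h1 h2; rewrite -(ltr_pM2l k0); lra.
have [N0 r0] : exists N : nat, forall n, (N <= n)%N -> radius (u n) <= `|r| + 1.
  have [N HN] := ur 1 ltr01; exists N => n /HN; rewrite ltr_norml => /andP[_ h].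
  by have := ler_norm r; lra.
have xr : 1 <= r * cos (k * d o x).
  apply/ler_addgt0Pl => e e0.
  have [|N1 H1] := ur (e / 2) _; first by lra.
  pose B := `|r| + 1; have B0 : 0 < B by rewrite ltr_wpDl.
  have [|N2 H2] := ux (e / (2 * B * k)) _; first by rewrite divr_gt0// !mulr_gt0.
  pose n := maxn N1 N2.
  have := H1 n (leq_maxl _ _); have := H2 n (leq_maxr _ _).
  rewrite ltr_pdivlMr ?mulr_gt0//.
  have := coneP (u n); have := cos_lipschitz (k * d o (base (u n))) (k * d o x).
  have : `|k * d o (base (u n)) - k * d o x| <= k * d (base (u n)) x.
    rewrite -mulrBr normrM (gtr0_norm k0) ler_pM2l// ler_norml.
    have := metric_triangle o x (base (u n)); have := metric_triangle o (base (u n)) x.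
    by rewrite (metric_sym x); lra.
  have := cos_le1 (k * d o (base (u n))); have := cos_geN1 (k * d o (base (u n))).
  move: (radius (u n)) (cos (k * d o (base (u n)))) (cos (k * d o x)) => q c c' c1 cN1 h.
  move=> /le_trans /(_ h){h}; move: (d _ _) => y h qc yB.
  rewrite ltr_norml => /andP[rq1 rq2].
  have E : q * c = r * c' + r * (c - c') + (q - r) * c by ring.
  have h1 : (q - r) * c <= e / 2.
    by apply: le_trans (ler_norm _) _; rewrite normrM -[leRHS]mulr1 ler_pM// ler_norml; lra.
  have h2 : r * (c - c') <= e / 2.
    apply: le_trans (ler_norm _) _; rewrite normrM.
    apply: le_trans (_ : B * (k * y) <= _); first by rewrite ler_pM//; rewrite /B; lra.
    by move: yB; rewrite !mulrA; lra.
  by lra.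
pose l : cone := Cone H xr; exists l => e e0.
pose B := `|r| + 1; have B0 : 0 < B by rewrite ltr_wpDl.
have [|N1 H1] := ur (e / 2) _; first by lra.
have [|N2 H2] := ux (e / (2 * B * k)) _; first by rewrite divr_gt0// !mulr_gt0.
exists (maxn N0 (maxn N1 N2)) => n; rewrite !geq_max => /and3P[n0 n1 n2].
have := H1 n n1; have := H2 n n2; rewrite ltr_pdivlMr ?mulr_gt0//.
have := @cone_dist_le (u n) l B (r0 n n0) _; rewrite /=.
have -> : r <= B by have := ler_norm r; rewrite /B; lra.
move=> /(_ isT); move: (d (base _) _) => y; move: (d _ _) => D.
have -> : y * (2 * B * k) = 2 * (B * (k * y)) by ring.
by lra.
Qed.

End cone_completeness.

(** * Comparison in the cone near the core *)

Section cone_over_relative_cat.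
Context {R : realType} (chi : R) {X : metricType R} (Delta : set X) (o : X).
Local Notation k := (Num.sqrt chi).
Local Notation d := mdist.
Hypothesis chi0 : 0 < chi.
Hypothesis Xg : geodesic_space X.
Hypothesis Delta_closed : closed Delta.
Hypothesis Delta_convex : geodesically_convex Delta.
Hypothesis triangles_at_Delta : forall T : geodesic_triangle X,
  (exists i, Delta (vertex T i)) -> perimeter T < circum chi -> satisfies_CAT chi T.
Hypothesis balls_off_Delta : exists2 lambda : R, 0 < lambda &
  forall x : X, ~ Delta x ->
    let B := mclosed_ball x (lambda * mdist_set x Delta) in
    complete_metric (set_type B) /\ CAT chi (set_type B).
Hypothesis Delta_o : Delta o.
Context (H : in_open_hemisphere k o).
Local Notation cone := (cone_over H).
Implicit Types (z w p a b c : cone) (t s u : R).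

Lemma geodesics_exist : exists G : X -> X -> R -> X, forall x y,
  [/\ geodesic01 (G x y), G x y 0 = x & G x y 1 = y].
Proof.
suff /choice[G HG] : forall xy : X * X, exists g : R -> X,
    [/\ geodesic01 g, g 0 = xy.1 & g 1 = xy.2].
  by exists (fun x y => G (x, y)) => x y; have := HG (x, y).
move=> [x y]; have [a [b [g [gg ga gb]]]] := Xg x y.
have [ab _] := gg; exists (fun t => g ((1 - t) * a + t * b)); split.
- exact: (geodesic_reparam gg).
- by rewrite /= subr0 mul1r mul0r addr0.
- by rewrite /= subrr mul1r mul0r add0r.
Qed.

(** The two sides through [x] may be chosen freely, as the hypothesis covers every
    triangle with a vertex in [Delta]. *)
Lemma core_triangle_cmp (g : R -> X) x : geodesic01 g -> Delta x \/ Delta (g 0) ->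
  k * d x (g 0) + k * d x (g 1) + k * d (g 0) (g 1) < 2 * pi ->
  spherical_cmp k x g.
Proof.
move=> gg core per; have [G HG] := geodesics_exist.
have [G1 G10 G11] := HG (g 1) x; have [G2 G20 G21] := HG x (g 0).
have {}per : d (g 0) (g 1) + d (g 1) x + d x (g 0) < circum chi.
  rewrite -(ltr_pM2l (sqrt_chi_gt0 chi0)) circumE//; move: per.
  rewrite (metric_sym (g 1) x); move: (d x (g 0)) (d x (g 1)) (d (g 0) (g 1)) => u v w h.
  by have -> : k * (w + v + u) = k * u + k * v + k * w by ring.
rewrite -G20; apply: (@CAT_spherical_cmp _ chi chi0 _ g (G (g 1) x) (G x (g 0))).
- by apply/geodesic01P.
- by apply/geodesic01P.
- by apply/geodesic01P.
- by rewrite G10.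
- by rewrite G11 G20.
- by rewrite G21.
- by rewrite G10 G11 G20 G21.
move=> T T0 T1 T2; case: (ltP (perimeter T) (circum chi)) => pT.
  apply: triangles_at_Delta => //.
  case: core => D; [exists e2|exists e0]; rewrite /vertex ?T2 ?T0//.
  by rewrite G20.
move: pT; rewrite perimeterE /edge_length T0 T1 T2 leNgt => /negP[].
by rewrite G10 G11 G20 G21.
Qed.

Lemma origin_cmp (g : R -> X) : geodesic01 g -> spherical_cmp k o g.
Proof.
move=> gg; apply: core_triangle_cmp; [by []|by left|].
have := kdist_o H (g 0); have := kdist_o H (g 1); have := kdist_lt_pi H (g 0) (g 1).
lra.
Qed.

(** A triangle whose vertices are within [e] of [x] stays within [3 * e] of [x],
    hence is a triangle of the ball of radius [3 * e]. *)
Lemma ball_triangle_cmp (x p : X) (g : R -> X) (r e : R) :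
  CAT chi (set_type (mclosed_ball x r)) -> 0 <= e -> 3 * e <= r -> k * e < pi / 3 ->
  geodesic01 g -> d x p <= e -> d x (g 0) <= e -> d x (g 1) <= e ->
  spherical_cmp k p g.
Proof.
set B := mclosed_ball x r => -[_ HB] e0 er ke gg xp x0 x1.
have [G HG] := geodesics_exist.
have Bx : B x by rewrite /B/mclosed_ball/= mdistxx; lra.
pose xB : set_type B := SigSub (mem_set Bx).
pose toB y : set_type B := if pselect (B y) is left h then SigSub (mem_set h) else xB.
have toBK y : B y -> \val (toB y) = y by rewrite /toB; case: pselect.
have inB (h : R -> X) t : geodesic01 h -> d x (h 0) <= e -> d x (h 1) <= e ->
    0 <= t <= 1 -> B (h t).
  move=> hh h0 h1 t01; have z01 : 0 <= (0 : R) <= 1 by rewrite lexx ler01.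
  have h2 := metric_triangle (h 0) x (h 1); rewrite (metric_sym (h 0) x) in h2.
  have h3 := metric_triangle x (h 0) (h t); rewrite hh// sub0r normrN in h3.
  have h4 : `|t| * d (h 0) (h 1) <= d (h 0) (h 1).
    by rewrite ler_piMl ?mdist_ge0// ger0_norm; case/andP: t01.
  by rewrite /B/mclosed_ball/=; lra.
have geoB (h : R -> X) : geodesic01 h -> d x (h 0) <= e -> d x (h 1) <= e ->
    is_geodesic 0 1 (toB \o h).
  move=> hh h0 h1; apply/geodesic01P => s t s01 t01.
  have o01 : 0 <= (1 : R) <= 1 by rewrite lexx ler01.
  have z01 : 0 <= (0 : R) <= 1 by rewrite lexx ler01.
  rewrite /mdist/= !toBK; last exact: inB.
  - exact: hh.
  - exact: inB.
  - exact: inB.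
  - exact: inB.
have [G1 G10 G11] := HG (g 1) p; have [G2 G20 G21] := HG p (g 0).
have o01 : 0 <= (1 : R) <= 1 by rewrite lexx ler01.
have z01 : 0 <= (0 : R) <= 1 by rewrite lexx ler01.
have Bp : B p by rewrite /B/mclosed_ball/=; lra.
have Bg t : 0 <= t <= 1 -> B (g t) by exact: inB.
have E (y w : X) : B y -> B w -> d (toB y) (toB w) = d y w.
  by move=> By Bw; rewrite [LHS]/mdist/= !toBK.
have := @CAT_spherical_cmp _ chi chi0 (set_type B) (toB \o g) (toB \o G (g 1) p)
  (toB \o G p (g 0)).
have Bg0 : B (g 0) := Bg 0 z01; have Bg1 : B (g 1) := Bg 1 o01.
rewrite /= G10 G11 G20 G21 !E// => h; have {}h := h (geoB _ gg x0 x1).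
have {}h := h (geoB _ G1 ltac:(by rewrite G10) ltac:(by rewrite G11)).
have {}h := h (geoB _ G2 ltac:(by rewrite G20) ltac:(by rewrite G21)).
have per : d (g 0) (g 1) + d (g 1) p + d p (g 0) < circum chi.
  apply: (@le_lt_trans _ _ (6 * e)).
    have := metric_triangle (g 0) x (g 1); have := metric_triangle (g 1) x p.
    have := metric_triangle p x (g 0); rewrite (metric_sym p x) (metric_sym (g 0) x).
    by rewrite (metric_sym (g 1) x); lra.
  rewrite -(ltr_pM2l (sqrt_chi_gt0 chi0)) circumE//.
  have -> : k * (6 * e) = 6 * (k * e) by ring.
  lra.
have {}h := h erefl erefl erefl per.
have {}h := h ltac:(move=> T T0 T1 T2; apply: HB;
  by rewrite perimeterE /edge_length T0 T1 T2 /= G10 G11 G20 G21 !E).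
move=> s s01; have Bgs := Bg s s01.
by have := h s s01; rewrite /= !E.
Qed.

(** The radius is that of [z], unless the point would then lie below the hyperplane,
    in which case the point is put on it; the radius of the hyperplane over [y]
    exceeds the one over [base z] by at most a multiple of the distance. *)
Lemma cone_point_over : exists2 C : R, 0 < C & forall z (y : X), exists2 w : cone,
  base w = y & d z w <= C * radius z * (k * d (base z) y).
Proof.
have [k0 [r kr Hr]] := H; have p0 := pi_gt0 R.
have r0 : 0 < r by apply: le_lt_trans (Hr o); rewrite mdist_ge0.
pose h := cos (k * r).
have h0 : 0 < h.
  have kr0 : 0 < k * r by rewrite mulr_gt0.
  by apply: cos_gt0_pihalf; lra.
have h1 : h <= 1 := cos_le1 _.
have hx x : h <= cos (k * d o x).
  apply: cos_le; [exact: (kdist_ge0 H)|by rewrite ler_pM2l// metric_sym ltW|by lra].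
exists (2 / h) => [|z y]; first by rewrite divr_gt0.
have cy := hx y; have cz := hx (base z); have := coneP z; have z1 := radius_ge1 z.
set c := cos (k * d o y) in cy *; set c' := cos (k * d o (base z)) in cz *.
move=> zP.
have cc : `|c' - c| <= k * d (base z) y.
  apply: le_trans (cos_lipschitz _ _) _.
  rewrite -mulrBr normrM (gtr0_norm k0) ler_pM2l// ler_norml.
  have := metric_triangle o (base z) y; have := metric_triangle o y (base z).
  by rewrite (metric_sym y); lra.
pose q := Num.max (radius z) c^-1.
have qP : 1 <= q * c.
  by rewrite -(mulVf (x := c)) ?ler_pM2r ?le_max ?lexx ?orbT//; lra.
have zq : radius z <= q by rewrite le_max lexx.
pose w : cone := Cone H qP; exists w => //.
have D0 := kdist_ge0 H (base z) y.
have qz : q - radius z <= h^-1 * radius z * (k * d (base z) y).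
  have P0 : 0 <= h^-1 * radius z * (k * d (base z) y).
    by apply: mulr_ge0 => //; apply: mulr_ge0; rewrite ?invr_ge0 ltW// radius_gt0.
  rewrite /q; case: (leP (radius z) c^-1) => zc; last by rewrite subrr.
  have c0 : 0 < c by lra.
  have -> : c^-1 - radius z = c^-1 * (1 - radius z * c) by field; rewrite gt_eqF.
  have -> : h^-1 * radius z * (k * d (base z) y) = h^-1 * (radius z * (k * d (base z) y)) by ring.
  have rc : radius z * c <= 1.
    by rewrite -(mulVf (x := c)) ?ler_pM2r ?gt_eqF.
  apply: ler_pM; rewrite ?invr_ge0 ?subr_ge0 ?lef_pV2//; first lra.
  move: cc; rewrite ler_norml => /andP[_ cc].
  have := ler_wpM2l (ltW (radius_gt0 z)) cc; rewrite mulrBr; lra.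
have qh : q <= h^-1 * radius z.
  rewrite /q ge_max; apply/andP; split.
    by rewrite ler_peMl ?invf_ge1// ltW// radius_gt0.
  have c0 : 0 < c by lra.
  by rewrite -[leLHS]mulr1 ler_pM ?invr_ge0 ?lef_pV2// ltW.
have := @cone_dist_le _ _ _ _ H z w (h^-1 * radius z) (le_trans zq qh) qh.
rewrite /= distrC ger0_norm ?subr_ge0// => /le_trans; apply.
move: qz; set A := h^-1 * radius z; have -> : 2 / h * radius z = 2 * A by rewrite /A; ring.
lra.
Qed.

Context (G : X -> X -> R -> X).
Hypothesis GP : forall x y, [/\ geodesic01 (G x y), G x y 0 = x & G x y 1 = y].

Lemma lifts_exist : exists (seg : cone -> cone -> R -> cone) (f : cone -> cone -> R -> R),
  forall z w, is_lift (G (base z) (base w)) z w (seg z w) (f z w).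
Proof.
suff /choice[S HS] : forall zw : cone * cone, exists S : (R -> cone) * (R -> R),
    is_lift (G (base zw.1) (base zw.2)) zw.1 zw.2 S.1 S.2.
  by exists (fun z w => (S (z, w)).1), (fun z w => (S (z, w)).2) => z w; have := HS (z, w).
move=> [z w]; have [gg g0 g1] := GP (base z) (base w).
have [F [f Ff]] := lift_exists gg g0 g1 (origin_cmp gg).
by exists (F, f).
Qed.

Context (seg : cone -> cone -> R -> cone) (f : cone -> cone -> R -> R).
Hypothesis segP : forall z w, is_lift (G (base z) (base w)) z w (seg z w) (f z w).

Definition cone_core : set cone := [set z | Delta (base z)].

Lemma cone_seg0 z w : seg z w 0 = z.
Proof. by have [gg g0 g1] := GP (base z) (base w); exact: (lift0 gg g0 g1 (segP z w)). Qed.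

Lemma cone_seg1 z w : seg z w 1 = w.
Proof. by have [gg g0 g1] := GP (base z) (base w); exact: (lift1 gg g0 g1 (segP z w)). Qed.

Lemma cone_segd z w s t : 0 <= s <= 1 -> 0 <= t <= 1 ->
  d (seg z w s) (seg z w t) = `|s - t| * d z w.
Proof. by have [gg g0 g1] := GP (base z) (base w); exact: (lift_dist gg g0 g1 (segP z w)). Qed.

Lemma cone_core_closed z : (forall e : R, 0 < e -> exists2 c, cone_core c & d z c < e) ->
  cone_core z.
Proof.
move=> h; apply: (closed_approx Delta_closed) => e e0; have k0 := k_gt0 H.
have [|c Dc zc] := h (k * e / 4) _; first by rewrite !mulr_gt0.
by exists (base c) => //; rewrite -(ltr_pM2l k0); have := base_dist z c; lra.
Qed.

Lemma cone_core_convex a b t : cone_core a -> cone_core b -> 0 <= t <= 1 ->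
  cone_core (seg a b t).
Proof.
move=> Da Db t01; have [gg g0 g1] := GP (base a) (base b).
have [f01 + _ _] := segP a b t01; rewrite /cone_core/= => ->.
by have [_ h] := Delta_convex Da Db; apply: (h 0 1) => //; apply/geodesic01P.
Qed.

(** Two sides issuing from a point have total length less than [2 * pi - 8 * e],
    as the space lies inside a smaller hemisphere. *)
Lemma small_perimeter : exists2 e : R, 0 < e & forall x y w : X, k * d y w < 4 * e ->
  k * d x y + k * d x w + k * d y w < 2 * pi.
Proof.
have [k0 [r kr Hr]] := H; exists ((2 * pi - 4 * (k * r)) / 8); first by lra.
have B (x y : X) : k * d x y < 2 * (k * r).
  apply: le_lt_trans (_ : k * (d x o + d o y) < _).
    by rewrite ler_pM2l// metric_triangle.
  have := Hr x; have := Hr y; rewrite (metric_sym o y) mulrDr.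
  by rewrite -(ltr_pM2l k0) => hy; rewrite -(ltr_pM2l k0); lra.
by move=> x y w; have := B x y; have := B x w; lra.
Qed.

Lemma cone_cn_vertex_small : exists2 e : R, 0 < e & forall c a b s u t, cone_core c ->
  0 <= s <= 1 -> 0 <= u <= 1 -> s <= u -> 0 <= t <= 1 ->
  d (seg a b s) (seg a b u) < e ->
  cn_ineq c (seg a b s) (seg a b u) (seg a b ((1 - t) * s + t * u)) t.
Proof.
have [e e0 He] := small_perimeter; exists e => // c a b s u t Dc s01 u01 su t01 dsu.
have [gg g0 g1] := GP (base a) (base b).
apply: (lift_cn gg g0 g1 (segP a b)) => //.
have [fs01 Es _ _] := segP a b s01; have [fu01 Eu _ _] := segP a b u01.
apply: core_triangle_cmp; first exact: sub_geodesic01.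
  by left.
rewrite !subr0 !subrr !mul1r !mul0r !addr0 !add0r -Es -Eu; apply: He.
by have := base_dist (seg a b s) (seg a b u); lra.
Qed.

Lemma cone_cn_side_small : exists2 e : R, 0 < e & forall c p b s t, cone_core c ->
  d p b < e -> 0 <= s <= 1 -> 0 <= t <= 1 -> cn_ineq (seg c p s) c b (seg c b t) t.
Proof.
have [e e0 He] := small_perimeter; exists e => // c p b s t Dc dpb s01 t01.
have [gg g0 g1] := GP (base c) (base b).
have z01 : 0 <= (0 : R) <= 1 by rewrite lexx ler01.
have o01 : 0 <= (1 : R) <= 1 by rewrite lexx ler01.
have [f001 E0 _ _] := segP c b z01; have [f101 E1 _ _] := segP c b o01.
have := @lift_cn _ _ _ _ H _ _ _ _ _ gg g0 g1 (segP c b) (seg c p s) 0 1 t z01 o01 ler01 t01.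
rewrite !cone_seg0 !cone_seg1 !mulr0 !add0r mulr1; apply.
apply: core_triangle_cmp; first exact: sub_geodesic01.
  by right; rewrite subr0 mul1r mul0r addr0 -E0 cone_seg0.
rewrite !subr0 !subrr !mul1r !mul0r !addr0 !add0r -E0 -E1 cone_seg0 cone_seg1.
have [fs01 -> _ _] := segP c p s01; have [hh h0 h1] := GP (base c) (base p).
have Ec : d (G (base c) (base p) (f c p s)) (base c) = f c p s * d (base c) (base p).
  by rewrite -{2}h0 hh// h0 h1 subr0 ger0_norm//; case/andP: fs01.
have Ep : d (base p) (G (base c) (base p) (f c p s)) = (1 - f c p s) * d (base c) (base p).
  by rewrite -{1}h1 hh// h0 h1 ger0_norm// subr_ge0; case/andP: fs01.
have h := metric_triangle (G (base c) (base p) (f c p s)) (base p) (base b).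
have {}h : d (G (base c) (base p) (f c p s)) (base b) <=
    (1 - f c p s) * d (base c) (base p) + d (base p) (base b).
  by rewrite -Ep (metric_sym (base p) (G _ _ _)).
have := ler_wpM2l (ltW (k_gt0 H)) h; rewrite Ec.
have := He (base c) (base p) (base b); have := base_dist p b.
move=> h1' h2; have {}h2 := h2 ltac:(lra).
by move: h2; rewrite mulrDr; lra.
Qed.

(** The cone point over a point of [Delta] at distance nearly [d(x, Delta)] from
    the base point [x] of [z] bounds [r]; dividing by the radius of [z], the base
    points of the ball are within a small multiple of [d(x, Delta)] of [x]. *)
Lemma cone_cn_ball : exists2 lam : R, 0 < lam & forall z (r : R),
  (forall c, cone_core c -> r <= lam * d z c) ->
  forall p a b t, d z p <= r -> d z a <= r -> d z b <= r -> 0 <= t <= 1 ->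
  cn_ineq p a b (seg a b t) t.
Proof.
have [C C0 HC] := cone_point_over; have [lambda lambda0 HB] := balls_off_Delta.
have k0 := k_gt0 H.
pose eta := Num.min (lambda / 3) (1 / 3).
have eta0 : 0 < eta by rewrite /eta lt_min !divr_gt0.
have eta1 : eta <= 1 / 3 by rewrite /eta ge_min lexx orbT.
have eta2 : 3 * eta <= lambda.
  have : eta <= lambda / 3 by rewrite /eta ge_min lexx.
  lra.
(* [6] bounds the square root of the constant [32] in the proof of [near] below *)
exists (eta / (6 * C)) => [|z r Hr p a b t zp za zb t01]; first by rewrite divr_gt0// mulr_gt0.
have [Dz|nDz] := pselect (Delta (base z)).
  have r0 : r <= 0 by have := Hr z Dz; rewrite mdistxx mulr0.
  have E q : d z q <= r -> q = z.
    by move=> zq; apply/esym/mdist_positivity; have := mdist_ge0 z q; lra.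
  rewrite (E p zp) (E a za) (E b zb) /cn_ineq !mdistxx.
  rewrite -{1}(cone_seg0 z z) cone_segd ?lexx ?ler01// mdistxx mulr0 expr0n/=.
  by rewrite !mulr0 !addr0 subr0.
have [_ catB] := HB (base z) nDz.
set m := mdist_set (base z) Delta in catB.
have m0 : 0 <= m.
  by apply: lb_le_inf; [exists (d (base z) o), o|move=> _ [y _ <-]; exact: mdist_ge0].
have mo : m <= d (base z) o.
  by apply: ge_inf; [exists 0 => _ [y _ <-]; exact: mdist_ge0|exists o].
have km : k * m < pi / 2.
  have /andP[_] := kdist_o H (base z); apply: le_lt_trans.
  by rewrite ler_pM2l// metric_sym.
have rz := radius_gt0 z.
have rm : r <= eta / 6 * radius z * (k * m).
  have c0 : 0 < eta / 6 * radius z * k by rewrite !mulr_gt0//; lra.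
  rewrite mulrA -ler_pdivrMl//; apply: lb_le_inf; first by exists (d (base z) o), o.
  move=> _ [y Dy <-]; rewrite ler_pdivrMl//.
  have [w wy zw] := HC z y; have Dw : cone_core w by rewrite /cone_core/= wy.
  apply: le_trans (Hr w Dw) _.
  have e60 : 0 <= eta / (6 * C) by rewrite divr_ge0 ?mulr_ge0 ?ltW.
  apply: le_trans (ler_wpM2l e60 zw) _; rewrite le_eqVlt; apply/orP; left; apply/eqP.
  by field; rewrite gt_eqF.
have near q : d z q <= r -> d (base z) (base q) <= eta * m.
  move=> zq; rewrite -(ler_pM2l k0).
  have p4 : pi < 4 :> R := pi_lt4; have km0 : 0 <= k * m by rewrite mulr_ge0// ltW.
  have r2 : r <= radius z / 2.
    have : eta / 6 * (k * m) <= 1 / 2 by nra.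
    move=> /(ler_wpM2l (ltW rz)); lra.
  have := radius_dist z q; rewrite ler_norml => /andP[_ rq].
  have := base_dist_radius z q; have := kdist_ge0 H (base z) (base q).
  have zq0 := mdist_ge0 z q.
  move: (k * d _ _) => x x0 h.
  have rqz : radius z / 2 <= radius q by lra.
  have h1 : radius z ^+ 2 * x ^+ 2 <= 32 * r ^+ 2.
    have : radius z * (radius z / 2) * x ^+ 2 <= radius z * radius q * x ^+ 2.
      by rewrite ler_wpM2r ?sqr_ge0// ler_pM2l.
    have : d z q ^+ 2 <= r ^+ 2 by rewrite ler_sqr ?nnegrE//; lra.
    rewrite expr2; lra.
  have h2 : radius z * x <= 6 * r.
    apply: le_of_sqr; first lra.
    by rewrite exprMn; apply: le_trans h1 _; rewrite exprMn; have := sqr_ge0 r; lra.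
  by rewrite -(ler_pM2l rz); lra.
have ep : 0 <= eta * m by rewrite mulr_ge0// ltW.
have [gg g0 g1] := GP (base a) (base b).
have z01 : 0 <= (0 : R) <= 1 by rewrite lexx ler01.
have o01 : 0 <= (1 : R) <= 1 by rewrite lexx ler01.
have [f001 E0 _ _] := segP a b z01; have [f101 E1 _ _] := segP a b o01.
have := @lift_cn _ _ _ _ H _ _ _ _ _ gg g0 g1 (segP a b) p 0 1 t z01 o01 ler01 t01.
rewrite !cone_seg0 !cone_seg1 !mulr0 !add0r mulr1; apply.
apply: (@ball_triangle_cmp (base z) (base p) _ (lambda * m) (eta * m)) => //.
- by rewrite mulrA ler_wpM2r.
- rewrite mulrCA; apply: (@le_lt_trans _ _ (1 / 3 * (k * m))).
    by rewrite ler_wpM2r// mulr_ge0// ltW.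
  by move: km; move: (k * m) => y km; have := pi_gt0 R; lra.
- exact: sub_geodesic01.
- exact: near.
- by rewrite subr0 mul1r mul0r addr0 -E0 cone_seg0; exact: near.
- by rewrite subrr mul1r mul0r add0r -E1 cone_seg1; exact: near.
Qed.

Lemma cone_locally_relative_cat0 : complete_metric X ->
  locally_relative_cat0 cone_core seg.
Proof.
move=> Xc; split.
- exact: cone_seg0.
- exact: cone_seg1.
- by move=> a b s t s01 t01; exact: cone_segd.
- have oP : 1 <= 1 * cos (k * d o o) by rewrite mdistxx mulr0 cos0 mulr1.
  by exists (Cone H oP).
- exact: cone_core_closed.
- by move=> a b t; exact: cone_core_convex.
- exact: cone_complete.
- exact: cone_cn_vertex_small.
- exact: cone_cn_side_small.
- exact: cone_cn_ball.
Qed.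

End cone_over_relative_cat.

(** * Orders of vanishing *)

Section small_order.
Context {R : realType}.
Implicit Types (phi psi : R -> R) (u : R) (n m : nat).

Definition small_order n phi : Prop :=
  exists K : R, \forall u \near 0^'+, `|phi u| <= K * u ^+ n.

Lemma small_order_le n phi psi : (\forall u \near 0^'+, `|phi u| <= psi u) ->
  small_order n psi -> small_order n phi.
Proof.
move=> h [K HK]; exists K; near=> u.
have h1 : `|phi u| <= psi u by near: u.
have h2 : `|psi u| <= K * u ^+ n by near: u.
by apply: le_trans h1 _; apply: le_trans (ler_norm _) h2.
Unshelve. all: by end_near. Qed.

Lemma small_order_eq n phi psi : (\forall u \near 0^'+, phi u = psi u) ->
  small_order n psi -> small_order n phi.
Proof.
move=> h [K HK]; exists K; near=> u.
have -> : phi u = psi u by near: u.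
by near: u.
Unshelve. all: by end_near. Qed.

Lemma small_orderD n phi psi : small_order n phi -> small_order n psi ->
  small_order n (fun u => phi u + psi u).
Proof.
move=> [K HK] [L HL]; exists (K + L); near=> u.
have h1 : `|phi u| <= K * u ^+ n by near: u.
have h2 : `|psi u| <= L * u ^+ n by near: u.
by rewrite mulrDl; apply: le_trans (ler_normD _ _) _; exact: lerD.
Unshelve. all: by end_near. Qed.

Lemma small_orderN n phi : small_order n phi -> small_order n (fun u => - phi u).
Proof. by move=> [K HK]; exists K; near=> u; rewrite normrN; near: u. Unshelve. all: by end_near. Qed.

Lemma small_orderM n m phi psi : small_order n phi -> small_order m psi ->
  small_order (n + m) (fun u => phi u * psi u).
Proof.
move=> [K HK] [L HL]; exists (K * L); near=> u.
have h1 : `|phi u| <= K * u ^+ n by near: u.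
have h2 : `|psi u| <= L * u ^+ m by near: u.
by rewrite normrM exprD mulrACA ler_pM.
Unshelve. all: by end_near. Qed.

Lemma small_order_expr n : small_order n (fun u => u ^+ n).
Proof.
exists 1; near=> u; rewrite mul1r ger0_norm// exprn_ge0// ltW//.
Unshelve. all: by end_near. Qed.

Lemma small_order_cst (c : R) : small_order 0 (fun=> c).
Proof. by exists `|c|; apply: nearW => u; rewrite expr0 mulr1. Qed.

Lemma small_orderZ n (c : R) phi : small_order n phi -> small_order n (fun u => c * phi u).
Proof. exact: (small_orderM (small_order_cst c)). Qed.

Lemma small_orderW n m phi : (m <= n)%N -> small_order n phi -> small_order m phi.
Proof.
move=> mn [K HK]; exists `|K|; near=> u.
have h1 : `|phi u| <= K * u ^+ n by near: u.
have u0 : 0 < u by near: u; exact: nbhs_right_gt.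
have u1 : u <= 1 by near: u; exact: nbhs_right_le.
apply: le_trans h1 _; apply: le_trans (_ : `|K| * u ^+ n <= _).
  by rewrite ler_wpM2r ?ler_norm// exprn_ge0// ltW.
rewrite ler_wpM2l// -(subnK mn) exprD ler_piMl ?exprn_ge0 ?exprn_ile1//; exact: ltW.
Unshelve. all: by end_near. Qed.

Lemma small_order_near n phi (e : R) : small_order n.+1 phi -> 0 < e ->
  \forall u \near 0^'+, `|phi u| <= e * u ^+ n.
Proof.
move=> [K HK] e0; near=> u.
have h1 : `|phi u| <= K * u ^+ n.+1 by near: u.
have u0 : 0 < u by near: u; exact: nbhs_right_gt.
have ue : u <= e / (`|K| + 1).
  by near: u; apply: nbhs_right_le; rewrite divr_gt0// ltr_wpDl.
apply: le_trans h1 _; rewrite exprSr mulrA mulrAC ler_wpM2r ?exprn_ge0 ?(ltW u0)//.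
move: ue; rewrite ler_pdivlMr ?ltr_wpDl// => ue.
have := ler_norm K; have := normr_ge0 K; move: ue; move: (`|K|) => L; nra.
Unshelve. all: by end_near. Qed.

Lemma near_powers (P : R -> Prop) (th : R) : 0 < th < 1 ->
  (\forall u \near 0^'+, P u) -> exists I : nat, forall i, (I <= i)%N -> P (th ^+ i).
Proof.
move=> /andP[th0 th1] /nbhs_ballP[e /= e0 eP].
have cv : th ^+ n @[n --> \oo] --> (0 : R) by apply: cvg_expr; rewrite gtr0_norm.
have [I _ HI] := cv _ (nbhsx_ballx _ e e0).
by exists I => i Ii; apply: eP; [exact: HI|exact: exprn_gt0].
Qed.

End small_order.

(** * Distances of tangent vectors *)

Section tangent_vectors.
Context {R : realType} {X : metricType R} (x : X).
Local Notation d := mdist.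
Implicit Types (g h : geodesic_from x) (b u : R).

Lemma geodesic_elimsup_le g h b : (\forall u \near 0^'+, d (g u) (h u) <= b * u) ->
  (geodesic_elimsup g h <= b%:E)%E.
Proof.
move=> gh; apply: ge_ereal_inf.
exists (ereal_sup ((fun u : R => (d (g u) (h u) / u)%:E) @`
    [set u | 0 < u /\ d (g u) (h u) <= b * u])).
  exists [set u | 0 < u /\ d (g u) (h u) <= b * u] => //.
  by near=> u; split => //; near: u.
by apply: ge_ereal_sup => _ [u /= [u0 ub] <-]; rewrite lee_fin ler_pdivrMr.
Unshelve. all: by end_near. Qed.

Lemma geodesic_limsup_le g h b : (\forall u \near 0^'+, d (g u) (h u) <= b * u) ->
  geodesic_limsup g h <= b.
Proof.
move=> gh; have b0 : 0 <= b.
  near (0 : R)^'+ => u; have u0 : 0 < u by [].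
  have : d (g u) (h u) <= b * u by near: u.
  by move=> /(le_trans (mdist_ge0 _ _)); rewrite pmulr_lge0.
have := geodesic_elimsup_le gh; rewrite /geodesic_limsup.
by case: geodesic_elimsup => [r| |]//=; rewrite lee_fin.
Unshelve. all: by end_near. Qed.

Lemma geodesic_from_lipschitz g : exists2 s : R, 0 <= s &
  \forall u \near 0^'+, d (g u) x = s * u.
Proof.
have [e e0 [_ [s s0 gs]]] := gfunP g; exists s => //; near=> u.
have u0 : 0 < u by [].
have ue : u <= e by near: u; exact: nbhs_right_le.
have : d (g u) (g 0) = s * u.
  by rewrite gs ?in_itv/= ?lexx ?(ltW e0) ?(ltW u0)// subr0 gtr0_norm.
by rewrite gfun0.
Unshelve. all: by end_near. Qed.

Lemma geodesic_limsup_near g h b : geodesic_limsup g h < b ->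
  \forall u \near 0^'+, d (g u) (h u) <= b * u.
Proof.
have [[s s0 gs] [t t0 ht]] := (geodesic_from_lipschitz g, geodesic_from_lipschitz h).
have fin : (geodesic_elimsup g h <= (s + t)%:E)%E.
  apply: geodesic_elimsup_le; near=> u.
  apply: le_trans (metric_triangle _ x _) _; rewrite (metric_sym x) mulrDl.
  have -> : d (g u) x = s * u by near: u.
  by have -> : d (h u) x = t * u by near: u.
move=> gb; have : (geodesic_elimsup g h < b%:E)%E.
  by move: gb fin; rewrite /geodesic_limsup; case: geodesic_elimsup => [r| |]//=; rewrite ?lte_fin ?ltNyr.
move=> /ereal_inf_lt[_ [V FV <-] Vb]; near=> u.
have u0 : 0 < u by [].
rewrite -ler_pdivrMr// -lee_fin; apply: le_trans (ltW Vb); apply: ereal_sup_ubound.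
by exists u => //; near: u.
Unshelve. all: by end_near. Qed.

Definition tangent_vector (g : {classic geodesic_from x}) : tangent_space x :=
  \pi_(tangent_space x)%qT (\pi_(geodesic_germ x)%qT g).

Lemma tangent_vector_dist (g h : {classic geodesic_from x}) :
  d (tangent_vector g) (tangent_vector h) = geodesic_limsup g h.
Proof.
rewrite /tangent_vector mdist_pi /= /germ_dist.
by apply: geodesic_limsup_germ; rewrite reprK.
Qed.

End tangent_vectors.

(** * First-order behaviour at a point of the core *)

Section first_order.
Context {R : realType} {X : metricType R} (k : R) (o : X).
Context (H : in_open_hemisphere k o).
Local Notation d := mdist.
Local Notation cone := (cone_over H).
Implicit Types (z w p : cone) (a b u t : R).

Lemma near_right_scale a : 0 <= a -> \forall u \near 0^'+, 0 <= a * u <= 1.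
Proof.
move=> a0; near=> u; have u0 : 0 < u by [].
rewrite mulr_ge0 ?(ltW u0)//=.
have : u <= (1 + a)^-1 by near: u; apply: nbhs_right_le; rewrite invr_gt0 ltr_wpDr.
by rewrite -[_^-1]mul1r ler_pdivlMr ?ltr_wpDr//; nra.
Unshelve. all: by end_near. Qed.

Context (G : X -> X -> R -> X).
Hypothesis GP : forall x y, [/\ geodesic01 (G x y), G x y 0 = x & G x y 1 = y].
Context (seg : cone -> cone -> R -> cone) (f : cone -> cone -> R -> R).
Hypothesis segP : forall z w, is_lift (G (base z) (base w)) z w (seg z w) (f z w).

Section directions.
Context (c : cone).
Let ell z := k * d (base c) (base z).

(** The components of the direction from [c] to [z]: tangent to [X], as a
    multiple of [radius c / k], and radial. *)
Definition angular_speed z := radius z * sin (k * d (base c) (base z)) / radius c.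
Definition radial_speed z := radius z * cos (k * d (base c) (base z)) - radius c.

Let rho z := angular_speed z / ell z.

Lemma angular_speed_ge0 z : 0 <= angular_speed z.
Proof.
apply: divr_ge0; last exact/ltW/radius_gt0.
apply: mulr_ge0; first exact/ltW/radius_gt0.
by rewrite sin_ge0_pi// (kdist_itv H).
Qed.

Let rho_ge0 z : 0 <= rho z.
Proof. by rewrite divr_ge0 ?angular_speed_ge0// /ell (kdist_ge0 H). Qed.

Let rho_ell z : rho z * ell z = angular_speed z.
Proof.
rewrite /rho; have [l0|l0] := eqVneq (ell z) 0; last by rewrite divfK.
by rewrite l0 mulr0 /angular_speed -/(ell z) l0 sin0 mulr0 mul0r.
Qed.

(** The absolute value makes this a geodesic for every [a]. The quotient is [0] when
    [base c = base z], in which case the path is constant. *)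
Definition ray_path z a u : X := G (base c) (base z) (`|a| * u * (angular_speed z / ell z)).

Lemma ray_path0 z a : ray_path z a 0 = base c.
Proof. by have [_ g0 _] := GP (base c) (base z); rewrite /ray_path mulr0 mul0r. Qed.

Lemma ray_path_geodesic z a : exists2 e : R, 0 < e & is_geodesic 0 e (ray_path z a).
Proof.
have [gg g0 g1] := GP (base c) (base z).
have ar0 : 0 <= `|a| * rho z by rewrite mulr_ge0.
have e0 : 0 < (1 + `|a| * rho z)^-1 by rewrite invr_gt0 ltr_wpDr.
exists (1 + `|a| * rho z)^-1 => //; split; first exact: ltW.
exists (`|a| * rho z * d (base c) (base z)); first by rewrite mulr_ge0 ?mdist_ge0.
have itv t : t \in `[0, (1 + `|a| * rho z)^-1] -> 0 <= `|a| * t * rho z <= 1.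
  rewrite in_itv/= => /andP[t0]; rewrite -[_^-1]mul1r ler_pdivlMr ?ltr_wpDr//.
  move=> t1; have -> : `|a| * t * rho z = `|a| * rho z * t by ring.
  by apply/andP; split; [exact: mulr_ge0|lra].
move=> t u /itv t01 /itv u01; rewrite /ray_path -/(rho z) gg// g0 g1.
have -> : `|a| * t * rho z - `|a| * u * rho z = `|a| * rho z * (t - u) by ring.
by rewrite normrM (ger0_norm ar0) mulrAC.
Qed.

Definition ray z a : geodesic_from (base c) := GeodesicFrom (ray_path0 z a) (ray_path_geodesic z a).

Let angle_le z t : 0 <= t <= 1 -> k * d (base c) (base (seg c z t)) <= 4 * (t * d c z).
Proof.
move=> t01; apply: le_trans (base_dist _ _) _; rewrite ler_pM2l//.
have [gg g0 g1] := GP (base c) (base z).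
have h := lift_dist gg g0 g1 (segP c z) (s := 0) (t := t).
rewrite -{1}(lift0 gg g0 g1 (segP c z)) h ?lexx ?ler01// sub0r normrN ger0_norm//.
by case/andP: t01.
Qed.

Let radius_le z t : 0 <= t <= 1 -> `|radius (seg c z t) - radius c| <= t * d c z.
Proof.
move=> t01; apply: le_trans (radius_dist _ _) _.
have [gg g0 g1] := GP (base c) (base z).
have h := lift_dist gg g0 g1 (segP c z) (s := t) (t := 0).
rewrite -{2}(lift0 gg g0 g1 (segP c z)) h ?lexx ?ler01// subr0 ger0_norm//.
by case/andP: t01.
Qed.

Let angleE z t : 0 <= t <= 1 -> k * d (base c) (base (seg c z t)) = f c z t * ell z.
Proof.
move=> t01; have [gg g0 g1] := GP (base c) (base z).
have [ft01 -> _ _] := segP c z t01; rewrite -{1}g0 gg ?lexx ?ler01// sub0r normrN.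
by rewrite g0 g1 ger0_norm; [rewrite mulrCA|case/andP: ft01].
Qed.

Lemma seg_radius_first_order z a : 0 <= a ->
  small_order 2 (fun u => radius (seg c z (a * u)) - radius c - u * (a * radial_speed z)).
Proof.
move=> a0; pose L := d c z; have L0 : 0 <= L := mdist_ge0 _ _.
pose K := (radius c + L) * (4 * (a * L)) ^+ 2 / 2.
apply: (@small_order_le _ _ _ (fun u => K * u ^+ 2)); last first.
  by apply: small_orderZ; exact: small_order_expr.
near=> u; have t01 : 0 <= a * u <= 1 by near: u; exact: near_right_scale.
have [_ _ hc _] := segP c z t01; have := angleE z t01; have := angle_le z t01.
have := radius_le z t01; have := radius_gt0 (seg c z (a * u)).
have := kdist_ge0 H (base c) (base (seg c z (a * u))).
rewrite -/L; move: hc; rewrite -/(ell z).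
move: (radius (seg _ _ _)) => n hc phi0 n0; rewrite ler_norml => /andP[_ nL].
have cle := cos_le1 (f c z (a * u) * ell z); have cge := cos_ge (f c z (a * u) * ell z).
move=> + E; rewrite E => phiL; rewrite E in phi0.
have -> : n - radius c - u * (a * radial_speed z) =
    n * (1 - cos (f c z (a * u) * ell z)).
  transitivity (n - n * cos (f c z (a * u) * ell z)); last by ring.
  by rewrite hc /radial_speed -/(ell z); ring.
rewrite ger0_norm; last by rewrite mulr_ge0 ?(ltW n0)//; lra.
have nle : n <= radius c + L.
  have : a * u * L <= 1 * L by rewrite ler_wpM2r//; lra.
  by lra.
have -> : K * u ^+ 2 = (radius c + L) * ((4 * (a * u * L)) ^+ 2 / 2) by rewrite /K; field.
move: (f c z _ * ell z) cle cge phiL phi0 => phi cle cge phiL phi0.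
apply: ler_pM; [exact: ltW|lra|by []|].
have : phi ^+ 2 <= (4 * (a * u * L)) ^+ 2 by rewrite ler_sqr ?nnegrE//; lra.
lra.
Unshelve. all: by end_near. Qed.

Lemma seg_base_first_order z a : 0 <= a ->
  small_order 2 (fun u => k * d (base (seg c z (a * u))) (ray z a u)).
Proof.
move=> a0; pose L := d c z; have L0 : 0 <= L := mdist_ge0 _ _.
pose v := angular_speed z; have v0 : 0 <= v := angular_speed_ge0 z.
apply: (@small_order_le _ _ _ (fun u => (4 * (a * L)) ^+ 3 / 6 * u ^+ 3 + a ^+ 2 * v * L * u ^+ 2)); last first.
  apply: small_orderD; last by apply: small_orderZ; exact: small_order_expr.
  by apply: small_orderW (_ : small_order 3 _) => //; apply: small_orderZ; exact: small_order_expr.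
near=> u; have t01 : 0 <= a * u <= 1 by near: u; exact: near_right_scale.
have r01 : 0 <= a * rho z * u <= 1 by near: u; apply: near_right_scale; exact: mulr_ge0.
rewrite ger0_norm ?(kdist_ge0 H)//.
have [gg g0 g1] := GP (base c) (base z).
have [ft01 Eb _ hs] := segP c z t01; have := angleE z t01; have := angle_le z t01.
have := radius_le z t01; have := radius_ge1 (seg c z (a * u)).
have := kdist_ge0 H (base c) (base (seg c z (a * u))).
have -> : k * d (base (seg c z (a * u))) (ray z a u) =
    `|f c z (a * u) * ell z - a * u * v|.
  rewrite Eb /= /ray_path (ger0_norm a0) -/(rho z) gg//; last by rewrite mulrAC.
  have -> : f c z (a * u) * ell z - a * u * v =
      (f c z (a * u) - a * u * rho z) * ell z by rewrite /v -rho_ell; ring.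
  by rewrite g0 g1 normrM (ger0_norm (x := ell z)) ?(kdist_ge0 H)// /ell; ring.
rewrite -/L; move: hs; rewrite -/(ell z).
move: (radius (seg _ _ _)) => n hs phi0 n1 nL + E; rewrite E => phiL; rewrite E in phi0.
have rc := radius_gt0 c.
have E2 : n * (sin (f c z (a * u) * ell z) - a * u * v) = a * u * v * (radius c - n).
  transitivity (n * sin (f c z (a * u) * ell z) - n * (a * u * v)); first by ring.
  by rewrite hs /v /angular_speed -/(ell z); field; rewrite gt_eqF.
move: (f c z _ * ell z) phiL phi0 E2 => phi phiL phi0 E2.
have s1 := sin_le phi0; have s3 := sin_ge_cubic phi0.
have p3 : phi ^+ 3 <= (4 * (a * u * L)) ^+ 3 by rewrite lerXn2r ?nnegrE//; lra.
have h1 : `|phi - sin phi| <= (4 * (a * L)) ^+ 3 / 6 * u ^+ 3.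
  rewrite ger0_norm ?subr_ge0//.
  have -> : (4 * (a * L)) ^+ 3 / 6 * u ^+ 3 = (4 * (a * u * L)) ^+ 3 / 6 by field.
  lra.
have h2 : `|sin phi - a * u * v| <= a ^+ 2 * v * L * u ^+ 2.
  apply: (@le_trans _ _ (`|n * (sin phi - a * u * v)|)).
    by rewrite normrM ler_peMl// ger0_norm//; lra.
  have auv : 0 <= a * u * v by rewrite mulr_ge0//; lra.
  rewrite E2 normrM (ger0_norm auv) distrC.
  have -> : a ^+ 2 * v * L * u ^+ 2 = a * u * v * (a * u * L) by ring.
  exact: ler_wpM2l.
have -> : phi - a * u * v = (phi - sin phi) + (sin phi - a * u * v) by ring.
by apply: le_trans (ler_normD _ _) _; exact: lerD.
Unshelve. all: by end_near. Qed.


(** In polar coordinates at the apex the square of the distance is the sum of the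
    squares of the radial and of the angular difference, up to third order. *)
Lemma seg_dist_first_order z w a b : 0 <= a -> 0 <= b ->
  small_order 3 (fun u => d (seg c z (a * u)) (seg c w (b * u)) ^+ 2 -
    (u * (a * radial_speed z - b * radial_speed w)) ^+ 2 -
    (radius c * (k * d (ray z a u) (ray w b u))) ^+ 2).
Proof.
move=> a0 b0; pose r0 := radius c.
pose n u := radius (seg c z (a * u)); pose m u := radius (seg c w (b * u)).
pose D u := k * d (base (seg c z (a * u))) (base (seg c w (b * u))).
pose x u := k * d (ray z a u) (ray w b u).
pose s := a * radial_speed z; pose s' := b * radial_speed w.
have n2 : small_order 2 (fun u => n u - r0 - u * s) := seg_radius_first_order z a0.
have m2 : small_order 2 (fun u => m u - r0 - u * s') := seg_radius_first_order w b0.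
have id1 : small_order 1 (fun u : R => u ^+ 1) := small_order_expr 1.
have lin (y : R) : small_order 1 (fun u => u * y).
  by apply: small_order_eq (small_orderZ y id1); apply: nearW => u; rewrite expr1 mulrC.
have n1 : small_order 1 (fun u => n u - r0).
  apply: small_order_eq (small_orderD (small_orderW (isT : (1 <= 2)%N) n2) (lin s)).
  by apply: nearW => u; ring.
have m1 : small_order 1 (fun u => m u - r0).
  apply: small_order_eq (small_orderD (small_orderW (isT : (1 <= 2)%N) m2) (lin s')).
  by apply: nearW => u; ring.
have m0 : small_order 0 m.
  apply: small_order_eq (small_orderD (small_orderW (isT : (0 <= 1)%N) m1) (small_order_cst r0)).
  by apply: nearW => u; ring.
have n0 : small_order 0 n.
  apply: small_order_eq (small_orderD (small_orderW (isT : (0 <= 1)%N) n1) (small_order_cst r0)).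
  by apply: nearW => u; ring.
have Dx2 : small_order 2 (fun u => D u - x u).
  apply: small_order_le (small_orderD (seg_base_first_order z a0) (seg_base_first_order w b0)).
  apply: nearW => u; rewrite /D /x -mulrBr -mulrDr normrM (gtr0_norm (k_gt0 H)).
  rewrite ler_pM2l ?(k_gt0 H)//.
  set P := base _; set Q := base _; set p := (ray z a u : X); set q := (ray w b u : X).
  rewrite ler_norml; have := metric_triangle P p Q; have := metric_triangle p q Q.
  have := metric_triangle p P q; have := metric_triangle P Q q.
  by rewrite (metric_sym p P) (metric_sym q Q); lra.
have x1 : small_order 1 x.
  have [t t0 ht] := geodesic_from_lipschitz (ray z a).
  have [t' t'0 ht'] := geodesic_from_lipschitz (ray w b).
  apply: small_order_le (lin (k * (t + t'))); near=> u.
  rewrite ger0_norm ?(kdist_ge0 H)// /x mulrCA ler_pM2l ?(k_gt0 H)//.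
  apply: le_trans (metric_triangle _ (base c) _) _; rewrite (metric_sym (base c)) mulrDr.
  have -> : d (ray z a u) (base c) = t * u by near: u.
  have -> : d (ray w b u) (base c) = t' * u by near: u.
  by rewrite mulrC [t' * u]mulrC.
have D1 : small_order 1 D.
  apply: small_order_eq (small_orderD (small_orderW (isT : (1 <= 2)%N) Dx2) x1).
  by apply: nearW => u; ring.
have c3 : small_order 3 (fun u => 1 - cos (D u) - D u ^+ 2 / 2).
  have D4 := small_orderM (small_orderM D1 D1) (small_orderM D1 D1).
  apply: small_order_le (small_orderW (isT : (3 <= 4)%N) (small_orderZ (1 / 24) D4)).
  apply: nearW => u; have := cos_ge (D u); have := cos_le_quartic (D u).
  have -> : 1 / 24 * (D u * D u * (D u * D u)) = D u ^+ 4 / 24 by field.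
  by rewrite ler_norml; lra.
have e1 := small_orderD n2 (small_orderN m2).
have e2 := small_orderD (small_orderW (isT : (1 <= 2)%N) e1) (lin (2 * (s - s'))).
have T1 := small_orderM e1 e2.
have T2 := small_orderM (small_orderZ 2 (small_orderM n0 m0)) c3.
have nm := small_orderD (small_orderM n1 m0) (small_orderZ r0 m1).
have T3 := small_orderM nm (small_orderM D1 D1).
have T4 := small_orderZ (r0 ^+ 2) (small_orderM Dx2 (small_orderD D1 x1)).
apply: small_order_eq (small_orderD (small_orderD T1 T2) (small_orderD T3 T4)).
apply: nearW => u; rewrite cone_dist_split -/(D u) -/(x u) -/r0 -/(n u) -/(m u).
by rewrite -/s -/s' /=; field.
Unshelve. all: by end_near. Qed.

(** The squared distance in the tangent cone at [c], which is the product of the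
    tangent space of [X], scaled by [radius c * k], and the line, between [a] times
    the direction of [z] and [b] times the direction of [w]. *)
Definition direction_sqr z a w b : R :=
  (radius c * (k * d (tangent_vector (ray z a)) (tangent_vector (ray w b)))) ^+ 2 +
  (a * radial_speed z - b * radial_speed w) ^+ 2.

Lemma direction_sqr_le z w a b (q : R) : 0 <= a -> 0 <= b -> 0 <= q ->
  (\forall u \near 0^'+, d (seg c z (a * u)) (seg c w (b * u)) <= q * u) ->
  direction_sqr z a w b <= q ^+ 2.
Proof.
move=> a0 b0 q0 hq; apply/ler_addgt0Pl => e e0.
rewrite /direction_sqr tangent_vector_dist; set E := (_ - _) ^+ 2.
have rk : 0 < radius c * k by rewrite mulr_gt0 ?radius_gt0 ?(k_gt0 H).
set phi := (fun u => d (seg c z (a * u)) (seg c w (b * u)) ^+ 2 -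
    (u * (a * radial_speed z - b * radial_speed w)) ^+ 2 -
    (radius c * (k * d (ray z a u) (ray w b u))) ^+ 2).
have h3 : \forall u \near 0^'+, `|phi u| <= e * u ^+ 2 :=
  small_order_near (seg_dist_first_order z w a0 b0) e0.
have key : \forall u \near 0^'+,
    (radius c * (k * d (ray z a u) (ray w b u))) ^+ 2 <= (e + q ^+ 2 - E) * u ^+ 2.
  near=> u; have u0 : 0 < u by [].
  have h1 : d (seg c z (a * u)) (seg c w (b * u)) <= q * u by near: u.
  have h2 : d (seg c z (a * u)) (seg c w (b * u)) ^+ 2 <= (q * u) ^+ 2.
    by rewrite ler_sqr// nnegrE ?mdist_ge0// mulr_ge0// ltW.
  have : `|phi u| <= e * u ^+ 2 by near: u.
  rewrite /phi ler_norml => /andP[h4 _]; move: h2 h4; rewrite !(exprMn, mulrDl, mulNr) -/E.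
  rewrite (mulrC E); lra.
have qE : 0 <= e + q ^+ 2 - E.
  near (0 : R)^'+ => u; have u0 : 0 < u by [].
  have h1 : (radius c * (k * d (ray z a u) (ray w b u))) ^+ 2 <= (e + q ^+ 2 - E) * u ^+ 2.
    by near: u.
  by rewrite -(pmulr_lge0 _ (exprn_gt0 2 u0)); apply: le_trans h1; exact: sqr_ge0.
set M := e + q ^+ 2 - E in key qE.
have DM : geodesic_limsup (ray z a) (ray w b) <= Num.sqrt M / (radius c * k).
  apply: geodesic_limsup_le; near=> u; have u0 : 0 < u by [].
  have h1 : (radius c * (k * d (ray z a u) (ray w b u))) ^+ 2 <= M * u ^+ 2 by near: u.
  rewrite mulrAC ler_pdivlMr//; apply: le_of_sqr.
    by rewrite mulr_ge0 ?sqrtr_ge0 ?ltW.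
  rewrite [leRHS]exprMn sqr_sqrtr//; apply: le_trans h1; rewrite le_eqVlt; apply/orP; left.
  by apply/eqP; congr (_ ^+ 2); ring.
have D0 : 0 <= geodesic_limsup (ray z a) (ray w b).
  by rewrite -tangent_vector_dist mdist_ge0.
move: DM; rewrite ler_pdivlMr// => DM.
have : (radius c * (k * geodesic_limsup (ray z a) (ray w b))) ^+ 2 <= M.
  rewrite -(sqr_sqrtr qE) ler_sqr ?nnegrE ?sqrtr_ge0//.
    by apply: le_trans DM; rewrite mulrA mulrC.
  by rewrite mulrA mulr_ge0// ltW.
by rewrite /M; lra.
Unshelve. all: by end_near. Qed.

(** The strict inequality leaves room for the error terms, and for replacing the
    limit superior in the distance of tangent vectors by its bound near [0]. *)
Lemma direction_sqr_near z w a b (q : R) : 0 <= a -> 0 <= b -> 0 <= q ->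
  direction_sqr z a w b < q ^+ 2 ->
  \forall u \near 0^'+, d (seg c z (a * u)) (seg c w (b * u)) <= q * u.
Proof.
move=> a0 b0 q0; rewrite /direction_sqr tangent_vector_dist.
set s := a * radial_speed z - b * radial_speed w; set L := geodesic_limsup _ _ => hq.
have rk : 0 < radius c * k by rewrite mulr_gt0 ?radius_gt0 ?(k_gt0 H).
have L0 : 0 <= L by rewrite /L -tangent_vector_dist mdist_ge0.
have [M LM Mq] : exists2 M, (radius c * (k * L)) ^+ 2 < M & M + s ^+ 2 < q ^+ 2.
  by exists ((q ^+ 2 - s ^+ 2 + (radius c * (k * L)) ^+ 2) / 2); lra.
have M0 : 0 <= M by apply: le_trans (ltW LM); exact: sqr_ge0.
have LM' : L < Num.sqrt M / (radius c * k).
  rewrite ltr_pdivlMr// -ltr_sqr ?nnegrE ?sqrtr_ge0 ?sqr_sqrtr//.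
    by move: LM; congr (_ < _); congr (_ ^+ 2); ring.
  by rewrite mulr_ge0// ltW.
have h1 := geodesic_limsup_near LM'.
have e0 : 0 < q ^+ 2 - s ^+ 2 - M by lra.
set phi := (fun u => d (seg c z (a * u)) (seg c w (b * u)) ^+ 2 -
    (u * (a * radial_speed z - b * radial_speed w)) ^+ 2 -
    (radius c * (k * d (ray z a u) (ray w b u))) ^+ 2).
have h3 : \forall u \near 0^'+, `|phi u| <= (q ^+ 2 - s ^+ 2 - M) * u ^+ 2 :=
  small_order_near (seg_dist_first_order z w a0 b0) e0.
near=> u; have u0 : 0 < u by [].
have : `|phi u| <= (q ^+ 2 - s ^+ 2 - M) * u ^+ 2 by near: u.
have : d (ray z a u) (ray w b u) <= Num.sqrt M / (radius c * k) * u by near: u.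
rewrite mulrAC ler_pdivlMr// => h4.
have : (radius c * (k * d (ray z a u) (ray w b u))) ^+ 2 <= M * u ^+ 2.
  rewrite -(sqr_sqrtr M0) -exprMn ler_sqr ?nnegrE.
  - by apply: le_trans h4; rewrite mulrA mulrC.
  - by rewrite mulrA mulr_ge0// ?mdist_ge0// ltW.
  - by rewrite mulr_ge0 ?sqrtr_ge0// ltW.
rewrite /phi ler_norml -/s => h5 /andP[_ h6].
apply: le_of_sqr; first by rewrite mulr_ge0// ltW.
move: h5 h6; rewrite (exprMn _ u) (exprMn _ q); move: (_ ^+ 2) (_ ^+ 2) => y1 y2; lra.
Unshelve. all: by end_near. Qed.

End directions.
End first_order.

(** * Geodesics of a product with the line *)

Section flat_products.
Context {R : realType} {M : metricType R}.
Local Notation d := mdist.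

(** Locally [g] and [sigma] are the components of a geodesic of the product of [M]
    (scaled by [C]) with the line. At a midpoint equality holds in the triangle
    inequality of the product, so the two halves have the same components: the real
    component is affine, and [g] has locally constant speed. *)
Lemma product_geodesic (g : R -> M) (sigma : R -> R) (N : nat) (C l0 : R) :
  (0 < N)%N -> 0 < C -> 0 <= l0 ->
  (forall s t, 0 <= s <= 1 -> 0 <= t <= 1 -> `|s - t| <= N%:R^-1 ->
    (C * d (g s) (g t)) ^+ 2 + (sigma s - sigma t) ^+ 2 = (l0 * `|s - t|) ^+ 2) ->
  (forall t, 0 <= t <= 1 -> sigma t = (1 - t) * sigma 0 + t * sigma 1) /\
  is_local_geodesic 0 1 g.
Proof.
move=> N0 C0 l00 loc.
have Np : 0 < N%:R :> R by rewrite ltr0n.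
have lip1 s t : 0 <= s <= 1 -> 0 <= t <= 1 -> `|s - t| <= N%:R^-1 ->
    `|sigma s - sigma t| <= l0 * `|s - t|.
  move=> s01 t01 st; rewrite ler_norml; apply: abs_le_of_sqr; first exact: mulr_ge0.
  by rewrite -loc// lerDr sqr_ge0.
have lip s t : 0 <= s <= 1 -> 0 <= t <= 1 -> `|sigma s - sigma t| <= l0 * `|s - t|.
  move=> s01 t01; pose y i := s + i%:R / N%:R * (t - s).
  have y01 i : (i <= N)%N -> 0 <= y i <= 1.
    move=> iN; have i0 : 0 <= i%:R / N%:R :> R by rewrite divr_ge0.
    have i1 : i%:R / N%:R <= 1 :> R by rewrite ler_pdivrMr// mul1r ler_nat.
    by rewrite /y; move: (_ / _) i0 i1 => v v0 v1; apply/andP; split; nra.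
  have st1 : `|s - t| <= 1 by rewrite ler_norml; lra.
  have step i : `|y i - y i.+1| = N%:R^-1 * `|s - t|.
    have -> : y i - y i.+1 = N%:R^-1 * (s - t).
      by rewrite /y -natr1; field; rewrite gt_eqF.
    by rewrite normrM gtr0_norm// invr_gt0.
  have ind i : (i <= N)%N -> `|sigma s - sigma (y i)| <= i%:R * (l0 * (N%:R^-1 * `|s - t|)).
    elim: i => [_|i IH iN]; first by rewrite /y !mul0r addr0 subrr normr0.
    have h := lip1 _ _ (y01 i (ltnW iN)) (y01 i.+1 iN).
    rewrite step in h; have {}h := h ltac:(by rewrite ler_piMr// invr_ge0 ltW).
    have := ler_normD (sigma s - sigma (y i)) (sigma (y i) - sigma (y i.+1)).
    rewrite addrA subrK => /le_trans; apply; rewrite -natr1 mulrDl mul1r.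
    by apply: lerD => //; apply: IH; exact: ltnW.
  have := ind N (leqnn N); have -> : y N = t by rewrite /y divff ?gt_eqF//; ring.
  by have -> : N%:R * (l0 * (N%:R^-1 * `|s - t|)) = l0 * `|s - t| by field; rewrite gt_eqF.
have mid t : 0 < t < 1 -> exists2 e, 0 < e & forall n, 0 < n < e ->
    sigma t = (sigma (t - n) + sigma (t + n)) / 2.
  move=> t01; exists (Num.min (N%:R^-1 / 2) (Num.min t (1 - t))).
    by rewrite !lt_min divr_gt0 ?invr_gt0//=; lra.
  move=> n /andP[n0]; rewrite !lt_min => /and3P[nN nt nt1].
  have h1 := loc (t - n) t ltac:(lra) ltac:(lra).
  have h2 := loc t (t + n) ltac:(lra) ltac:(lra).
  have h3 := loc (t - n) (t + n) ltac:(lra) ltac:(lra).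
  have E1 : t - n - t = - n by ring.
  have E2 : t - (t + n) = - n by ring.
  have E3 : t - n - (t + n) = - (2 * n) by ring.
  rewrite E1 normrN gtr0_norm// in h1; rewrite E2 normrN gtr0_norm// in h2.
  rewrite E3 normrN gtr0_norm ?mulr_gt0// in h3.
  have {}h1 := h1 ltac:(lra); have {}h2 := h2 ltac:(lra); have {}h3 := h3 ltac:(lra).
  have := ler_wpM2l (ltW C0) (metric_triangle (g (t - n)) (g t) (g (t + n))).
  have D0 : 0 <= C * d (g (t - n)) (g (t + n)) by rewrite mulr_ge0 ?mdist_ge0// ltW.
  move: D0 h1 h2 h3; rewrite mulrDr; move: (C * _) (C * _) (C * _) => B A D.
  move: (sigma _) (sigma _) (sigma _) => z y x D0 h1 h2 h3 tri.
  have D2 : D ^+ 2 <= (A + B) ^+ 2 by rewrite ler_sqr ?nnegrE//; lra.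
  have : (x - y - (y - z)) ^+ 2 = 0.
    apply/eqP; rewrite eq_le sqr_ge0 andbT.
    have := sqr_ge0 (A - B); lra.
  move=> /eqP; rewrite sqrf_eq0 => /eqP; lra.
have aff t : 0 <= t <= 1 -> sigma t = (1 - t) * sigma 0 + t * sigma 1.
  move=> t01; apply/eqP; rewrite eq_le; apply/andP; split.
    apply: (local_midpoint_convex lip) => // u /mid[e e0 He].
    by exists e => // n /He ->.
  rewrite -lerN2.
  have -> : - ((1 - t) * sigma 0 + t * sigma 1) = (1 - t) * - sigma 0 + t * - sigma 1 by ring.
  apply: (@local_midpoint_convex R (fun u => - sigma u) l0) => //.
    by move=> u v u01 v01; rewrite -opprD normrN; exact: lip.
  move=> u /mid[e e0 He]; exists e => // n /He; lra.
split=> //; split=> //.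
pose v := sigma 1 - sigma 0.
have sub s t : 0 <= s <= 1 -> 0 <= t <= 1 -> sigma s - sigma t = (s - t) * v.
  by move=> s01 t01; rewrite (aff s)// (aff t)// /v; ring.
have sq s t : 0 <= s <= 1 -> 0 <= t <= 1 -> `|s - t| <= N%:R^-1 ->
    (C * d (g s) (g t)) ^+ 2 = (l0 ^+ 2 - v ^+ 2) * `|s - t| ^+ 2.
  move=> s01 t01 st; have := loc s t s01 t01 st; rewrite sub//.
  by rewrite real_normK ?num_real// exprMn [in RHS]exprMn real_normK ?num_real//; lra.
have M1 : N%:R^-1 <= 1 :> R by rewrite invf_le1// ler1n.
have M0 : 0 < N%:R^-1 :> R by rewrite invr_gt0.
have W0 : 0 <= l0 ^+ 2 - v ^+ 2.
  have := sq 0 N%:R^-1; rewrite lexx ler01 (ltW M0) M1 sub0r normrN gtr0_norm// lexx.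
  move=> /(_ isT isT isT) E.
  by rewrite -(pmulr_lge0 _ (exprn_gt0 2 M0)) -E sqr_ge0.
exists (Num.sqrt (l0 ^+ 2 - v ^+ 2) / C); first by rewrite divr_ge0 ?sqrtr_ge0 ?ltW.
move=> c _; exists (N%:R^-1 / 2); first by rewrite divr_gt0.
move=> s t; rewrite !in_itv/= => s01 t01; rewrite !ltr_norml => sc tc.
have Cn0 : C != 0 by rewrite gt_eqF.
apply: (mulfI Cn0); apply/eqP; rewrite -(@eqrXn2 _ 2)//; last 2 first.
- by rewrite mulr_ge0 ?mdist_ge0// ltW.
- by rewrite !mulr_ge0 ?sqrtr_ge0 ?invr_ge0// ltW.
rewrite sq//; last by rewrite ler_norml; lra.
have -> : C * (Num.sqrt (l0 ^+ 2 - v ^+ 2) / C * `|s - t|) =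
    Num.sqrt (l0 ^+ 2 - v ^+ 2) * `|s - t| by field; rewrite gt_eqF.
by rewrite exprMn sqr_sqrtr.
Qed.

End flat_products.

(** * Blow-up at a point of the core *)

Section blow_up.
Context {R : realType} {X : metricType R} (k : R) (o : X).
Context (H : in_open_hemisphere k o).
Local Notation d := mdist.
Local Notation cone := (cone_over H).
Context (G : X -> X -> R -> X).
Hypothesis GP : forall x y, [/\ geodesic01 (G x y), G x y 0 = x & G x y 1 = y].
Context (seg : cone -> cone -> R -> cone) (f : cone -> cone -> R -> R).
Hypothesis segP : forall z w, is_lift (G (base z) (base w)) z w (seg z w) (f z w).
Context (D : set cone).
Hypothesis HS : locally_relative_cat0 D seg.
Context (c : cone) (th : R).
Hypothesis Dc : D c.
Hypothesis th01 : 0 < th < 1.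
Implicit Types (z w p : cone) (F : nat -> R -> cone) (s t u e : R).
Local Notation dsqr := (direction_sqr GP c).
Local Notation T := (tangent_space (base c)).

Let th_gt0 j : 0 < th ^+ j.
Proof. by rewrite exprn_gt0//; case/andP: th01. Qed.

Let th_itv j : 0 <= th ^+ j <= 1.
Proof. by rewrite ltW//= exprn_ile1//; case/andP: th01 => /ltW ? /ltW. Qed.

Let al j := (th ^+ j)^-1.

Let al_gt0 j : 0 < al j.
Proof. by rewrite invr_gt0. Qed.

Let al_ge0 j : 0 <= al j := ltW (al_gt0 j).

Let al_th j i : al j * th ^+ (j + i) = th ^+ i.
Proof. by rewrite exprD mulKf// gt_eqF. Qed.

Let al_add j i : al j = th ^+ i * al (j + i).
Proof. by rewrite /al exprD invfM mulrCA divff ?mulr1// gt_eqF. Qed.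

Let seg_al z j i u : 0 <= al (j + i) * u <= 1 ->
  seg c z (al j * u) = seg c (seg c z (th ^+ i)) (al (j + i) * u).
Proof.
by move=> u01; rewrite (seg_segD HS)// (al_add j i); congr seg; ring.
Qed.

Definition shrinks_to F : Prop := forall e, 0 < e -> exists J : nat,
  forall (j i : nat) s, (J <= j)%N -> 0 <= s <= 1 ->
    d (seg c (F j s) (th ^+ i)) (F (j + i)%N s) <= e * th ^+ (j + i).

(** [F (j + i)] is nearly the image of [F j] under the homothety of ratio [th ^+ i],
    so that both have nearly the same direction at [c] once rescaled. *)
Lemma rescaled_cauchy F : shrinks_to F -> forall e, 0 < e -> exists J : nat,
  forall (j i : nat) s, (J <= j)%N -> 0 <= s <= 1 ->
    dsqr (F j s) (al j) (F (j + i)%N s) (al (j + i)) <= e ^+ 2.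
Proof.
move=> HF e e0; have [J HJ] := HF e e0; exists J => j i s Jj s01.
apply: (direction_sqr_le GP segP); rewrite ?(ltW e0)//.
near=> u; have u01 : 0 <= al (j + i) * u <= 1 by near: u; exact: near_right_scale.
rewrite (seg_al _ u01); apply: le_trans (homothety HS _ _ Dc u01) _.
apply: le_trans (ler_wpM2l _ (HJ j i s Jj s01)) _; first by case/andP: u01.
have -> : al (j + i) * u * (e * th ^+ (j + i)) = (al (j + i) * th ^+ (j + i)) * (e * u) by ring.
by rewrite mulVf ?mul1r// gt_eqF.
Unshelve. all: by end_near. Qed.

Let rk : 0 < radius c * k.
Proof. by rewrite mulr_gt0 ?radius_gt0 ?(k_gt0 H). Qed.

Definition direction F j s : T := tangent_vector (ray GP c (F j s) (al j)).
Definition radial F j s : R := al j * radial_speed c (F j s).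

Lemma direction_sqr_dist F F' i j s t e : 0 <= e ->
  dsqr (F i s) (al i) (F' j t) (al j) <= e ^+ 2 ->
  radius c * k * d (direction F i s) (direction F' j t) <= e /\
  `|radial F i s - radial F' j t| <= e.
Proof.
move=> e0; rewrite /direction_sqr -/(direction F i s) -/(direction F' j t).
rewrite -/(radial F i s) -/(radial F' j t) mulrA.
set x := _ * d _ _; set y := _ - _ => h; split.
  by apply: le_of_sqr => //; have := sqr_ge0 y; lra.
by rewrite ler_norml; apply: abs_le_of_sqr => //; have := sqr_ge0 x; lra.
Qed.

(** [g] and [sigma] are the components, in the completed tangent space of [X] and in
    the line, of the limit of the paths [F j] seen from [c] and magnified by
    [th ^- j]. *)
Definition is_blow_up F (g : R -> metric_completion T) (sigma : R -> R) : Prop :=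
  forall s, 0 <= s <= 1 ->
    (exists2 U : {classic cauchy_seq T}, g s = \pi_(metric_completion T)%qT U &
      forall j, (U : cauchy_seq T) j = direction F j s) /\
    radial F j s @[j --> \oo] --> sigma s.

Lemma blow_up_exists F : shrinks_to F -> exists g sigma, is_blow_up F g sigma.
Proof.
move=> HF; have Hc := rescaled_cauchy HF.
suff /choice[q Hq] : forall s, exists q : metric_completion T * R, 0 <= s <= 1 ->
    (exists2 U : {classic cauchy_seq T}, q.1 = \pi_(metric_completion T)%qT U &
      forall j, (U : cauchy_seq T) j = direction F j s) /\
    radial F j s @[j --> \oo] --> q.2.
  by exists (fun s => (q s).1), (fun s => (q s).2) => s /Hq.
move=> s; have [s01|] := boolP (0 <= s <= 1); last first.
  have cst : cauchy ((fun _ : nat => direction F 0 s) @ \oo).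
    apply/cauchy_exP => e e0; exists (direction F 0 s).
    by exists 0%N => // n _; exact: ballxx.
  by exists (\pi_(metric_completion T)%qT (CauchySeq cst), 0).
have dc : cauchy ((fun j => direction F j s) @ \oo).
  apply/cauchy_exP => e e0.
  have [|J HJ] := Hc (radius c * k * (e / 2)) _; first by rewrite mulr_gt0// divr_gt0.
  exists (direction F J s); exists J => //= n /= Jn; rewrite ballEmdist/=.
  have := HJ J (n - J)%N s (leqnn _) s01; rewrite subnKC// => /direction_sqr_dist[|+ _].
    by rewrite ltW// mulr_gt0// divr_gt0.
  by rewrite ler_pM2l// => h; apply: le_lt_trans h _; lra.
have sc : cvg (radial F j s @[j --> \oo]).
  apply: cauchy_cvg; apply/cauchy_exP => e e0.
  have [|J HJ] := Hc (e / 2) _; first by rewrite divr_gt0.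
  exists (radial F J s); exists J => //= n /= Jn; rewrite /ball/=.
  have := HJ J (n - J)%N s (leqnn _) s01; rewrite subnKC// => /direction_sqr_dist[|_].
    by rewrite ltW// divr_gt0.
  by move=> h; apply: le_lt_trans h _; lra.
exists (\pi_(metric_completion T)%qT (CauchySeq dc), lim (radial F j s @[j --> \oo])) => _.
by split=> //; exists (CauchySeq dc).
Qed.

Lemma blow_up_dist F F' g g' sigma sigma' s t :
  is_blow_up F g sigma -> is_blow_up F' g' sigma' -> 0 <= s <= 1 -> 0 <= t <= 1 ->
  dsqr (F j s) (al j) (F' j t) (al j) @[j --> \oo] -->
    (radius c * k * d (g s) (g' t)) ^+ 2 + (sigma s - sigma' t) ^+ 2.
Proof.
move=> Fg Fg' s01 t01; have [[U -> HU] cs] := Fg s s01; have [[V -> HV] ct] := Fg' t t01.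
rewrite mdist_pi /=; have := @cseq_dist_cvg _ _ U V.
under eq_fun do rewrite HU HV.
move=> cd; rewrite /direction_sqr; under eq_fun do rewrite mulrA.
apply: cvgD.
  by apply: (@cvgM _ _ _ _ (fun j => _ * d (direction F j s) (direction F' j t)));
    apply: cvgMr.
by apply: (@cvgM _ _ _ _ (fun j => radial F j s - radial F' j t)); apply: cvgB.
Qed.

Let near_al (P : R -> Prop) : (\forall u \near 0^'+, P u) ->
  exists I : nat, forall i, (I <= i)%N -> P (th ^+ i).
Proof. exact: near_powers. Qed.

(** The upper bound holds for every [F j], because homotheties contract. For the lower
    bound the distance of the rays to [F j s] and [F j t] is measured at the scale
    of [F (j + i)], which they nearly meet and where it is known. *)
Lemma blow_up_local F g sigma (N : nat) (l : nat -> R) (l0 : R) :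
  (0 < N)%N -> shrinks_to F -> is_blow_up F g sigma ->
  (forall j, local_geodesic_at N (l j) (F j)) ->
  (forall e, 0 < e -> exists J : nat, forall j, (J <= j)%N -> `|l j / th ^+ j - l0| <= e) ->
  0 <= l0 /\ forall s t, 0 <= s <= 1 -> 0 <= t <= 1 -> `|s - t| <= N%:R^-1 ->
    (radius c * k * d (g s) (g t)) ^+ 2 + (sigma s - sigma t) ^+ 2 = (l0 * `|s - t|) ^+ 2.
Proof.
move=> N0 HF Fg Fl ll.
have Np : 0 < N%:R :> R by rewrite ltr0n.
have lj0 j : 0 <= l j.
  have M1 : N%:R^-1 <= 1 :> R by rewrite invf_le1// ler1n.
  have M0 : 0 < N%:R^-1 :> R by rewrite invr_gt0.
  have := Fl j 0 N%:R^-1; rewrite lexx ler01 (ltW M0) M1 sub0r normrN gtr0_norm// lexx.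
  by move=> /(_ isT isT isT) E; rewrite -(pmulr_lge0 _ M0) -E mdist_ge0.
have lc : l j / th ^+ j @[j --> \oo] --> l0.
  apply/cvgrPdist_le => e /ll[J HJ]; exists J => // j /= Jj.
  by rewrite distrC; exact: HJ.
have l00 : 0 <= l0.
  apply: (ler_cvg_to (cvg_cst (0 : R)) lc); apply: nearW => j.
  by rewrite divr_ge0// ltW.
split=> // s t s01 t01 st; have cd := blow_up_dist Fg Fg s01 t01.
pose a := `|s - t|; have a0 : 0 <= a := normr_ge0 _.
have a1 : a <= 1 by rewrite /a ler_norml; lra.
have E j : d (F j s) (F j t) = l j * a by exact: Fl.
apply/eqP; rewrite eq_le -/a; apply/andP; split.
  have cl : (l j / th ^+ j * a) ^+ 2 @[j --> \oo] --> (l0 * a) ^+ 2.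
    by apply: (@cvgM _ _ _ _ (fun j => l j / th ^+ j * a)
      (fun j => l j / th ^+ j * a)); apply: cvgMl.
  apply: (ler_cvg_to cd cl); apply: nearW => j.
  have q0 : 0 <= l j / th ^+ j * a by rewrite mulr_ge0// divr_ge0// ltW.
  apply: (direction_sqr_le GP segP) => //; near=> u.
  have u01 : 0 <= al j * u <= 1 by near: u; exact: near_right_scale.
  apply: le_trans (homothety HS _ _ Dc u01) _; rewrite E.
  by rewrite le_eqVlt; apply/orP; left; apply/eqP; rewrite /al; ring.
set A := _ + _ in cd *.
suff eps : forall e : R, 0 < e -> (l0 * a) ^+ 2 <= e + A by apply/ler_addgt0Pl => e; exact: eps.
move=> e e0; have A0 : 0 <= A by rewrite addr_ge0 ?sqr_ge0.
have [y y0 ye] : exists2 y : R, 0 < y & 8 * (l0 * a) * y <= e.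
  have l1 : 0 < 8 * (l0 + 1) by rewrite mulr_gt0// ltr_wpDl.
  exists (e / (8 * (l0 + 1))); first by rewrite divr_gt0.
  rewrite [leLHS]mulrA ler_pdivrMr//.
  have h : l0 * a <= l0 by rewrite ler_piMr.
  by have := ler_wpM2l (ltW e0) h; lra.
(* the loss [4 * y] is larger than the sum of the three errors, each at most [y] *)
have [neg|pos] := leP (l0 * a) (4 * y).
  apply: (@le_trans _ _ e); last by rewrite lerDl.
  have v0 : 0 <= l0 * a by exact: mulr_ge0.
  move: v0 neg ye e0; move: (l0 * a) => v v0 neg ye e0.
  by have := ler_wpM2l v0 neg; lra.
have [J1 H1] := HF y y0; have [J2 H2] := ll y y0.
pose q := l0 * a - 4 * y; have q0 : 0 <= q by rewrite /q; lra.
suff low : q ^+ 2 <= A.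
  rewrite /q in low; have := sqr_ge0 y; move: ye e0 low.
  by move: (l0 * a) => v; clearbody A; lra.
have := @ler_cvg_to _ _ _ _ _ _ _ _ (cvg_cst (q ^+ 2)) cd; apply.
exists (maxn J1 J2) => // j /=; rewrite geq_max => /andP[J1j J2j].
rewrite leNgt; apply/negP => Aq.
have [I HI] := near_al (direction_sqr_near segP (al_ge0 j) (al_ge0 j) q0 Aq).
have := HI (j + I)%N (leq_addl _ _); rewrite al_th => up.
have h1 := H1 j I s J1j s01; have h2 := H1 j I t J1j t01.
have h3 := H2 (j + I)%N (leq_trans J2j (leq_addr _ _)).
have := metric_triangle (F (j + I)%N s) (seg c (F j s) (th ^+ I)) (F (j + I)%N t).
have := metric_triangle (seg c (F j s) (th ^+ I)) (seg c (F j t) (th ^+ I)) (F (j + I)%N t).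
rewrite (metric_sym (F (j + I)%N s) (seg _ _ _)) E; have T0 := th_gt0 (j + I).
have h4 : (l0 - y) * th ^+ (j + I) <= l (j + I)%N.
  move: h3; rewrite ler_norml => /andP[h3 _].
  by rewrite -ler_pdivlMr//; lra.
have h5 := ler_wpM2r a0 h4.
have h6 : y * a * th ^+ (j + I) <= y * th ^+ (j + I).
  by rewrite ler_wpM2r ?(ltW T0)// ler_piMr// ltW.
have h7 := mulr_gt0 y0 T0.
move: up h1 h2 h5 h6 h7; rewrite /q.
move: (th ^+ (j + I)) => v; lra.
Unshelve. all: by end_near. Qed.

(** Equality of the limits makes the rays to [F j s] and [F' j s] close for one large
    [j]; at smaller scales both paths follow these rays. *)
Lemma blow_up_small F F' g sigma s : shrinks_to F -> shrinks_to F' ->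
  is_blow_up F g sigma -> is_blow_up F' g sigma -> 0 <= s <= 1 ->
  forall e, 0 < e -> exists J : nat, forall j, (J <= j)%N -> d (F j s) (F' j s) <= e * th ^+ j.
Proof.
move=> HF HF' Fg Fg' s01 e e0; have cd := blow_up_dist Fg Fg' s01 s01.
rewrite mdistxx mulr0 subrr expr0n/= addr0 in cd.
have e30 : 0 < e / 3 by rewrite divr_gt0.
have [J1 H1] := HF _ e30; have [J2 H2] := HF' _ e30.
have [J3 _ H3] : \forall j \near \oo, dsqr (F j s) (al j) (F' j s) (al j) < (e / 3) ^+ 2.
  by apply: (cvgr_lt 0 cd); exact: exprn_gt0.
pose j0 := maxn J1 (maxn J2 J3).
have [j1 j2 j3] : [/\ (J1 <= j0)%N, (J2 <= j0)%N & (J3 <= j0)%N].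
  by split; rewrite /j0 !leq_max leqnn ?orbT.
have [I HI] := near_al (direction_sqr_near segP (al_ge0 j0) (al_ge0 j0) (ltW e30) (H3 j0 j3)).
exists (j0 + I)%N => j jI.
have -> : j = (j0 + (j - j0))%N by rewrite subnKC// (leq_trans (leq_addr _ _) jI).
set i := (j - j0)%N.
have Ii : (I <= j0 + i)%N.
  by rewrite /i subnKC ?(leq_trans (leq_addl _ _) jI)// (leq_trans (leq_addr _ _) jI).
have := HI _ Ii; rewrite al_th => up.
have h1 := H1 j0 i s j1 s01; have h2 := H2 j0 i s j2 s01.
have := metric_triangle (F (j0 + i)%N s) (seg c (F j0 s) (th ^+ i)) (F' (j0 + i)%N s).
have := metric_triangle (seg c (F j0 s) (th ^+ i)) (seg c (F' j0 s) (th ^+ i)) (F' (j0 + i)%N s).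
rewrite (metric_sym (F (j0 + i)%N s) (seg _ _ _)).
move: up h1 h2; move: (th ^+ (j0 + i)) => v; lra.
Qed.

Lemma blow_up_eq F F' g g' sigma sigma' s : is_blow_up F g sigma -> is_blow_up F' g' sigma' ->
  0 <= s <= 1 -> (forall j, F j s = F' j s) -> g s = g' s /\ sigma s = sigma' s.
Proof.
move=> Fg Fg' s01 FF'; have cd := blow_up_dist Fg Fg' s01 s01.
have z : dsqr (F j s) (al j) (F' j s) (al j) @[j --> \oo] --> (0 : R).
  rewrite [X in X @ _](_ : _ = fun=> 0); first exact: cvg_cst.
  by apply/funext => j; rewrite FF' /direction_sqr mdistxx subrr !mulr0 expr0n/= addr0.
have E : (radius c * k * d (g s) (g' s)) ^+ 2 + (sigma s - sigma' s) ^+ 2 = 0.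
  exact: (cvg_unique (@Rhausdorff R) cd z).
move/eqP: E; rewrite paddr_eq0 ?sqr_ge0// !sqrf_eq0 mulf_eq0 (gt_eqF rk)/= subr_eq0.
by move=> /andP[/eqP d0 /eqP s0]; split=> //; exact: mdist_positivity.
Qed.

(** Both blow-ups are local geodesics between the same points of the completed
    tangent space, and their radial components are affine with the same ends. *)
Lemma blow_up_unique x y F F' :
  unique_local_geodesics (metric_completion T) ->
  asymptotic_geodesics seg c x y th F -> asymptotic_geodesics seg c x y th F' ->
  forall s, 0 <= s <= 1 -> forall e, 0 < e -> exists J : nat, forall j, (J <= j)%N ->
    d (F j s) (F' j s) <= e * th ^+ j.
Proof.
move=> uniq [ends HF [N [l [l0 [N0 loc ll]]]]] [ends' HF' [N' [l' [l0' [N0' loc' ll']]]]] s s01.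
have [g [sigma Fg]] := blow_up_exists HF; have [g' [sigma' Fg']] := blow_up_exists HF'.
have [l00 flat] := blow_up_local N0 HF Fg loc ll.
have [l00' flat'] := blow_up_local N0' HF' Fg' loc' ll'.
have [aff lg] := product_geodesic N0 rk l00 flat.
have [aff' lg'] := product_geodesic N0' rk l00' flat'.
have z01 : 0 <= (0 : R) <= 1 by rewrite lexx ler01.
have o01 : 0 <= (1 : R) <= 1 by rewrite lexx ler01.
have [|g0 s0] := blow_up_eq Fg Fg' z01.
  by move=> j; rewrite (ends j).1 (ends' j).1.
have [|g1 s1] := blow_up_eq Fg Fg' o01.
  by move=> j; rewrite (ends j).2 (ends' j).2.
have gg' t : 0 <= t <= 1 -> g t = g' t.
  move=> t01; have := uniq _ _ _ _ _ _ _ _ lg g0 g1 lg' erefl erefl t.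
  by rewrite in_itv/= /line_path !mulr0 !add0r mulr1; apply.
apply: (blow_up_small HF HF' Fg) => // t t01.
by have := Fg' t t01; rewrite gg'// (aff t)// s0 s1 -aff'.
Qed.

End blow_up.

(** * Return from the cone to the space *)

Section conclusion.
Context {R : realType} {X : metricType R} (k : R) (o : X).
Context (H : in_open_hemisphere k o).
Local Notation d := mdist.
Local Notation cone := (cone_over H).

Lemma cone_point_exists (x : X) : exists z : cone, base z = x.
Proof.
have c0 := cos_o_gt0 H x.
have cP : 1 <= (cos (k * d o x))^-1 * cos (k * d o x) by rewrite mulVf// gt_eqF.
by exists (Cone H cP).
Qed.

(** In the cone the segments are the only geodesics, so every lift of a geodesic
    of [X] is a segment. *)
Lemma spherical_cmp_of_cone (D : set cone) (seg : cone -> cone -> R -> cone)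
    (g : R -> X) (x : X) :
  relative_cat0 D seg -> geodesic01 g -> spherical_cmp k o g -> spherical_cmp k x g.
Proof.
move=> HR gg go; have [z z0] := cone_point_exists (g 0).
have [w w1] := cone_point_exists (g 1); have [p <-] := cone_point_exists x.
have [F [f Ff]] := lift_exists gg (esym z0) (esym w1) go.
apply: (lift_cmp gg (esym z0) (esym w1) Ff) => t t01.
suff -> : F t = seg z w t by exact: (cn_everywhere HR).
have o01 : 0 <= (1 : R) <= 1 by rewrite lexx ler01.
have e01 : 0 <= (0 : R) <= 1 by rewrite lexx ler01.
have dz : d (F t) z = t * d z w.
  rewrite -{1}(lift0 gg (esym z0) (esym w1) Ff) (lift_dist gg (esym z0) (esym w1) Ff)//.
  by rewrite subr0 ger0_norm//; case/andP: t01.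
have dw : d (F t) w = (1 - t) * d z w.
  rewrite -{1}(lift1 gg (esym z0) (esym w1) Ff) (lift_dist gg (esym z0) (esym w1) Ff)//.
  by rewrite distrC ger0_norm// subr_ge0; case/andP: t01.
apply: mdist_positivity; apply/eqP; rewrite -sqrf_eq0 eq_le sqr_ge0 andbT.
have := cn_everywhere HR (F t) z w t01; rewrite /cn_ineq dz dw => /le_trans; apply.
by rewrite le_eqVlt; apply/orP; left; apply/eqP; ring.
Qed.

End conclusion.

Theorem theorem4p1 (R : realType) (chi : R) (X : metricType R)
    (Delta : set X) :
  0 < chi ->
  complete_metric X ->
  geodesic_space X ->
  Delta !=set0 ->
  closed Delta ->
  geodesically_convex Delta ->
  (forall T : geodesic_triangle X,
      (exists i, Delta (vertex T i)) ->
      perimeter T < circum chi ->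
      satisfies_CAT chi T) ->
  (forall c : X, Delta c ->
      unique_local_geodesics (metric_completion (tangent_space c))) ->
  (exists2 lambda : R, 0 < lambda &
     forall x : X, ~ Delta x ->
       let B := mclosed_ball x (lambda * mdist_set x Delta) in
       complete_metric (set_type B) /\ CAT chi (set_type B)) ->
  (exists2 c : X, Delta c &
     exists2 r : R, r < circum chi / 4 & forall x : X, mdist x c < r) ->
  CAT chi X.
Proof.
move=> chi0 Xc Xg _ Dcl Dconv hA hB hC [p Dp [r rlt Hr]].
have H : in_open_hemisphere (Num.sqrt chi) p.
  split; first exact: sqrt_chi_gt0.
  exists r => //; rewrite -(ltr_pM2l (sqrt_chi_gt0 chi0)) mulrA circumE// in rlt.
  by lra.
have [G GP] := geodesics_exist Xg.
have [seg [f segP]] := lifts_exist chi0 Xg hA Dp H GP.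
have HL := cone_locally_relative_cat0 chi0 Xg Dcl Dconv hA hC Dp GP segP Xc.
have HR : relative_cat0 (cone_core Delta (H:=H)) seg.
  split=> // c x y th F F' Dc th01.
  exact: (blow_up_unique GP segP HL Dc th01 (hB _ Dc)).
apply: spherical_cmp_CAT => // [x y|x g gg]; first exact: (kdist_lt_pi H).
exact: (spherical_cmp_of_cone _ HR gg (origin_cmp chi0 Xg hA Dp H gg)).
Qed.
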